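(* For the elliptic curve quotient $X=E/(\mathbb Z/3)=\mathbb P^1_{3,3,3}$, where $E=\mathbb C/(\mathbb Z+\mathbb Z e^{2\pi\sqrt{-1}/3})$, the mirror map equals the generalized SYZ map. That is, the generalized SYZ mirror $W_{3,3,3}(x,y,z)$ equals, up to a change of the coordinates $(x,y,z)$ over $\Lambda$, the Landau-Ginzburg mirror $$W^{\mathrm{LG}}(x,y,z)=x^3+y^3+z^3+\check q(q)\,xyz,$$ where $q=q_\alpha^8$ is the Kähler parameter of $\mathbb P^1_{3,3,3}$ and $\check q(q)$ is the (inverse) mirror map.
   Context: Coefficients: $\Lambda=\{\sum_{j\ge1}a_jT^{\lambda_j}: a_j\in\mathbb C,\lambda_j\in\mathbb R,\lambda_j\to\infty\}$. For a polygon $P$, $q^{\omega(P)}$ means $T^{\mathrm{area}(P)}$. Let $q$ be the weight $T^{\mathrm{area}(\mathbb P^1_{3,3,3})}$ and $q_\alpha=T^{\mathrm{area}(\Delta)}$, $\Delta$ the minimal $XYZ$-triangle below; then $q=q_\alpha^8$. Mirror map: $q(\check q)=\exp\big(\tfrac{2\pi\sqrt{-1}}3\pi_B(\check q)/\pi_A(\check q)\big)$, with $\pi_A,\pi_B$ the standard solutions of the Picard-Fuchs equation $u''+\frac{3\check q^2}{\check q^3+27}u'+\frac{\check q}{\check q^3+27}u=0$. The inverse series is $$\check q(q)=-3a(q),\qquad a(q)=1+\frac13q^{-1}\left(\frac{\prod_{k\ge1}(1-q^k)}{\prod_{k\ge1}(1-q^{9k})}\right)^3,$$ and this formula may be taken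 as the definition of $\check q(q)$. Generalized SYZ mirror: let $\tau_0=e^{2\pi\sqrt{-1}/3}$ and let $\mathbb Z/3$ act on $E$ by multiplication by $\tau_0$. The Seidel Lagrangian $\bar L\subset\mathbb P^1_{3,3,3}=E/(\mathbb Z/3)$ is the image of the line $\frac{1+\tau_0}2+\sqrt{-1}\,\mathbb R\subset\mathbb C$. It is an immersed circle with three transverse double points $X,Y,Z$, invariant under the reflection of the orbisphere across the equator through the three cone points (on which $X,Y,Z$ lie). Its complement in the sphere consists of two triangles (upper and lower, vertices $X,Y,Z$, no cone point) and three bigons containing one cone point each. It is oriented compatibly with the boundary of the upper triangle, and has the non-trivial spin structure. A convex corner of a polygon at a double point is of type $X$ (or $Y,Z$) if near the corner the polygon projects to a triangle angle. Let $e$ be a generic point on the side of the upper triangle joining $X$ and $Z$. Then $W_{3,3,3}$ is the Lagrangian Floer potential of $\bar L$, given by $\sum_km_k(b,\dots,b)=W_{3,3,3}(x,y,z)\,e$ for $b=xX+yY+zZ$. Explicitly $$W_{3,3,3}=\sum_P(-1)^{s(P)}\frac{s(P)+s(P^{op})}{r(P)}q^{\omega(P)}x^my^nz^l .$$ The sum is over classes, modulo the deck group $\pi_1^{orb}(\mathbb P^1_{3,3,3})$ and reparametrization, of holomorphic polygons $P$ in the universal cover $\mathbb C$ with boundary on lifts of $\bar L$, having only convex corners of types $X,Y,Z$ ($m,n,l$ times respectively), with counter-clockwise boundary orientation agreeing with that of $\bar L$. Here $P^{op}$ is the reflected polygon, $s(\cdot)$ the number of lifts of $e$ on the boundary, and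 $r(P)$ the order of the group of deck rotations preserving $P$. Generalized SYZ map: the map from the Kähler parameter $q$ to the complex parameter of the family of superpotentials, $q\mapsto W_{3,3,3}$ (considered up to coordinate change). *)

(* Defs.v *)
From HB Require Import structures.
From mathcomp Require Import all_boot all_order all_algebra.
From mathcomp Require Import complex finmap.
From mathcomp Require Import all_classical all_reals all_analysis.
From mathcomp Require Import lra.
From mathcomp Require Import -(notations) mpoly.
Set Implicit Arguments.
Unset Strict Implicit.
Unset Printing Implicit Defensive.
Import Order.TTheory GRing.Theory Num.Theory.
Import numFieldNormedType.Exports.
Local Open Scope classical_set_scope.
Local Open Scope ring_scope.

(* The ring Lambda of series sum_j a_j T^(lambda_j), a_j complex, lambda_j real with
   lambda_j -> oo, as the functions lambda |-> coefficient of T^lambda whose support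
   meets every half-line ]-oo, c] in a finite set. *)
Record novikov (R : realType) := Novikov {
  ncoef :> R -> R[i];
  ncoefP : forall c : R, finite_set [set x | x <= c /\ ncoef x != 0]
}.

HB.instance Definition _ (R : realType) := gen_eqMixin (novikov R).
HB.instance Definition _ (R : realType) := gen_choiceMixin (novikov R).

Section NovikovRing.
Variable R : realType.
Implicit Types (f g h : novikov R) (c x y : R).

Lemma novikovP f g : ncoef f = ncoef g -> f = g.
Proof.
by case: f g => f Pf [g Pg] /= E; subst g; congr Novikov; exact: Prop_irrelevance.
Qed.

Fact nov_zero_subproof c : finite_set [set x : R | x <= c /\ (0 : R[i]) != 0].
Proof. by apply: (@sub_finite_set _ _ set0) => // x [_ /eqP]. Qed.

Definition nov_zero := Novikov nov_zero_subproof.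

Fact nov_opp_subproof f c : finite_set [set x | x <= c /\ - f x != 0].
Proof.
by apply: sub_finite_set (ncoefP f c) => x [xc]; rewrite oppr_eq0.
Qed.

Definition nov_opp f := Novikov (nov_opp_subproof f).

Fact nov_add_subproof f g c : finite_set [set x | x <= c /\ f x + g x != 0].
Proof.
have fin : finite_set ([set x | x <= c /\ f x != 0]
    `|` [set x | x <= c /\ g x != 0]).
  by rewrite finite_setU; split; exact: ncoefP.
apply: sub_finite_set fin => x [xc fgx].
by have [fx0|fx0] := eqVneq (f x) 0; [right|left]; split=> //;
  move: fgx; rewrite fx0 add0r.
Qed.

Definition nov_add f g := Novikov (nov_add_subproof f g).

Fact nov_addA : associative nov_add.
Proof. by move=> f g h; apply: novikovP; apply/funext => x /=; rewrite addrA. Qed.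

Fact nov_addC : commutative nov_add.
Proof. by move=> f g; apply: novikovP; apply/funext => x /=; rewrite addrC. Qed.

Fact nov_add0 : left_id nov_zero nov_add.
Proof. by move=> f; apply: novikovP; apply/funext => x /=; rewrite add0r. Qed.

Fact nov_addN : left_inverse nov_zero nov_opp nov_add.
Proof. by move=> f; apply: novikovP; apply/funext => x /=; rewrite addNr. Qed.

HB.instance Definition _ := GRing.isZmodule.Build (novikov R)
  nov_addA nov_addC nov_add0 nov_addN.

Lemma nov_lb f : exists m, forall x, f x != 0 -> m <= x.
Proof.
have /finite_seqP[s sE] := ncoefP f 0.
have [m mle] : exists m, (m <= 0) /\ forall x, x \in s -> m <= x.
  elim: s {sE} => [|a s [m [m0 IH]]]; first by exists 0.
  exists (Order.min a m); split; first by rewrite ge_min m0 orbT.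
  by move=> x; rewrite inE ge_min => /orP[/eqP->|/IH->]; rewrite ?lexx ?orbT.
exists m => x fx; have [x0|/ltW x0] := leP x 0; last exact: le_trans mle.1 x0.
have : [set x | x <= 0 /\ f x != 0] x by [].
by rewrite sE; exact: mle.2.
Qed.

Definition nov_conv f g x : R[i] := \sum_(y \in [set: R]) f y * g (x - y).

Lemma nov_convE (D : set R) f g x : finite_set D ->
    (forall y, f y != 0 -> g (x - y) != 0 -> D y) ->
  nov_conv f g x = \sum_(y \in D) f y * g (x - y).
Proof.
move=> Dfin H; apply/esym/fsbig_widen => // y [_ Dy] /=.
apply/eqP; apply: contra_notT Dy; rewrite mulf_eq0 negb_or => /andP[].
exact: H.
Qed.

Lemma nov_conv_supp f g c : exists D : set R, finite_set D /\
  forall x y, x <= c -> f y != 0 -> g (x - y) != 0 -> D y.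
Proof.
have [m mP] := nov_lb g; exists [set y | y <= c - m /\ f y != 0].
split=> [|x y xc fy gxy]; first exact: ncoefP.
split=> //; have := mP _ gxy; rewrite lerBrDr => H.
by rewrite lerBrDr addrC (le_trans H).
Qed.

Fact nov_mul_subproof f g c : finite_set [set x | x <= c /\ nov_conv f g x != 0].
Proof.
have [D [Dfin DP]] := nov_conv_supp f g c.
have [m mP] := nov_lb f.
have Efin := finite_image2 +%R Dfin (ncoefP g (c - m)).
apply: sub_finite_set Efin => x [xc].
rewrite (nov_convE Dfin) => [|y fy gxy]; last exact: DP gxy.
rewrite fsbig_finite //= => S0.
have [y /andP[_ yP]] : exists y, (y \in fset_set D) && (f y * g (x - y) != 0).
  apply: contrapT => /forallNP nex; move/negP: S0; apply; apply/eqP.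
  rewrite big_seq big1 // => y yD; apply/eqP; apply/negPn/negP => H.
  by apply: (nex y); rewrite yD.
move: yP; rewrite mulf_eq0 negb_or => /andP[fy gxy].
exists y; first exact: DP gxy.
exists (x - y); last by rewrite addrC subrK.
by split=> //; apply: lerB => //; exact: mP.
Qed.

Definition nov_mul f g := Novikov (nov_mul_subproof f g).

Fact nov_mulC : commutative nov_mul.
Proof.
move=> f g; apply: novikovP; apply/funext => x /=.
transitivity (\sum_(y \in [set: R]) f (x - y) * g (x - (x - y))).
  apply: (@reindex_fsbigT _ _ _ _ _ (fun y => x - y)).
  by exists (fun y => x - y) => y; rewrite subKr.
by apply: eq_fsbigr => y _; rewrite subKr mulrC.
Qed.

Fact nov_mulDl : left_distributive nov_mul nov_add.
Proof.
move=> f g h; apply: novikovP; apply/funext => x /=.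
have [D1 [fin1 P1]] := nov_conv_supp f h x.
have [D2 [fin2 P2]] := nov_conv_supp g h x.
have fin : finite_set (D1 `|` D2) by rewrite finite_setU.
rewrite !(@nov_convE (D1 `|` D2)) //=.
- by rewrite -fsbig_split //=; apply: eq_fsbigr => y _; rewrite mulrDl.
- by move=> y a b; right; exact: P2 b.
- by move=> y a b; left; exact: P1 b.
- move=> y a b; have [fy0|fy0] := eqVneq (f y) 0; last by left; exact: P1 b.
  by right; apply: P2 b => //; move: a; rewrite fy0 add0r.
Qed.

Definition nov_T_fun (a : R) x : R[i] := if x == a then 1 else 0.

Fact nov_T_subproof a c : finite_set [set x | x <= c /\ nov_T_fun a x != 0].
Proof.
apply: (@sub_finite_set _ _ [set a]) => // x [_]; rewrite /nov_T_fun.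
by case: (x =P a) => [->|_] //; rewrite eqxx.
Qed.

Definition nov_T a := Novikov (nov_T_subproof a).

Fact nov_mul1 : left_id (nov_T 0) nov_mul.
Proof.
move=> f; apply: novikovP; apply/funext => x /=.
rewrite (@nov_convE [set 0]) //=; last first.
  by move=> y; rewrite /nov_T_fun; case: (y =P 0) => [->|]//; rewrite eqxx.
by rewrite fsbig_set1 /= /nov_T_fun eqxx mul1r subr0.
Qed.

Fact nov_mulA : associative nov_mul.
Proof.
move=> f g h; apply: novikovP; apply/funext => x /=.
have [mf mfP] := nov_lb f; have [mg mgP] := nov_lb g; have [mh mhP] := nov_lb h.
pose Z := [set z | z <= x - mh - mg /\ f z != 0].
pose W := [set w | w <= x - mh - mf /\ g w != 0].
have Zfin : finite_set Z by exact: ncoefP.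
have Wfin : finite_set W by exact: ncoefP.
pose Y := [set z + w | z in Z & w in W].
have Yfin : finite_set Y by exact: finite_image2.
have ZW z w : f z != 0 -> g w != 0 -> h (x - z - w) != 0 -> Z z /\ W w.
  move=> fz gw /mhP H; have Hf := mfP _ fz; have Hg := mgP _ gw.
  by split; split=> //; lra.
transitivity (\sum_(z \in Z) \sum_(y \in Y) f z * (g (y - z) * h (x - y))).
  rewrite (@nov_convE Z) //=; last first.
    move=> z fz; rewrite /nov_conv => S0.
    have [w [gw hw]] : exists w, g w != 0 /\ h (x - z - w) != 0.
      apply: contrapT => /forallNP nex; move/negP: S0; apply; apply/eqP.
      apply: fsbig1 => w _; apply/eqP; rewrite mulf_eq0.
      have [//|gw /=] := eqVneq (g w) 0; apply/negPn/negP => hw.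
      by apply: (nex w).
    by have [] := ZW _ _ fz gw hw.
  apply: eq_fsbigr => z /set_mem [_ fz]; rewrite -mulr_fsumr; congr (_ * _).
  rewrite (@nov_convE [set y - z | y in Y]) /=; first last.
  - move=> w gw hw; have [Zz Ww] := ZW _ _ fz gw hw.
    by exists (z + w); [exists z => //; exists w|rewrite addrAC subrr add0r].
  - exact: finite_image.
  rewrite fsbig_image => [|a b _ _ /addIr //].
  by apply: eq_fsbigr => y _; rewrite -addrA -opprD subrKC.
rewrite exchange_fsbig //= (@nov_convE Y) //=; last first.
  move=> y S0 hy.
  have [z [fz gz]] : exists z, f z != 0 /\ g (y - z) != 0.
    apply: contrapT => /forallNP nex; move/negP: S0; apply; apply/eqP.
    apply: fsbig1 => w _; apply/eqP; rewrite mulf_eq0.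
    have [//|gw /=] := eqVneq (f w) 0; apply/negPn/negP => hw.
    by apply: (nex w).
  have hz : h (x - z - (y - z)) != 0 by rewrite -addrA -opprD subrKC.
  have [Zz Ww] := ZW _ _ fz gz hz.
  by exists z => //; exists (y - z) => //; rewrite subrKC.
apply: eq_fsbigr => y _.
have [hy0|hy0] := eqVneq (h (x - y)) 0.
  by rewrite hy0 mulr0; apply: fsbig1 => z _; rewrite !mulr0.
rewrite (@nov_convE Z) //= => [|z fz gz].
  by rewrite mulr_fsuml; apply: eq_fsbigr => z _; rewrite mulrA.
have hz : h (x - z - (y - z)) != 0 by rewrite -addrA -opprD subrKC.
by have [] := ZW _ _ fz gz hz.
Qed.

Fact nov_oner_neq0 : nov_T 0 != 0 :> novikov R.
Proof.
apply/eqP => /(congr1 (fun f : novikov R => f 0)) /=.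
by rewrite /nov_T_fun eqxx => /eqP; rewrite oner_eq0.
Qed.

HB.instance Definition _ := GRing.Zmodule_isComNzRing.Build (novikov R)
  nov_mulA nov_mulC nov_mul1 nov_mulDl nov_oner_neq0.

(* Only a unit ring structure is declared: the inverse of a series is chosen among
   the solutions of g * f = 1, when there is one. *)
Definition nov_unit : {pred novikov R} :=
  fun f => `[< exists g : novikov R, g * f = 1 >].

Definition nov_inv f := xget f [set g : novikov R | g * f = 1].

Fact nov_mulVx : {in nov_unit, left_inverse 1 nov_inv *%R}.
Proof.
move=> f; rewrite unfold_in => /asboolP[g gf]; rewrite /nov_inv.
by case: xgetP => [h _ //|/(_ g)].
Qed.

Fact nov_unitPl f g : g * f = 1 -> nov_unit f.
Proof. by move=> gf; apply/asboolP; exists g. Qed.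

Fact nov_invr_out : {in [predC nov_unit], nov_inv =1 id}.
Proof.
move=> f; rewrite inE unfold_in => /asboolPn nu; rewrite /nov_inv.
by case: xgetP => // h _ hf; case: nu; exists h.
Qed.

HB.instance Definition _ := GRing.ComNzRing_hasMulInverse.Build (novikov R)
  nov_mulVx nov_unitPl nov_invr_out.

End NovikovRing.

Section NovikovSeries.
Variable R : realType.
Implicit Types (q : novikov R).

(* Convergence in the T-adic topology; [nov_lim] is 0 on divergent sequences. *)
Definition nov_cvg (u : nat -> novikov R) (l : novikov R) :=
  forall c : R, \forall n \near \oo, forall x, x <= c -> u n x = l x.

Definition nov_lim (u : nat -> novikov R) : novikov R := xget 0 [set l | nov_cvg u l].

Definition euler_prod q : novikov R :=
  nov_lim (fun n => \prod_(1 <= k < n.+1) (1 - q ^+ k)).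

Definition cubic_a q : novikov R :=
  1 + 3%:R^-1 * q^-1 * (euler_prod q / euler_prod (q ^+ 9)) ^+ 3.

Definition inverse_mirror_map q : novikov R := - 3%:R * cubic_a q.

End NovikovSeries.

Section Orbifold.
Variable R : realType.
(* [R[i]^o] is [R[i]] with its norm topology; derivatives over it are complex. *)
Local Notation C := (R[i]^o).

(* exp(2 pi i / 3) *)
Definition tau0 : C := ((- 2^-1) +i* (Num.sqrt 3 / 2))%C.

(* The deck group (Z + Z tau0) x| Z/3 of C -> P^1_{3,3,3}: the triple (j, a, b)
   acts by z |-> tau0^j z + a + b tau0. *)
Definition deck := ('I_3 * (int * int))%type.

Definition deck_act (g : deck) (z : C) : C :=
  tau0 ^+ g.1 * z + (g.2.1)%:~R + (g.2.2)%:~R * tau0.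

Definition same_orbit (z w : C) := exists g : deck, w = deck_act g z.

Definition base_line : set C :=
  [set (1 + tau0) / 2 + 'i * (t%:C)%C | t in [set: R]].

(* The base line is oriented upwards and its lifts by deck transformations; this
   names "upper" the orbit of triangles to the left of their three sides. The
   other choice is its image under z |-> - z. *)
Definition base_left : set C := [set z | complex.Re z <= complex.Re ((1 + tau0) / 2)].

Definition lift (g : deck) : set C := deck_act g @` base_line.
Definition left_of (g : deck) : set C := deck_act g @` base_left.

Definition double_point (z : C) :=
  exists g h : deck, [/\ g.1 != h.1, lift g z & lift h z].

Definition upper_triangle (D : set C) (X Y Z : C) :=
  [/\ exists g1 g2 g3 : deck, D = left_of g1 `&` left_of g2 `&` left_of g3,
      compact D /\ D° !=set0,
      forall g : deck, D° `&` lift g = set0,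
      forall V, V \in [:: X; Y; Z] -> D V /\ double_point V
    & uniq [:: X; Y; Z]].

Definition open_side (A B e : C) :=
  exists t : R, 0 < t < 1 /\ e = ((1 - t)%:C)%C * A + (t%:C)%C * B.

Definition planar_area (D : set C) : \bar R :=
  (lebesgue_measure \x lebesgue_measure)%E
    [set w : R * R | D (w.1 +i* w.2)%C].

(* A map [pfun] considered on the closed domain [pdom] only. *)
Record pmap := PMap { pdom : set C; pfun : C -> C }.

HB.instance Definition _ := gen_eqMixin pmap.
HB.instance Definition _ := gen_choiceMixin pmap.

Definition pboundary (P : pmap) : set C := pdom P `\` (pdom P)°.

(* Near [p], the map is a homeomorphism onto a neighborhood of its value in [M]. *)
Definition locally_onto (P : pmap) (p : C) (M : set C) :=
  (exists2 V : set C, nbhs p V & set_inj (pdom P `&` V) (pfun P)) /\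
  pfun P @ within (pdom P) (nbhs p) = within M (nbhs (pfun P p)).

Definition edge_point (P : pmap) (p : C) :=
  exists g : deck, lift g (pfun P p) /\ locally_onto P p (left_of g).

(* Two transverse left half-planes always meet in a sector of angle pi/3, which is
   an angle of an upper triangle. *)
Definition corner_point (P : pmap) (p : C) :=
  exists g h : deck, [/\ g.1 != h.1, lift g (pfun P p), lift h (pfun P p)
    & locally_onto P p (left_of g `&` left_of h)].

(* Rigid (hence immersed) holomorphic polygons with convex corners. The domain is
   any planar convex body rather than the closed unit disc only: every such body is
   conformally equivalent to the closed disc, homeomorphically up to the boundary
   (Riemann, Caratheodory), so the classes modulo reparametrization are the same.
   At interior points the last condition follows from the first two. *)
Definition polygon (P : pmap) :=
  [/\ compact (pdom P), @convex_set R[i] C (pdom P), (pdom P)° !=set0,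
      (forall p, (pdom P)° p -> [/\ derivable (pfun P) p 1,
         'D_1 (pfun P) p != 0 & locally_onto P p [set: C]])
    & (forall p, pboundary P p -> edge_point P p \/ corner_point P p)].

Definition reparametrization (P Q : pmap) :=
  exists phi : C -> C,
    [/\ set_bij (pdom P) (pdom Q) phi, {within pdom P, continuous phi},
        (forall p, (pdom P)° p -> derivable phi p 1)
      & (forall p, pdom P p -> pfun Q (phi p) = pfun P p)].

Definition deck_pmap (g : deck) (P : pmap) := PMap (pdom P) (deck_act g \o pfun P).

Definition polygon_class (P : pmap) : set pmap :=
  [set Q | polygon Q /\ exists g : deck, reparametrization (deck_pmap g P) Q].

(* z |-> - conj z is a lift of the reflection of the orbisphere across the equator,
   the imaginary axis being a lift of the equator; the conjugation of the domain
   keeps the map holomorphic. *)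
Definition reflect (P : pmap) :=
  PMap (Num.conj @` pdom P) (fun z => - (pfun P z^*)^*).

(* The number of elements of a finite set; 0 on infinite sets. *)
Definition ncard (T : choiceType) (A : set T) : nat := (#|` fset_set A|)%fset.

Definition corner_number (P : pmap) (V : C) : nat :=
  ncard [set p | [/\ pboundary P p, corner_point P p & same_orbit V (pfun P p)]].

Definition s_number (e : C) (P : pmap) : nat :=
  ncard [set p | pboundary P p /\ same_orbit e (pfun P p)].

Definition r_number (P : pmap) : nat :=
  ncard [set g : deck | reparametrization (deck_pmap g P) P].

(* The symplectic area: the Lebesgue measure of the image with multiplicities. *)
Definition polygon_area (P : pmap) : \bar R :=
  (\int[lebesgue_measure \x lebesgue_measure]_w
    counting [set p | pdom P p /\ pfun P p = (w.1 +i* w.2)%C])%E.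

Definition polygon_classes (X Y Z : C) (m n l : nat) (a : R) : set (set pmap) :=
  [set polygon_class P | P in [set P | [/\ polygon P,
     [/\ corner_number P X = m, corner_number P Y = n & corner_number P Z = l]
   & polygon_area P = a%:E]]].

Definition polygon_weight (e : C) (P : pmap) : R[i] :=
  (-1) ^+ s_number e P *
  (s_number e P + s_number e (reflect P))%:R / (r_number P)%:R.

Definition class_weight (e : C) (K : set pmap) : R[i] :=
  polygon_weight e (xget (PMap set0 id) K).

End Orbifold.

Section Superpotential.
Variable R : realType.
Local Notation C := (R[i]^o).
Local Notation "'Lambda'" := (novikov R).
Local Notation Lxyz := (mpoly 3 Lambda).
Local Notation var i := (mpolyX Lambda (mnm1 (i : 'I_3))).

Definition monomial3 (m n l : nat) : multinom 3 :=
  Multinom [tuple m; n; l].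

(* [W] is the generalized SYZ mirror W_{3,3,3}: for every real [a], the coefficient
   of T^a x^m y^n z^l is the signed count of polygon classes of area [a]. *)
Definition Floer_potential (X Y Z e : C) (W : Lxyz) :=
  forall (m n l : nat) (a : R),
    finite_set (polygon_classes X Y Z m n l a) /\
    mcoeff (monomial3 m n l) W a =
      \sum_(K \in polygon_classes X Y Z m n l a) class_weight e K.

Definition W_LG (c : Lambda) : Lxyz :=
  let x := var (inord 0) in let y := var (inord 1) in let z := var (inord 2) in
  x ^+ 3 + y ^+ 3 + z ^+ 3 + c *: (x * y * z).

Definition coordinate_change (f : 3.-tuple Lxyz) :=
  exists g : 3.-tuple Lxyz, forall i : 'I_3,
    comp_mpoly g (tnth f i) = var i /\ comp_mpoly f (tnth g i) = var i.

Definition equal_up_to_coordinates (W W' : Lxyz) :=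
  exists f : 3.-tuple Lxyz, coordinate_change f /\ comp_mpoly f W = W'.

End Superpotential.

(* Main.v *)
(** A holomorphic polygon is a locally convex immersion of a compact connected planar
    set.  Shortening chains of points in its domain (Birkhoff's curve shortening) shows
    that it is injective with convex image; hence its image is an equilateral triangle
    cut out by three lifts of the Lagrangian, whose side is an odd multiple [2n+1] of the
    side of the minimal triangle.  If [3] does not divide [2n+1] there is one class, with
    corners [X], [Y], [Z] and weight [(-1)^(n+1) (2n+1)]; if [2n+1 = 3(2p+1)] the three
    corners have the same type, and the weight is [(-1)^(p+1) (2p+1)] for [x^3] and
    [z^3] and its opposite for [y^3].  So
    [W = phi (x^3 - y^3 + z^3) + psi x y z], and Jacobi's identity
    [prod (1 - q^k)^3 = sum (-1)^j (2j+1) q^(j(j+1)/2)] gives, with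
    [E(q) = prod (1 - q^k)] and [qa = q_alpha],
    [phi = - qa^9 E(q^9)^3] and [psi = - (qa E(q)^3 + 3 qa^9 E(q^9)^3)].
    Rescaling [x], [y], [z] by a cube root of [1 / phi], with the opposite sign for [y],
    turns [psi] into [- 3 a(q)]. *)
Require Import Defs.
From mathcomp Require Import all_boot all_order all_algebra.
From mathcomp Require Import complex finmap.
From mathcomp Require Import all_classical all_reals all_analysis.
From mathcomp Require Import measurable_realfun ring lra zify.
From mathcomp Require Import -(notations) mpoly.
Import Normc.
Import Order.TTheory GRing.Theory Num.Theory.
Import numFieldNormedType.Exports.
Set Implicit Arguments.
Unset Strict Implicit.
Unset Printing Implicit Defensive.
Local Open Scope classical_set_scope.
Local Open Scope ring_scope.

(** * Locally convex immersions *)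


(** The obstacle is that a polygon is only controlled locally and could a priori overlap itself. Its
    domain is convex, and so is each local model (plane, half-plane, sector of angle pi/3); this is
    what lets the local statements globalize. What remains is integer arithmetic. In the coordinates
    [u j], whose sum is 0, the lifts are the lines [u j = 1/4 + k/2], a triangle is a triple [k] of
    integers, and a deck transformation rotates the three indices and adds integers of sum 0 that
    are congruent modulo 3. Hence a deck orbit of triangles is given by the sum of [k] and, up to
    rotation, by the differences [k j - k (j + 1)] modulo 3, and the marked points on the sides are
    counted by residues. Areas are odd squares times the minimal one; since
    [(2j+1)^2 = 1 + 8 j(j+1)/2], Jacobi's series appears with [q = qa^8]. In [psi] the term
    [3 qa^9 E(q^9)^3] removes from [qa E(q)^3] exactly the sides that are multiples of 3. *)

Section PlaneTopology.
Variable R : realType.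
Local Notation C := (R[i]^o).
Implicit Types (p x y z : C) (V K : set C).

(** The norm of [C] takes values in [R[i]]; this real-valued version gives access to the linear
    order of [R]. *)
Definition cdist x y : R := normc (x - y : R[i]).

Lemma cdistE x y : `|x - y : C| = ((cdist x y)%:C)%C.
Proof. by []. Qed.

Lemma cdist0 x : cdist x x = 0.
Proof. by rewrite /cdist subrr normc0. Qed.

Lemma cdistC x y : cdist x y = cdist y x.
Proof. by rewrite /cdist -opprB normcN. Qed.

Lemma cdist_ge0 x y : 0 <= cdist x y.
Proof. by rewrite -ler0c -cdistE normr_ge0. Qed.

Lemma cdist_eq0 x y : cdist x y = 0 -> x = y.
Proof. by move=> /eq0_normc /eqP; rewrite subr_eq0 => /eqP. Qed.

Lemma cdist_triangle x y z : cdist x z <= cdist x y + cdist y z.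
Proof. by rewrite /cdist -[x - z](subrKA y) le_normcD. Qed.

Lemma nbhsCP p V :
  nbhs p V <-> exists2 e : R, 0 < e & forall x, cdist x p < e -> V x.
Proof.
split=> [/(nbhs_normP p V)[e /= e0 H]|[e e0 H]].
  have eR : e = ((complex.Re e)%:C)%C by rewrite RRe_real // gtr0_real.
  exists (complex.Re e); first by rewrite -ltcR -eR.
  by move=> x; rewrite cdistC -ltcR -eR => /H.
apply/(nbhs_normP p V); exists ((e%:C)%C); first by rewrite /= ltcR.
by move=> x /=; rewrite -/(ball_ _ _ _) /= ltcR -/(cdist _ _) cdistC; exact: H.
Qed.

Lemma near_cdist p (e : R) : 0 < e -> \forall x \near p, cdist x p < e.
Proof. by move=> e0; apply/nbhsCP; exists e. Qed.

Lemma Re_cdist x y : `|complex.Re x - complex.Re y| <= cdist x y.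
Proof.
by rewrite -lecR -cdistE -raddfB; exact: normc_ge_Re.
Qed.

Lemma Im_cdist x y : `|complex.Im x - complex.Im y| <= cdist x y.
Proof.
case: x y => [a b] [c d]; rewrite /cdist /= -(sqrtr_sqr (b - d)).
by apply: ler_wsqrtr; rewrite lerDr sqr_ge0.
Qed.

Lemma cdist_ReIm x y :
  cdist x y <= `|complex.Re x - complex.Re y| + `|complex.Im x - complex.Im y|.
Proof.
case: x y => [a b] [c d]; rewrite /cdist /=.
rewrite -[leRHS]ger0_norm ?addr_ge0 // -[leRHS]sqrtr_sqr.
apply: ler_wsqrtr; rewrite [leRHS]sqrrD !real_normK ?num_real //.
by rewrite lerD2r lerDl mulrn_wge0 // mulr_ge0.
Qed.

Lemma Re_continuous : continuous (fun z : C => complex.Re z).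
Proof.
move=> p; apply/(cvgrPdist_lt (F := nbhs p)) => e e0.
apply: filterS (near_cdist p e0) => x; rewrite distrC.
exact: le_lt_trans (Re_cdist _ _).
Qed.

Lemma Im_continuous : continuous (fun z : C => complex.Im z).
Proof.
move=> p; apply/(cvgrPdist_lt (F := nbhs p)) => e e0.
apply: filterS (near_cdist p e0) => x; rewrite distrC.
exact: le_lt_trans (Im_cdist _ _).
Qed.

(** Lebesgue number lemma for a relation. The near-covering form of compactness, applied to the
    filter of small positive [d], replaces the choice of a finite subcover. *)
Lemma compact_uniform (K : set C) (Phi : C -> C -> Prop) : compact K ->
    (forall k, K k -> exists2 e : R, 0 < e &
      forall x z, K x -> K z -> cdist x k < e -> cdist z k < e -> Phi x z) ->
  exists2 d : R, 0 < d & forall x z, K x -> K z -> cdist x z < d -> Phi x z.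
Proof.
move=> /compact_near_coveringP cK loc.
have := cK _ (0 : R)^'+
  (fun d x => K x -> forall z, K z -> cdist x z < d -> Phi x z) _.
case=> [k Kk|].
  have [e e0 H] := loc k Kk; near=> x d => /= Kx z Kz xz.
  have xk : cdist x k < e / 2.
    by near: x; apply: near_cdist; rewrite divr_gt0.
  have dk : d < e / 2 by near: d; apply: nbhs_right_lt; rewrite divr_gt0.
  apply: H => //; first by lra.
  have := cdist_triangle z x k; rewrite (cdistC z x); lra.
move=> e /= e0 H; exists (e / 2); first by rewrite divr_gt0.
move=> x z Kx; apply: (H (e / 2)) => //=; last by rewrite divr_gt0.
by rewrite sub0r normrN gtr0_norm ?divr_gt0 // gtr_pMr // invf_lt1 // ltr1n.
Unshelve. all: by end_near. Qed.

End PlaneTopology.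

(** * Segments and squared distances in the plane *)

Section Segments.
Variable R : realType.
Local Notation C := (R[i]^o).
Implicit Types (x y z p q a b : C) (t : R).

Definition seg a b t : C := ((1 - t)%:C)%C * a + (t%:C)%C * b.

Definition sqn z : R := complex.Re z ^+ 2 + complex.Im z ^+ 2.

Lemma complex_ext x y :
  complex.Re x = complex.Re y -> complex.Im x = complex.Im y -> x = y.
Proof. by case: x y => [a b] [c d] /= -> ->. Qed.

Lemma ReB x y : complex.Re (x - y) = complex.Re x - complex.Re y.
Proof. by case: x y => [a b] [c d]. Qed.

Lemma ImB x y : complex.Im (x - y) = complex.Im x - complex.Im y.
Proof. by case: x y => [a b] [c d]. Qed.

Lemma Re_seg a b t :
  complex.Re (seg a b t) = (1 - t) * complex.Re a + t * complex.Re b.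
Proof. by case: a b => [? ?] [? ?]; rewrite /seg /= !mul0r !subr0. Qed.

Lemma Im_seg a b t :
  complex.Im (seg a b t) = (1 - t) * complex.Im a + t * complex.Im b.
Proof. by case: a b => [? ?] [? ?]; rewrite /seg /= !mul0r !addr0. Qed.

Lemma seg0 a b : seg a b 0 = a.
Proof. by apply: complex_ext; rewrite ?Re_seg ?Im_seg; lra. Qed.

Lemma seg1 a b : seg a b 1 = b.
Proof. by apply: complex_ext; rewrite ?Re_seg ?Im_seg; lra. Qed.

Lemma sqn_ge0 z : 0 <= sqn z.
Proof. by rewrite addr_ge0 ?sqr_ge0. Qed.

Lemma sqn_eq0 z : sqn z = 0 -> z = 0.
Proof.
move=> /eqP; rewrite paddr_eq0 ?sqr_ge0 // !sqrf_eq0 => /andP[/eqP a /eqP b].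
exact: complex_ext.
Qed.

Lemma sqn_cdist x y : sqn (x - y) = cdist x y ^+ 2.
Proof.
rewrite /sqn /cdist; case: (x - y) => a b /=.
by rewrite sqr_sqrtr // addr_ge0 ?sqr_ge0.
Qed.

Lemma sqn_seg a b (t u : R) :
  sqn (seg a b t - seg a b u) = (t - u) ^+ 2 * sqn (a - b).
Proof. by rewrite /sqn !ReB !ImB !Re_seg !Im_seg; ring. Qed.

Lemma cdist_seg a b (t u : R) :
  cdist (seg a b t) (seg a b u) = `|t - u| * cdist a b.
Proof.
apply/eqP; rewrite -(@eqrXn2 _ 2) // ?mulr_ge0 ?cdist_ge0 //.
by rewrite -sqn_cdist sqn_seg exprMn -sqn_cdist real_normK // num_real.
Qed.

(** Parallelogram identity: the midpoint is the unique minimizer of [sqn (a - y) + sqn (y - b)],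
    which drives the shortening. *)
Lemma sqn_mid a b y :
  sqn (a - y) + sqn (y - b) =
    sqn (a - seg a b 2^-1) + sqn (seg a b 2^-1 - b) + 2 * sqn (y - seg a b 2^-1).
Proof. by rewrite /sqn !ReB !ImB !Re_seg !Im_seg; field. Qed.

Lemma sqn_continuous : continuous (sqn : C -> R).
Proof.
move=> z; rewrite /sqn.
have -> : (fun w : C => complex.Re w ^+ 2 + complex.Im w ^+ 2) =
  (fun w => complex.Re w * complex.Re w + complex.Im w * complex.Im w).
  by apply/funext => w; rewrite !expr2.
by apply: (@cvgD _ R^o _ (nbhs z)); apply: (@cvgM _ _ (nbhs z));
  try exact: Re_continuous; exact: Im_continuous.
Qed.

End Segments.

(** * Curve shortening: local injectivity and local convexity become global *)

Section Birkhoff.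
Variable R : realType.
Local Notation C := (R[i]^o).
Variables (K : set C) (f : C -> C).
Hypothesis cK : compact K.
Hypothesis fK : forall x, K x -> f @ within K (nbhs x) --> f x.
Hypothesis conv : forall p q (t : R), K p -> K q -> 0 <= t <= 1 -> K (seg p q t).
Hypothesis linj : forall k, K k -> exists2 e : R, 0 < e &
  forall x z, K x -> K z -> cdist x k < e -> cdist z k < e -> f x = f z -> x = z.
Hypothesis lconv : forall k (s : R), K k -> 0 < s -> exists2 e : R, 0 < e &
  forall x z, K x -> K z -> cdist x k < e -> cdist z k < e ->
  forall t : R, 0 <= t <= 1 ->
    exists m, [/\ K m, cdist m k < s & f m = seg (f x) (f z) t].

Lemma linj_uniform : exists2 d : R, 0 < d &
  forall x z, K x -> K z -> cdist x z < d -> f x = f z -> x = z.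
Proof.
by apply: (@compact_uniform _ K (fun x z => f x = f z -> x = z)) => //; exact: linj.
Qed.

Lemma lconv_uniform (s : R) : 0 < s -> exists2 d : R, 0 < d &
  forall x z, K x -> K z -> cdist x z < d -> forall t : R, 0 <= t <= 1 ->
    exists m, [/\ K m, cdist x m < s, cdist m z < s & f m = seg (f x) (f z) t].
Proof.
move=> s0; apply: (@compact_uniform _ K (fun x z => forall t : R, 0 <= t <= 1 ->
  exists m, [/\ K m, cdist x m < s, cdist m z < s & f m = seg (f x) (f z) t])).
  exact: cK.
move=> k Kk.
have s20 : 0 < s / 2 by rewrite divr_gt0.
have [e e0 H] := lconv Kk s20.
exists (Num.min e (s / 2)); first by rewrite lt_min e0.
move=> x z Kx Kz; rewrite !lt_min => /andP[xe xs] /andP[ze zs] t t01.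
have [m [Km mk fm]] := H x z Kx Kz xe ze t t01.
exists m; split=> //.
  by have := cdist_triangle x k m; rewrite (cdistC k m); lra.
by have := cdist_triangle m k z; rewrite (cdistC k z); lra.
Qed.

Lemma cvg_within_comp (T : topologicalType) (P : set T) (pr : T -> C) (v : T) :
  {for v, continuous pr} -> (forall w, P w -> K (pr w)) -> P v ->
  (f \o pr) @ within P (nbhs v) --> f (pr v).
Proof.
move=> prc PK Pv; apply: cvg_trans (fK (PK _ Pv)) => A H.
have H2 : nbhs v (fun w => K (pr w) -> A (f (pr w))) := prc _ H.
change (nbhs v (fun w => P w -> A (f (pr w)))).
by apply: filterS H2 => w HA Pw; exact: HA (PK _ Pw).
Qed.

(** On the compact set of pairs with [s <= cdist x z <= d], the continuous function
    [sqn (f x - f z)] attains its minimum, which injectivity makes positive. *)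
Lemma expanding (d s : R) :
    (forall x z, K x -> K z -> cdist x z <= d -> f x = f z -> x = z) -> 0 < s ->
  exists2 e : R, 0 < e & forall x z, K x -> K z -> cdist x z <= d ->
    sqn (f x - f z) < e -> cdist x z < s.
Proof.
move=> inj s0.
pose cd (w : C * C) : R := Num.sqrt (sqn (w.1 - w.2)).
have cdE x z : cd (x, z) = cdist x z.
  by rewrite /cd sqn_cdist sqrtr_sqr ger0_norm // cdist_ge0.
have cdc : continuous cd.
  move=> w; apply: (@continuous_comp _ _ _ (fun w : C * C => sqn (w.1 - w.2))
    (@Num.sqrt R)); last exact: sqrt_continuous.
  apply: (@continuous_comp _ _ _ (fun w : C * C => w.1 - w.2)
    (@sqn R)); last exact: sqn_continuous.
  by apply: (@cvgB _ C _ (nbhs w)); [exact: cvg_fst | exact: cvg_snd].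
pose P := (K `*` K) `&` ([set w | cd w <= d] `&` [set w | s <= cd w]).
have cP : compact P.
  apply: compact_closedI; first exact: compact_setX.
  have /continuous_closedP cdC := cdc.
  by apply: closedI; [exact: cdC (@closed_le R d) | exact: cdC (@closed_ge R s)].
have [P0|P0] := pselect (P !=set0); last first.
  exists 1 => // x z Kx Kz xd _; rewrite ltNge; apply/negP => sx; apply: P0.
  by exists (x, z); split=> //; split; rewrite /= cdE.
have [] := @compact_EVT_min _ R (fun w => sqn (f w.1 - f w.2)) P P0 cP.
  apply/subspace_continuousP => w Pw.
  apply: (@cvg_comp _ _ _ (fun w : C * C => f w.1 - f w.2) (@sqn R) _
    (nbhs (f w.1 - f w.2))); last exact: sqn_continuous.
  apply: (@cvgB _ C _ (within P (nbhs w))).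
    apply: (@cvg_within_comp _ P fst w _ _ Pw); first exact: cvg_fst.
    by move=> u [[]].
  apply: (@cvg_within_comp _ P snd w _ _ Pw); first exact: cvg_snd.
  by move=> u [[]].
move=> w; rewrite inE => Pw wmin.
exists (sqn (f w.1 - f w.2)).
  rewrite lt_neqAle sqn_ge0 andbT; apply/eqP => /esym/sqn_eq0/eqP.
  move: Pw; case: w {wmin} => x z [[/= Kx Kz] [/=]]; rewrite cdE => xd sx.
  rewrite subr_eq0 => /eqP fxz.
  move: sx; rewrite (inj x z) // cdist0 leNgt s0 //.
move=> x z Kx Kz xd; rewrite ltNge => /negP fxz; rewrite ltNge; apply/negP => sx.
by apply: fxz; apply: (wmin (x, z)); rewrite inE; split=> //; split; rewrite /= cdE.
Qed.

(** Discrete path from [p] to [q], with steps at most [d] in the domain and energy below [e] in the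
    image. Unlike the length, the energy becomes arbitrarily small by subdivision. *)
Definition fine_chain (d e : R) (p q : C) := exists (N : nat) (x : nat -> C),
  [/\ x 0%N = p, x N = q, forall i, K (x i),
      forall i, (i < N)%N -> cdist (x i) (x i.+1) <= d
    & \sum_(0 <= i < N) sqn (f (x i) - f (x i.+1)) < e].

Lemma fine_chain_refl (d e : R) p : K p -> 0 < e -> fine_chain d e p p.
Proof. by move=> Kp e0; exists 0%N, (fun=> p); split=> //; rewrite big_geq. Qed.

Lemma fine_chain_trans (d e1 e2 : R) p q r :
  fine_chain d e1 p q -> fine_chain d e2 q r -> fine_chain d (e1 + e2) p r.
Proof.
move=> [N [x [x0 xN Kx dx ex]]] [M [y [y0 yM Ky dy ey]]].
exists (N + M)%N, (fun i => if (i < N)%N then x i else y (i - N)%N); split.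
- by case: ltnP => // /[!leqn0]/eqP N0; rewrite sub0n y0 -xN N0.
- by rewrite ltnNge leq_addr addKn.
- by move=> i; case: ifP.
- move=> i iNM; case: ltnP => iN; last first.
    by rewrite ltnNge leqW //= subSn //; apply: dy; lia.
  case: ltnP => iN1; first exact: dx.
  have iE : (i.+1 = N)%N by lia.
  by rewrite iE subnn y0 -xN -{1}iE; exact: dx.
rewrite (@big_cat_nat _ _ _ N) ?leq_addr //=; apply: ltrD.
  rewrite (eq_big_nat _ _ (F2 := fun i => sqn (f (x i) - f (x i.+1)))) // => i /= iN.
  rewrite iN; case: ltnP => // iN1.
  have iE : (i.+1 = N)%N by lia.
  by rewrite iE subnn y0 -xN.
rewrite -{1}[N]add0n big_addn addKn.
rewrite (eq_big_nat _ _ (F2 := fun i => sqn (f (y i) - f (y i.+1)))) // => i /= iM.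
by rewrite !ltnNge leq_addl leqW ?leq_addl //= addnK -addSn addnK.
Qed.

Lemma fine_chain_iter (d : R) (n : nat) (x : nat -> C) : K (x 0%N) ->
    (forall i, (i < n)%N -> forall e : R, 0 < e -> fine_chain d e (x i) (x i.+1)) ->
  forall e : R, 0 < e -> fine_chain d e (x 0%N) (x n).
Proof.
elim: n => [Kx _ e e0|n IH Kx H e e0]; first exact: fine_chain_refl.
have e20 : 0 < e / 2 by rewrite divr_gt0.
rewrite (splitr e); apply: (@fine_chain_trans _ _ _ _ (x n)).
  by apply: IH => // i iN; apply: H; rewrite ltnS ltnW.
exact: H.
Qed.

Lemma fine_chain_local (d : R) : 0 < d -> exists2 s : R, 0 < s &
  forall x z, K x -> K z -> cdist x z < s -> forall e : R, 0 < e -> fine_chain d e x z.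
Proof.
move=> d0; have d20 : 0 < d / 2 by rewrite divr_gt0.
have [s s0 H] := lconv_uniform d20; exists (Num.min s (d / 2)).
  by rewrite lt_min s0.
move=> x z Kx Kz; rewrite lt_min => /andP[xz xzd] e e0.
(* Cutting the image segment into [n] equal pieces divides its energy by [n]. *)
pose n := (Num.trunc (sqn (f x - f z) / e)).+1.
have nR : 0 < n%:R :> R by rewrite ltr0n.
have t01 i : (i <= n)%N -> 0 <= (i%:R / n%:R : R) <= 1.
  by move=> iN; rewrite divr_ge0 //= ler_pdivrMr // mul1r ler_nat.
have /choice[m mP] : forall i : nat, exists m, [/\ K m,
    cdist x m < d / 2, (i = 0%N -> m = x), (i = n -> m = z) &
    (i <= n)%N -> f m = seg (f x) (f z) (i%:R / n%:R)].
  move=> i; have [->|i0] := eqVneq i 0%N.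
    by exists x; split=> //; rewrite ?cdist0 // mul0r seg0.
  have [->|iN] := eqVneq i n.
    by exists z; split=> //; rewrite divff ?gt_eqF // seg1.
  have [iltn|ngti] := leqP i n; last by exists x; split=> //; rewrite ?cdist0 //; lia.
  have [m [Km xm mz fm]] := H x z Kx Kz xz _ (t01 i iltn).
  by exists m; split=> // e1; [rewrite e1 eqxx in i0 | rewrite e1 eqxx in iN].
exists n, m; split.
- by have [_ _ ->] := mP 0%N.
- by have [_ _ _ ->] := mP n.
- by move=> i; have [] := mP i.
- move=> i iN; have [_ a _ _ _] := mP i; have [_ b _ _ _] := mP i.+1.
  by have := cdist_triangle (m i) x (m i.+1); rewrite (cdistC (m i) x); lra.
rewrite (eq_big_nat _ _ (F2 := fun i => sqn (f x - f z) / n%:R ^+ 2)); last first.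
  move=> i /= iN; have [_ _ _ _ fi] := mP i; have [_ _ _ _ fi1] := mP i.+1.
  rewrite fi ?(ltnW iN) // fi1 // sqn_seg -mulrBl.
  rewrite -[i%:R - _]opprB -natrB // subSnn.
  by rewrite exprMn sqrrN expr1n mul1r mulrC exprVn.
rewrite sumr_const_nat subn0 -(mulr_natr (_ / _)) -mulrA expr2 invfM.
rewrite divfK ?gt_eqF // ltr_pdivrMr // mulrC -ltr_pdivrMr //.
exact: truncnS_gt.
Qed.

Lemma fine_chain_exists (d e : R) p q :
  0 < d -> 0 < e -> K p -> K q -> fine_chain d e p q.
Proof.
move=> d0 e0 Kp Kq; have [s s0 H] := fine_chain_local d0.
pose n := (Num.trunc (cdist p q / s)).+1.
have nR : 0 < n%:R :> R by rewrite ltr0n.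
pose x i := if (i <= n)%N then seg p q (i%:R / n%:R) else q.
have Kx i : K (x i).
  rewrite /x; case: leqP => // iN; apply: conv => //.
  by rewrite divr_ge0 //= ler_pdivrMr // mul1r ler_nat.
have -> : p = x 0%N by rewrite /x /= mul0r seg0.
have -> : q = x n by rewrite /x leqnn divff ?gt_eqF // seg1.
apply: fine_chain_iter => // i iN; apply: H => //.
rewrite /x iN (ltnW iN) cdist_seg -mulrBl -[i%:R - _]opprB -natrB // subSnn.
rewrite normrM normrN normr1 mul1r ger0_norm ?invr_ge0 // mulrC ltr_pdivrMr //.
by rewrite mulrC -ltr_pdivrMr //; exact: truncnS_gt.
Qed.

Lemma big_nat_split2 (h : nat -> R) (N j : nat) : (j.+1 < N)%N ->
  \sum_(0 <= k < N) h k =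
    \sum_(0 <= k < j) h k + (h j + h j.+1) + \sum_(j.+2 <= k < N) h k.
Proof.
move=> jN; rewrite (@big_cat_nat _ _ _ j.+2) //=.
by rewrite !big_nat_recr //= addrA.
Qed.

Lemma arithmetic_seq (u : nat -> C) (N : nat) : (0 < N)%N ->
    (forall j, (j.+1 < N)%N -> u j.+1 = seg (u j) (u j.+2) 2^-1) ->
  forall i, (i <= N)%N -> u i = seg (u 0%N) (u N) (i%:R / N%:R).
Proof.
move=> N0 H; have NR : N%:R != 0 :> R by rewrite pnatr_eq0 -lt0n.
have AP : forall i, (i <= N)%N ->
    complex.Re (u i) = complex.Re (u 0%N) + i%:R * complex.Re (u 1%N - u 0%N) /\
    complex.Im (u i) = complex.Im (u 0%N) + i%:R * complex.Im (u 1%N - u 0%N).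
  elim/ltn_ind => i; case: i => [|[|i]] IH iN; rewrite ?ReB ?ImB.
  - by split; lra.
  - by split; lra.
  have [] := IH i _ (ltnW (ltnW iN)) => //; have [//|] := IH i.+1 _ (ltnW iN).
  have := H i iN => /(congr1 (fun z => (complex.Re z, complex.Im z))).
  rewrite Re_seg Im_seg ReB ImB => -[e1 e2] a b c d.
  rewrite -!natr1 in a b *.
  by split; lra.
move=> i iN; have [a b] := AP i iN; have [c d] := AP N (leqnn N).
by apply: complex_ext; rewrite ?Re_seg ?Im_seg ?a ?b ?c ?d; field.
Qed.

Lemma cvg_sum_nat (T : Type) (F : set_system T) (FF : Filter F)
    (u : nat -> T -> R) (l : nat -> R) N :
  (forall i, (i < N)%N -> u i @ F --> l i) ->
  (fun v => \sum_(0 <= i < N) u i v) @ F --> \sum_(0 <= i < N) l i.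
Proof.
elim: N => [|N IH] H.
  rewrite big_geq //; under eq_fun do rewrite big_geq //.
  exact: cvg_cst.
rewrite big_nat_recr //=; under eq_fun do rewrite big_nat_recr //=.
apply: (@cvgD _ R^o _ F); last exact: H.
by apply: IH => i iN; apply: H; rewrite ltnW.
Qed.

(* A chain of minimal energy [\sum_i sqn (f (x i) - f (x i.+1))] is mapped to equally
   spaced points of a segment: otherwise local convexity lets one replace a point by the
   preimage of the midpoint of its neighbours. *)
Lemma geodesic (s : R) p q : 0 < s -> K p -> K q -> exists N (x : nat -> C),
  (0 < N)%N /\ [/\ x 0%N = p, x N = q, forall i, K (x i),
    forall i, (i < N)%N -> cdist (x i) (x i.+1) < s
  & forall i, (i <= N)%N -> f (x i) = seg (f p) (f q) (i%:R / N%:R)].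
Proof.
move=> s0 Kp Kq; have [pq|pq] := pselect (p = q).
  exists 1%N, (fun=> p); split=> //; rewrite -pq; split=> // i _; first by rewrite cdist0.
  by apply: complex_ext; rewrite ?Re_seg ?Im_seg; lra.
have [d1 d10 inj1] := linj_uniform; pose d := d1 / 2.
have d0 : 0 < d by rewrite divr_gt0.
have inj x z : K x -> K z -> cdist x z <= d -> f x = f z -> x = z.
  by move=> Kx Kz xz; apply: inj1 => //; rewrite /d in xz; lra.
(* Two points closer than [s1] have an image midpoint with a preimage within [d] of both. Two
   consecutive steps below [s2] stay below [s1]. *)
have [s1 s10 mid] := lconv_uniform d0; pose s2 := Num.min (s1 / 2) s.
have s20 : 0 < s2 by rewrite lt_min s0 divr_gt0.
have [eta eta0 expd] := expanding inj s20.
have [N [x0 [x00 x0N Kx0 dx0 ex0]]] := fine_chain_exists d0 eta0 Kp Kq.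
have N0 : (0 < N)%N.
  by rewrite lt0n; apply/eqP => N0; apply: pq; rewrite -x00 -x0N N0.
pose g (v : 'rV[C]_N.+1) (i : nat) : C := v ord0 (inord i).
have gc i : continuous (fun v => g v i) by move=> v; exact: coord_continuous.
(* The chains with [N] steps, fixed ends and steps at most [d] form a compact set, so the energy has
   a minimizer on it. *)
pose S := [set v : 'rV[C]_N.+1 | forall i, K (v ord0 i)] `&`
  ([set v | g v 0%N = p] `&` [set v | g v N = q]) `&`
  (\bigcap_(i in [set i | (i < N)%N]) [set v | Num.sqrt (sqn (g v i - g v i.+1)) <= d]).
have SK v i : S v -> K (g v i) by case=> -[+ _] _; exact.
have cdE a b : Num.sqrt (sqn (a - b)) = cdist a b :> R.
  by rewrite sqn_cdist sqrtr_sqr ger0_norm // cdist_ge0.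
have cS : compact S.
  apply: compact_closedI; last first.
    apply: closed_bigI => i _.
    have /continuous_closedP : continuous (fun v => Num.sqrt (sqn (g v i - g v i.+1))).
      move=> v; apply: (@continuous_comp _ _ _ (fun v => sqn (g v i - g v i.+1))
        (@Num.sqrt R)); last exact: sqrt_continuous.
      apply: (@continuous_comp _ _ _ (fun v => g v i - g v i.+1)
        (@sqn R)); last exact: sqn_continuous.
      by apply: (@cvgB _ C _ (nbhs v)); exact: gc.
    by move=> H; exact: H (@closed_le R d).
  apply: compact_closedI; first by apply: (rV_compact (A := fun=> K)) => _; exact: cK.
  have cl (a : C) : closed [set a].
    by apply: accessible_closed_set1; apply: hausdorff_accessible; exact: norm_hausdorff.
  have /continuous_closedP g0 := gc 0%N; have /continuous_closedP gN := gc N.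
  by apply: closedI; [exact: g0 (cl p) | exact: gN (cl q)].
pose F (v : 'rV[C]_N.+1) : R := \sum_(0 <= i < N) sqn (f (g v i) - f (g v i.+1)).
pose v0 : 'rV[C]_N.+1 := \row_j x0 j.
have gv0 i : (i <= N)%N -> g v0 i = x0 i.
  by move=> iN; rewrite /g mxE inordK.
have Sv0 : S v0.
  split; [split; [by move=> i; rewrite mxE | by split; rewrite /= gv0] |].
  by move=> i /= iN; rewrite cdE !gv0 // ?dx0 // ltnW.
have [] := @compact_EVT_min _ R F S (ex_intro _ v0 Sv0) cS.
  apply/subspace_continuousP => v Sv; rewrite /F.
  apply: cvg_sum_nat => i iN.
  apply: (@cvg_comp _ _ _ (fun w => f (g w i) - f (g w i.+1)) (@sqn R) _
    (nbhs (f (g v i) - f (g v i.+1)))); last exact: sqn_continuous.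
  apply: (@cvgB _ C _ (within S (nbhs v))).
    by apply: (@cvg_within_comp _ S (fun w => g w i) v _ _ Sv); [exact: gc | move=> w /SK].
  by apply: (@cvg_within_comp _ S (fun w => g w i.+1) v _ _ Sv); [exact: gc | move=> w /SK].
move=> v; rewrite inE => Sv vmin.
(* The energy of [v] is below [eta], hence so is each of its terms, and [expd] bounds every step by
   [s2]. The neighbours of a point are thus at distance below [s1]. *)
have step i : (i < N)%N -> cdist (g v i) (g v i.+1) < s2.
  move=> iN; apply: expd; [exact: SK|exact: SK| |].
    by rewrite -cdE; case: Sv => _; apply.
  apply: le_lt_trans ex0; apply: (@le_trans _ _ (F v)); last first.
    apply: le_trans (vmin v0 _) _; first by rewrite inE.
    rewrite le_eqVlt; apply/orP; left; apply/eqP; apply: eq_big_nat => j /= jN.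
    by rewrite !gv0 // ltnW.
  rewrite /F big_mkord (bigD1 (Ordinal iN)) //= lerDl.
  by apply: sumr_ge0 => j _; exact: sqn_ge0.
exists N, (g v); split=> //; split.
- by case: Sv => -[_ []].
- by case: Sv => -[_ []].
- by move=> i; exact: SK.
- by move=> i iN; apply: lt_le_trans (step i iN) _; rewrite ge_min lexx orbT.
have <- : g v 0%N = p by case: Sv => -[_ []].
have <- : g v N = q by case: Sv => -[_ []].
apply: (arithmetic_seq (u := fun j => f (g v j)) N0) => j jN.
have ab : cdist (g v j) (g v j.+2) < s1.
  have := step j (ltnW jN); have := step j.+1 jN; rewrite !lt_min => /andP[h1 _] /andP[h2 _].
  by have := cdist_triangle (g v j) (g v j.+1) (g v j.+2); lra.
have half01 : 0 <= (2^-1 : R) <= 1 by apply/andP; split; lra.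
have [m [Km am mb fm]] := mid _ _ (SK v j Sv) (SK v j.+2 Sv) ab _ half01.
(* The competitor: one point is replaced by a preimage [m] of the midpoint of its neighbours. As [m]
   is within [d] of both, the new chain is still in [S]. *)
pose w : 'rV[C]_N.+1 := \row_i (if i == inord j.+1 then m else v ord0 i).
have gw i : (i <= N)%N -> g w i = if (i == j.+1)%N then m else g v i.
  move=> iN; rewrite /g /w mxE; congr (if _ then _ else _).
  by rewrite -val_eqE /= !inordK // ltnS ltnW.
have gwj : g w j = g v j by rewrite gw ?ltn_eqF // ltnW // ltnW.
have gwj1 : g w j.+1 = m by rewrite gw ?eqxx // ltnW.
have gwj2 : g w j.+2 = g v j.+2 by rewrite gw ?gtn_eqF.
have gwlt i : (i < j.+1)%N -> g w i = g v i.
  by move=> ij; rewrite gw ?ltn_eqF //; exact: ltnW (ltn_trans ij jN).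
have gwgt i : (j.+1 < i <= N)%N -> g w i = g v i.
  by move=> /andP[ij iN]; rewrite gw ?gtn_eqF.
have Sw : S w.
  case: (Sv) => -[Kv [v_0 v_N]] vd; split; [split; [|split] |].
  - by move=> i; rewrite mxE; case: ifP.
  - by rewrite /= gwlt.
  - by rewrite /= gwgt // jN leqnn.
  move=> i /= iN; have [ij|ij] := ltnP i j.
    by rewrite !gwlt //; [exact: vd | rewrite ltnW].
  have [->|ij1] := eqVneq i j; first by rewrite gwj gwj1 cdE ltW.
  have [->|ij2] := eqVneq i j.+1; first by rewrite gwj1 gwj2 cdE ltW.
  by rewrite !gwgt; [exact: vd | clear -ij ij1 ij2 iN; lia..].
have := vmin w; rewrite inE => /(_ Sw); rewrite /F.
rewrite (big_nat_split2 _ jN) [leRHS](big_nat_split2 _ jN) gwj gwj1 gwj2.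
rewrite [X in _ <= X + _ + _](eq_big_nat _ _
  (F2 := fun i => sqn (f (g v i) - f (g v i.+1)))); last first.
  by move=> i /= ij; rewrite !gwlt // ltnW.
rewrite [X in _ <= _ + X](eq_big_nat _ _
  (F2 := fun i => sqn (f (g v i) - f (g v i.+1)))); last first.
  by move=> i /= ij; rewrite !gwgt //; clear -ij; lia.
rewrite lerD2r lerD2l fm sqn_mid gerDl pmulr_rle0 // => le0.
apply/eqP; rewrite -subr_eq0; apply/eqP/sqn_eq0/le_anti.
by rewrite le0 sqn_ge0.
Qed.

(** A geodesic chain between two points with the same image has constant image, and its steps lie in
    the range of local injectivity, so the chain itself is constant. *)
Lemma immersion_inj x z : K x -> K z -> f x = f z -> x = z.
Proof.
move=> Kx Kz fxz; have [d d0 inj] := linj_uniform.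
have [N [y [N0 [y0 yN Ky yd H]]]] := geodesic d0 Kx Kz.
have fy i : (i <= N)%N -> f (y i) = f x.
  move=> iN; rewrite H // -fxz.
  by apply: complex_ext; rewrite ?Re_seg ?Im_seg; lra.
suff yE i : (i <= N)%N -> y i = x by rewrite -yN yE.
elim: i => [_|i IH iN]; first exact: y0.
rewrite -IH ?(ltnW iN) //.
by apply/esym/inj => //; [exact: yd | rewrite !fy // ltnW].
Qed.

(** The parameter [t] falls between two consecutive points of a geodesic chain, and local convexity
    fills that gap. *)
Lemma immersion_convex x z (t : R) : K x -> K z -> 0 <= t <= 1 ->
  exists2 m, K m & f m = seg (f x) (f z) t.
Proof.
move=> Kx Kz /andP[t0]; rewrite le_eqVlt => /orP[/eqP->|t1].
  by exists z; rewrite ?seg1.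
have [s s0 mid] := lconv_uniform ltr01.
have [N [y [N0 [y0 yN Ky yd fy]]]] := geodesic s0 Kx Kz.
have NR : 0 < N%:R :> R by rewrite ltr0n.
have tN0 : 0 <= t * N%:R by rewrite mulr_ge0.
pose i := Num.trunc (t * N%:R).
have /andP[il ir] : i%:R <= t * N%:R < i.+1%:R by rewrite truncn_itv.
have iN : (i < N)%N by rewrite -(ltr_nat R) (le_lt_trans il) // gtr_pMl.
have u01 : 0 <= t * N%:R - i%:R <= 1.
  by rewrite subr_ge0 il /= lerBlDl natr1 ltW.
have [m [Km _ _ fm]] := mid _ _ (Ky i) (Ky i.+1) (yd i iN) _ u01.
exists m => //; rewrite fm !fy // ?(ltnW iN) // -natr1.
by apply: complex_ext; rewrite !(Re_seg, Im_seg); field; rewrite gt_eqF.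
Qed.

End Birkhoff.

(** * The lifts of the Lagrangian and the deck group *)

(** The third element is written [1 + 1] so that indices are computed in Z/3 by [ord3E]. *)
Lemma ord3P (P : 'I_3 -> Prop) : P 0 -> P 1 -> P (1 + 1) -> forall j, P j.
Proof.
move=> P0 P1 P2 [[|[|[|//]]] lt3].
- by rewrite (_ : Ordinal lt3 = 0) //; exact/val_inj.
- by rewrite (_ : Ordinal lt3 = 1) //; exact/val_inj.
- by rewrite (_ : Ordinal lt3 = 1 + 1) //; exact/val_inj.
Qed.

Lemma ord3E : (1 + 1 + 1 = 0 :> 'I_3) * (1 + (1 + 1) = 0 :> 'I_3) *
  (1 + 1 + (1 + 1) = 1 :> 'I_3) * (- 1 = 1 + 1 :> 'I_3) * (- (1 + 1) = 1 :> 'I_3).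
Proof. by do !split; apply/val_inj. Qed.

Lemma ord3_neq : ((0 == 1 :> 'I_3) = false) * ((0 == 1 + 1 :> 'I_3) = false) *
  ((1 == 0 :> 'I_3) = false) * ((1 == 1 + 1 :> 'I_3) = false) *
  ((1 + 1 == 0 :> 'I_3) = false) * ((1 + 1 == 1 :> 'I_3) = false).
Proof. by []. Qed.

Section Coordinates.
Variable R : realType.
Local Notation C := (R[i]^o).
Implicit Types (x y z p v w : C) (g h : deck) (j : 'I_3).

Local Notation tau := (tau0 R).
Local Notation sq3 := (Num.sqrt 3 : R).

Lemma sqrt3_sqr : sq3 * sq3 = 3.
Proof. by rewrite -expr2 sqr_sqrtr. Qed.

Lemma sqrt3_gt0 : 0 < sq3.
Proof. by rewrite sqrtr_gt0. Qed.

Lemma tau_sqr : tau ^+ 2 = ((- 2^-1) +i* (- (sq3 / 2)))%C.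
Proof.
rewrite expr2 /tau0; apply: complex_ext => /=; have := sqrt3_sqr.
  by move=> s; rewrite mulf_div s; field.
by move=> s; field.
Qed.

Lemma tau_cube : tau ^+ 3 = 1.
Proof.
rewrite exprS tau_sqr /tau0; apply: complex_ext => /=; have := sqrt3_sqr.
  by move=> s; lra.
by move=> s; lra.
Qed.

(* The signed coordinate of [z] in the direction normal to the [j]-th family of
   lifts of the Lagrangian. *)
Definition u j z : R := complex.Re (tau ^+ (j + j) * z).

Lemma u0E z : u 0 z = complex.Re z.
Proof. by rewrite /u mul1r. Qed.

Lemma u1E z : u 1 z = - complex.Re z / 2 + sq3 / 2 * complex.Im z.
Proof. by rewrite /u /= tau_sqr; case: z => a b /=; field. Qed.

Lemma u2E z : u (1 + 1) z = - complex.Re z / 2 - sq3 / 2 * complex.Im z.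
Proof.
rewrite /u (_ : _ + _ = 3 + 1)%N // exprD tau_cube mul1r.
by case: z => a b /=; field.
Qed.

Definition uE := (u0E, u1E, u2E).

Lemma u_sum z : u 0 z + u 1 z + u (1 + 1) z = 0.
Proof. by rewrite !uE; field. Qed.

Lemma u_sum3 j z : u j z + u (j + 1) z + u (j + 1 + 1) z = 0.
Proof.
by move: j; apply: ord3P; rewrite ?add0r ?ord3E -?addrA ?ord3E ?addr0;
  have := u_sum z; lra.
Qed.

Lemma u_ext z w : u 0 z = u 0 w -> u 1 z = u 1 w -> z = w.
Proof.
rewrite !uE => re; rewrite re => /addrI.
have s0 : sq3 / 2 != 0 by rewrite gt_eqF // divr_gt0 // sqrt3_gt0.
by move=> /(mulfI s0); exact: complex_ext.
Qed.

Lemma u_ext2 j z w : u j z = u j w -> u (j + 1) z = u (j + 1) w -> z = w.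
Proof.
move=> e0 e1; have e2 : u (j + 1 + 1) z = u (j + 1 + 1) w.
  by have := u_sum3 j z; have := u_sum3 j w; lra.
move: j e0 e1 e2; apply: ord3P; rewrite ?add0r ?ord3E -?addrA ?ord3E ?addr0 => e0 e1 e2;
  exact: u_ext.
Qed.

Lemma u_seg j z w (t : R) : u j (seg z w t) = (1 - t) * u j z + t * u j w.
Proof. by move: j; apply: ord3P; rewrite !uE Re_seg ?Im_seg; field. Qed.

Definition pt0 (a b : R) : C := (a +i* ((b + a / 2) * 2 / sq3))%C.

Lemma u_pt0 a b : u 0 (pt0 a b) = a /\ u 1 (pt0 a b) = b.
Proof.
by rewrite !uE /=; split=> //; field; rewrite gt_eqF // sqrt3_gt0.
Qed.

Lemma u_pt j (a b : R) : exists2 z, u j z = a & u (j + 1) z = b.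
Proof.
move: j; apply: ord3P; rewrite ?add0r ?ord3E.
- by have [] := u_pt0 a b; exists (pt0 a b).
- have [e0 e1] := u_pt0 (- a - b) a; exists (pt0 (- a - b) a) => //.
  by have := u_sum (pt0 (- a - b) a); rewrite e0 e1; lra.
have [e0 e1] := u_pt0 b (- a - b); exists (pt0 b (- a - b)) => //.
by have := u_sum (pt0 b (- a - b)); rewrite e0 e1; lra.
Qed.

(** Twice the [j]-th coordinate of the translation part [a + b tau0]. *)
Definition offset (g : deck) j : int :=
  if j == 0 then g.2.1 + g.2.1 - g.2.2
  else if j == 1 then g.2.2 + g.2.2 - g.2.1 else - g.2.1 - g.2.2.

(** As [tau] has order 3, [u j z] is the real part of [z] divided by [tau ^+ j]; a rotation by
    [tau ^+ g.1] therefore shifts the index. *)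
Lemma u_deck g j z :
  u j (deck_act g z) = u (j - g.1) z + (offset g j)%:~R / 2.
Proof.
case: g => i [a b]; rewrite /deck_act /= /offset.
have tauD (n : nat) (z' : C) : tau ^+ n * z' = tau ^+ (n %% 3)%N * z'.
  by rewrite {1}(divn_eq n 3) exprD mulnC exprM tau_cube expr1n mul1r.
have uD k (z1 z2 : C) : u k (z1 + z2) = u k z1 + u k z2.
  by rewrite /u mulrDr; case: (_ * z1) => ? ?; case: (_ * z2).
have uint k (n : int) (z1 : C) : u k (n%:~R * z1) = n%:~R * u k z1.
  rewrite /u mulrCA -(rmorph_int (real_complex R)).
  by case: (_ * z1) => ? ? /=; rewrite mul0r subr0.
rewrite !uD -[a%:~R]mulr1 !uint.
have -> : u j (tau ^+ i * z) = u (j - i) z.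
  rewrite /u mulrA -exprD tauD [in RHS]tauD; congr (complex.Re (tau ^+ _ * z)).
  by move: i j; apply: ord3P; apply: ord3P.
rewrite -addrA; congr (_ + _).
have s := sqrt3_sqr.
by move: j; apply: ord3P; rewrite /= !uE /= !intrD !intrN; [field|field: s|field: s].
Qed.

(** The base line is [u 0 = 1/4] and translations move coordinates by halves of offsets, so these
    are the levels of the lifts in each direction. *)
Definition lvl (k : int) : R := 4^-1 + k%:~R / 2.

Lemma lvl_inj : injective lvl.
Proof. by move=> k l; rewrite /lvl => ?; apply: (@intr_inj R); lra. Qed.

Lemma deck_surj g w : exists z, deck_act g z = w.
Proof.
have [z z0 z1] := u_pt 0 (u g.1 w - (offset g g.1)%:~R / 2)
  (u (g.1 + 1) w - (offset g (g.1 + 1))%:~R / 2).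
exists z; apply: (@u_ext2 g.1); rewrite u_deck.
  by rewrite subrr z0 subrK.
by rewrite addrAC subrr z1 subrK.
Qed.

Lemma base_mid : complex.Re ((1 + tau) / 2) = 4^-1.
Proof.
have n2 : (2 : C) != 0 by rewrite pnatr_eq0.
rewrite (_ : (1 + tau) / 2 = (4^-1 +i* (sq3 / 4))%C) //.
apply: (mulIf n2); rewrite divfK // mulr2n mulrDr !mulr1.
by apply: complex_ext; rewrite /=; field.
Qed.

Lemma base_lineP z : base_line z <-> u 0 z = 4^-1.
Proof.
have mid := base_mid; rewrite u0E; split=> [[t _ <-]|z0].
  rewrite -mid; case: ((1 + tau) / 2) => a b /=.
  by rewrite mul0r mul1r subr0 addr0.
exists (complex.Im z - complex.Im ((1 + tau) / 2)) => //.
apply: complex_ext; move: mid; case: ((1 + tau) / 2) => a b /= ab; rewrite /= ?z0 ?ab;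
  ring.
Qed.

Lemma liftP g z : Defs.lift g z <-> u g.1 z = lvl (offset g g.1).
Proof.
rewrite /Defs.lift /lvl; split=> [[w /base_lineP w0 <-]|].
  by rewrite u_deck subrr w0.
have [w <-] := deck_surj g z; rewrite u_deck subrr => /addIr w0.
by exists w => //; apply/base_lineP.
Qed.

Lemma base_leftP z : base_left z <-> u 0 z <= 4^-1.
Proof.
have -> : base_left z = (complex.Re z <= 4^-1) by rewrite -base_mid.
by rewrite u0E.
Qed.

Lemma left_ofP g z : left_of g z <-> u g.1 z <= lvl (offset g g.1).
Proof.
rewrite /left_of /lvl; split=> [[w /base_leftP w0 <-]|].
  by rewrite u_deck subrr lerD2r.
have [w <-] := deck_surj g z; rewrite u_deck subrr lerD2r => w0.
by exists w => //; apply/base_leftP.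
Qed.

Lemma offset_surj j k : exists2 g, g.1 = j & offset g j = k.
Proof.
move: j; apply: ord3P.
- by exists (0, (0, - k)); rewrite //= /offset /=; lia.
- by exists (1, (- k, 0)); rewrite //= /offset /=; lia.
- by exists (1 + 1, (- k, 0)); rewrite //= /offset /=; lia.
Qed.

Lemma offset_sum g : offset g 0 + offset g 1 + offset g (1 + 1) = 0.
Proof. by rewrite /offset /=; lia. Qed.

(** With [offset_sum] and [offset_exists], this characterizes the offsets: integer triples of sum 0
    whose entries are congruent modulo 3. *)
Lemma offset_mod3 g j : (3 %| offset g j - offset g (j + 1)%R)%Z.
Proof.
case: g => i [a b]; move: j; apply: ord3P; rewrite /offset ?add0r ?ord3E /=;
  lia.
Qed.

Lemma offset_exists i (t : 'I_3 -> int) : t 0 + t 1 + t (1 + 1) = 0 ->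
  (3 %| t 0%R - t 1%R)%Z -> exists2 g, g.1 = i & forall j, offset g j = t j.
Proof.
(* Solution of [2a - b = t 0] and [2b - a = t 1], where [t 0 - t 1 = 3m]. *)
move=> t0 /dvdzP[m tm]; exists (i, (t 1 + m + m, t 1 + m)) => //.
by apply: ord3P; rewrite /offset /=; lia.
Qed.

Lemma double_pointP z : double_point z <->
  exists j k l, u j z = lvl k /\ u (j + 1) z = lvl l.
Proof.
split=> [[g [h [gh /liftP zg /liftP zh]]]|[j [k [l [zk zl]]]]].
  have [e|e] : h.1 = g.1 + 1 \/ g.1 = h.1 + 1.
    by move: gh; move: (g.1) (h.1); do 2!apply: ord3P;
      rewrite ?eqxx ?ord3E ?add0r //; auto.
  - by exists g.1, (offset g g.1), (offset h h.1); rewrite -e.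
  - by exists h.1, (offset h h.1), (offset g g.1); rewrite -e.
have [g gj gk] := offset_surj j k; have [h hj hl] := offset_surj (j + 1) l.
exists g, h; split; last by apply/liftP; rewrite hj hl.
- by rewrite gj hj; move: (j); apply: ord3P.
- by apply/liftP; rewrite gj gk.
Qed.

Lemma u_cdist j x y : `|u j x - u j y| <= cdist x y.
Proof.
have uB : u j x - u j y = u j (x - y).
  by rewrite /u mulrBr ReB.
rewrite uB /u -[leRHS]mul1r -lecR; apply: le_trans (normc_ge_Re _) _.
rewrite normrM; have -> : `|tau ^+ (j + j)| = 1.
  rewrite normrX; have : `|tau| ^+ 3 = 1 by rewrite -normrX tau_cube normr1.
  by move=> /eqP; rewrite pexprn_eq1 //= => /eqP ->; rewrite expr1n.
by rewrite mul1r mul1r.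
Qed.

Lemma u_continuous j : continuous (u j : C -> R).
Proof.
move=> p; apply/(cvgrPdist_lt (F := nbhs p)) => e e0.
apply: filterS (near_cdist p e0) => x; rewrite distrC.
exact: le_lt_trans (u_cdist _ _ _).
Qed.

Lemma cdist_u x y : cdist x y <= 2 * `|u 0 x - u 0 y| + 2 * `|u 1 x - u 1 y|.
Proof.
apply: le_trans (cdist_ReIm _ _) _; rewrite !uE.
set a := complex.Re x; set b := complex.Re y; set c := complex.Im x; set d := complex.Im y.
set w := (X in _ + 2 * `|X|).
have w1 : c - d = (w + (a - b) / 2) * (2 / sq3).
  by rewrite /w; field; rewrite gt_eqF // sqrt3_gt0.
have s2 : 1 <= sq3 by rewrite -[leLHS]sqrtr1; apply: ler_wsqrtr; lra.
have s3 : 0 <= 2 / sq3 <= 2.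
  by rewrite divr_ge0 ?sqrtr_ge0 //= ler_pdivrMr ?sqrt3_gt0 //; lra.
have a0 := normr_ge0 w; have b0 := normr_ge0 (a - b).
have h1 : `|w + (a - b) / 2| <= `|w| + `|a - b| / 2.
  by apply: le_trans (ler_normD _ _) _; rewrite normrM (@ger0_norm R 2^-1).
have h2 : `|c - d| <= (`|w| + `|a - b| / 2) * 2.
  rewrite w1 normrM; case/andP: s3 => s3 s4.
  by apply: ler_pM; rewrite ?normr_ge0 //; rewrite ger0_norm.
by lra.
Qed.

Lemma nbhs_uP p (V : set C) : nbhs p V <-> exists2 e : R, 0 < e &
  forall x, (forall j, `|u j x - u j p| < e) -> V x.
Proof.
split=> [/nbhsCP[e e0 H]|[e e0 H]].
  exists (e / 4); first by rewrite divr_gt0.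
  move=> x xp; apply: H; apply: le_lt_trans (cdist_u _ _) _.
  by have := xp 0; have := xp 1; lra.
apply/nbhsCP; exists e => // x xp; apply: H => j.
exact: le_lt_trans (u_cdist _ _ _) xp.
Qed.

Definition hplane j k : set C := [set z | u j z <= lvl k].

(** The levels exceed the coordinates by a total of [3/4 + (k 0 + k 1 + k 2)/2], which is never 0:
    this is a genuine triangle when it is positive and the empty set otherwise. *)
Definition tri (k : 'I_3 -> int) : set C := [set z | forall j, u j z <= lvl (k j)].

Lemma left_of_hplane g : left_of g = hplane g.1 (offset g g.1).
Proof. by apply/seteqP; split=> z /left_ofP. Qed.

End Coordinates.

(** * Polygons are triangles *)


Section ConvexSet.
Variable R : realType.
Local Notation C := (R[i]^o).

(** In [R[i]], the condition [0 <= l <= 1] forces [l] to be real, so convexity with complex weights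
    is convexity along [seg]. *)
Lemma convex_setP (K : set C) : @convex_set R[i] C K <->
  forall p q (t : R), K p -> K q -> 0 <= t <= 1 -> K (seg p q t).
Proof.
split=> [H p q t Kp Kq /andP[t0 t1]|H p q l].
  have l0 : 0 <= (((1 - t)%:C)%C : R[i]) by rewrite ler0c subr_ge0.
  have l1 : (((1 - t)%:C)%C : R[i]) <= 1 by rewrite lecR gerBl.
  have := H p q (Itv01 l0 l1); rewrite !inE => /(_ Kp Kq).
  congr K; rewrite /seg /conv /=; congr (_ + _ * _).
  by rewrite /unstable.onem -[X in X - _](rmorph1 (real_complex R)) -rmorphB subKr.
rewrite !inE => Kp Kq.
have l0 : 0 <= l%:num by [].
have l1 : l%:num <= 1 by [].
have lE : l%:num = ((complex.Re (l%:num : R[i]))%:C)%C by rewrite RRe_real // ger0_real.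
have := H p q (1 - complex.Re (l%:num : R[i])) Kp Kq _.
rewrite /seg /conv /= subKr /unstable.onem rmorphB /= -lE; apply.
by rewrite subr_ge0 gerBl -!lecR -lE l0 l1.
Qed.

End ConvexSet.

(** * Local models of a polygon: plane, half-plane, sector *)

Section LocalModels.
Variable R : realType.
Local Notation C := (R[i]^o).
Implicit Types (P : Defs.pmap R) (p q x y : C) (M K : set C).

Definition seg_closed M := forall x y (t : R), M x -> M y -> 0 <= t <= 1 -> M (seg x y t).

Lemma hplane_seg j k : seg_closed (hplane j k).
Proof.
move=> x y t; rewrite /hplane /= u_seg => hx hy /andP[t0 t1].
by have := ler_wpM2l t0 hy; have := @ler_wpM2l _ (1 - t) _ _ _ hx; lra.
Qed.

Lemma segI M N : seg_closed M -> seg_closed N -> seg_closed (M `&` N).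
Proof. by move=> HM HN x y t [Mx Nx] [My Ny] t01; split; [exact: HM|exact: HN]. Qed.

Lemma locally_onto_nbhs P p M (V : set C) : locally_onto P p M -> nbhs p V ->
  exists2 e : R, 0 < e &
    forall y, M y -> cdist y (pfun P p) < e ->
      exists2 x, pdom P x /\ V x & pfun P x = y.
Proof.
move=> [_ H] /nbhsCP[d d0 HV].
have : (pfun P @ within (pdom P) (nbhs p)) (pfun P @` (pdom P `&` V)).
  change (nbhs p (fun x => pdom P x -> (pfun P @` (pdom P `&` V)) (pfun P x))).
  by apply/nbhsCP; exists d => // x xp Kx; exists x => //; split=> //; exact: HV.
rewrite H => /nbhsCP[e e0 He]; exists e => // y My yp.
by have [x [Kx Vx] <-] := He y yp My; exists x.
Qed.

Lemma locally_onto_image P p M : locally_onto P p M ->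
  exists2 e : R, 0 < e & forall x, pdom P x -> cdist x p < e -> M (pfun P x).
Proof.
move=> [_ H]; have : within M (nbhs (pfun P p)) M.
  by change (nbhs (pfun P p) (fun y => M y -> M y)); apply: filterE.
rewrite -H => H2; have : nbhs p (fun x => pdom P x -> M (pfun P x)) by exact: H2.
by move=> /nbhsCP[e e0 He]; exists e => // x Kx xp; exact: He.
Qed.

Lemma locally_onto_cvg P p M : locally_onto P p M ->
  pfun P @ within (pdom P) (nbhs p) --> pfun P p.
Proof.
move=> [_ ->] A /= nA.
change (nbhs (pfun P p) (fun y => M y -> A y)).
by apply: filterS nA => y Ay _.
Qed.

Lemma within_cdist (f : C -> C) K p : f @ within K (nbhs p) --> f p ->
  forall e : R, 0 < e -> exists2 d : R, 0 < d &
    forall x, K x -> cdist x p < d -> cdist (f x) (f p) < e.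
Proof.
move=> H e e0; have n : nbhs (f p) (fun y => cdist y (f p) < e) by exact: near_cdist.
have : nbhs p (fun x => K x -> cdist (f x) (f p) < e) := H _ n.
by move=> /nbhsCP[d d0 Hd]; exists d => // x Kx xp; exact: Hd.
Qed.

Lemma locally_onto_inj P p M : locally_onto P p M ->
  exists2 e : R, 0 < e & forall x z, pdom P x -> pdom P z ->
    cdist x p < e -> cdist z p < e -> pfun P x = pfun P z -> x = z.
Proof.
move=> [[V /nbhsCP[e e0 He] inj] _]; exists e => // x z Kx Kz xp zp.
by apply: inj; rewrite inE; split=> //; exact: He.
Qed.

Lemma cdist_seg_lt x y p (t e : R) : 0 <= t <= 1 -> cdist x p < e -> cdist y p < e ->
  cdist (seg x y t) p < e.
Proof.
move=> /andP[t0 t1] xp yp.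
have -> : cdist (seg x y t) p = normc (((1 - t)%:C)%C * (x - p) + (t%:C)%C * (y - p)).
  rewrite /cdist; congr normc; rewrite /seg !mulrBr addrACA; congr (_ + _).
  rewrite -opprD -mulrDl -rmorphD subrK mul1r //.
apply: le_lt_trans (le_normcD _ _) _; rewrite !normcM.
have nR (a : R) : 0 <= a -> normc (a%:C)%C = a.
  by move=> a0; rewrite /= expr0n addr0 sqrtr_sqr ger0_norm.
rewrite !nR ?subr_ge0 // -/(cdist x p) -/(cdist y p).
have [->|t0'] := eqVneq t 0; first by rewrite subr0 mul0r addr0 mul1r.
have tp : 0 < t by rewrite lt_neqAle eq_sym t0'.
have h1 : t * cdist y p < t * e by rewrite ltr_pM2l.
have h2 : (1 - t) * cdist x p <= (1 - t) * e by rewrite ler_wpM2l ?subr_ge0 // ltW.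
lra.
Qed.

Lemma locally_onto_seg P p M : seg_closed M -> locally_onto P p M ->
  forall s : R, 0 < s -> exists2 e : R, 0 < e &
    forall x z, pdom P x -> pdom P z -> cdist x p < e -> cdist z p < e ->
    forall t : R, 0 <= t <= 1 -> exists m,
      [/\ pdom P m, cdist m p < s & pfun P m = seg (pfun P x) (pfun P z) t].
Proof.
move=> segM H s s0.
have [e1 e10 He1] := locally_onto_nbhs H (near_cdist p s0).
have [e2 e20 He2] := within_cdist (locally_onto_cvg H) e10.
have [e3 e30 He3] := locally_onto_image H.
exists (Num.min e2 e3); first by rewrite lt_min e20.
move=> x z Kx Kz; rewrite !lt_min => /andP[x2 x3] /andP[z2 z3] t t01.
have Ms : M (seg (pfun P x) (pfun P z) t) by apply: segM => //; exact: He3.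
have [m [Km mp] fm] := He1 _ Ms (cdist_seg_lt t01 (He2 x Kx x2) (He2 z Kz z2)).
by exists m.
Qed.

End LocalModels.

Section PolygonImage.
Variable R : realType.
Local Notation C := (R[i]^o).
Variable P : Defs.pmap R.
Hypothesis polP : polygon P.
Local Notation K := (pdom P).
Local Notation f := (pfun P).

Lemma polygon_compact : compact K. Proof. by case: polP. Qed.

Lemma polygon_convex : seg_closed K.
Proof. by move=> x y t; case: polP => _ /convex_setP H _ _ _; exact: H. Qed.

(** At a corner, [j] is the direction of neither line through the corner, that is, the direction of
    the opposite side. *)
Inductive local_model p : set C -> Prop :=
| InteriorModel of K° p : local_model p setT
| EdgeModel j k of pboundary P p & u j (f p) = lvl R k : local_model p (hplane j k)
| CornerModel j k l of pboundary P p & u (j + 1) (f p) = lvl R k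
    & u (j + 1 + 1) (f p) = lvl R l :
    local_model p (hplane (j + 1) k `&` hplane (j + 1 + 1) l).

Lemma local_modelP p : K p -> exists2 M, local_model p M & locally_onto P p M.
Proof.
move=> Kp; have [Ip|Ip] := pselect (K° p).
  by exists setT; [exact: InteriorModel | case: polP => _ _ _ /(_ p Ip)[]].
have Bp : pboundary P p by [].
case: polP => _ _ _ _ /(_ p Bp)[[g [/liftP fg]]|[g [h [gh /liftP fg /liftP fh]]]].
  by rewrite left_of_hplane => H; exists (hplane g.1 (offset g g.1)) => //; exact: EdgeModel.
rewrite !left_of_hplane.
have [[j [jg jh]]|[j [jg jh]]] : (exists j, g.1 = j + 1 /\ h.1 = j + 1 + 1) \/
    (exists j, h.1 = j + 1 /\ g.1 = j + 1 + 1).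
  move: (g.1) (h.1) gh; do 2!apply: ord3P => //; move=> _;
  first [left; exists 0; by split; apply/val_inj
        |left; exists 1; by split; apply/val_inj
        |left; exists (1 + 1); by split; apply/val_inj
        |right; exists 0; by split; apply/val_inj
        |right; exists 1; by split; apply/val_inj
        |right; exists (1 + 1); by split; apply/val_inj].
- rewrite jg jh in fg fh *; exists (hplane (j + 1) (offset g (j + 1)) `&`
    hplane (j + 1 + 1) (offset h (j + 1 + 1))) => //.
  exact: CornerModel.
rewrite setIC; rewrite jg jh in fg fh *; exists (hplane (j + 1) (offset h (j + 1)) `&`
    hplane (j + 1 + 1) (offset g (j + 1 + 1))) => //.
exact: CornerModel.
Qed.

Lemma local_model_seg p M : local_model p M -> seg_closed M.
Proof.
by case=> [_|j k _ _|j k l _ _ _] //; [exact: hplane_seg | apply: segI; exact: hplane_seg].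
Qed.

Lemma polygon_cvg p : K p -> f @ within K (nbhs p) --> f p.
Proof. by move=> /local_modelP[M _ /locally_onto_cvg]. Qed.

Let linj k : K k -> exists2 e : R, 0 < e &
  forall x z, K x -> K z -> cdist x k < e -> cdist z k < e -> f x = f z -> x = z.
Proof. by move=> /local_modelP[M _ /locally_onto_inj]. Qed.

Let lconv k (s : R) : K k -> 0 < s -> exists2 e : R, 0 < e &
  forall x z, K x -> K z -> cdist x k < e -> cdist z k < e ->
  forall t : R, 0 <= t <= 1 ->
    exists m, [/\ K m, cdist m k < s & f m = seg (f x) (f z) t].
Proof.
move=> /local_modelP[M /local_model_seg sM H] s0.
exact: (locally_onto_seg sM H s0).
Qed.

Lemma polygon_inj x z : K x -> K z -> f x = f z -> x = z.
Proof.
exact: (immersion_inj polygon_compact polygon_cvg polygon_convex linj lconv).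
Qed.

Lemma polygon_image_convex : seg_closed (f @` K).
Proof.
move=> _ _ t [x Kx <-] [z Kz <-] t01.
have [m Km fm] := immersion_convex polygon_compact polygon_cvg polygon_convex linj
  lconv Kx Kz t01.
by exists m.
Qed.

(** Continuity of the inverse of an injective continuous map on a compact set: away from [p], the
    distance of [f x] to [f p] has a positive minimum. *)
Lemma polygon_inverse_cvg p : K p -> forall e : R, 0 < e -> exists2 d : R, 0 < d &
  forall x, K x -> cdist (f x) (f p) < d -> cdist x p < e.
Proof.
move=> Kp e e0; pose S := K `&` [set x | e <= cdist x p].
have cS : compact S.
  apply: compact_closedI; first exact: polygon_compact.
  have cdc : continuous (fun x : C => cdist x p).
    move=> x; apply/(cvgrPdist_lt (F := nbhs x)) => r r0.
    apply: filterS (near_cdist x r0) => y yx.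
    have := cdist_triangle x y p; have := cdist_triangle y x p.
    by rewrite (cdistC x y) ltr_norml; move=> *; apply/andP; split; lra.
  by have /continuous_closedP H := cdc; exact: H (@closed_ge R e).
have [S0|S0] := pselect (S !=set0); last first.
  by exists 1 => // x Kx _; rewrite ltNge; apply/negP => ex; apply: S0; exists x.
have [] := @compact_EVT_min _ R (fun x => cdist (f x) (f p)) S S0 cS.
  apply/subspace_continuousP => x [Kx _].
  apply/(cvgrPdist_lt (F := within S (nbhs x))) => r r0.
  have [d d0 Hd] := within_cdist (polygon_cvg Kx) r0.
  change (nbhs x (fun y => S y -> `|cdist (f x) (f p) - cdist (f y) (f p)| < r)).
  apply: filterS (near_cdist x d0) => y yx [Ky _].
  have := cdist_triangle (f x) (f y) (f p); have := cdist_triangle (f y) (f x) (f p).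
  have := Hd y Ky yx.
  by rewrite (cdistC (f x) (f y)) ltr_norml; move=> *; apply/andP; split; lra.
move=> m; rewrite inE => -[Km em] mmin.
exists (cdist (f m) (f p)).
  rewrite lt_neqAle cdist_ge0 andbT; apply/eqP => /esym/cdist_eq0 /polygon_inj mp.
  by move: em; rewrite /= mp // cdist0 leNgt e0.
move=> x Kx; rewrite ltNge => /negP H; rewrite ltNge; apply/negP => ex.
by apply/H/mmin; rewrite inE.
Qed.

End PolygonImage.

Lemma ord3_around (i : 'I_3) (Q : 'I_3 -> Prop) :
  Q i -> Q (i + 1) -> Q (i + 1 + 1) -> forall j, Q j.
Proof.
by move: i; apply: ord3P; rewrite ?add0r ?ord3E ?add0r => *; exact: ord3P.
Qed.

Lemma ord3_succ3 (i : 'I_3) : i + 1 + 1 + 1 = i.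
Proof. by rewrite -!addrA (addrA 1) ord3E addr0. Qed.

Lemma ord3_succ_neq (i : 'I_3) : i + 1 != i.
Proof. by move: i; exact: ord3P. Qed.

Lemma ord3_succ2_neq (i : 'I_3) : i + 1 + 1 != i.
Proof. by move: i; exact: ord3P. Qed.

Section Triangles.
Variable R : realType.
Local Notation C := (R[i]^o).
Local Notation lvl := (lvl R).
Implicit Types (v w z : C) (k : 'I_3 -> int).

(* A triangle [tri k] has side [tsum k + 3/2], up to a constant factor. *)
Definition tsum k : int := k 0 + k 1 + k (1 + 1).

Lemma tsum_around i k : tsum k = k i + k (i + 1) + k (i + 1 + 1).
Proof. by rewrite /tsum; move: i; apply: ord3P; rewrite ?add0r ?ord3E ?add0r; ring. Qed.

Lemma lvl_sum i k :
  lvl (k i) + lvl (k (i + 1)) + lvl (k (i + 1 + 1)) = 3 / 4 + (tsum k)%:~R / 2.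
Proof. by rewrite (tsum_around i) /lvl !intrD; lra. Qed.

(** The freedom left by [u_sum3]: one coordinate decreases by [r], a second one is kept, and the
    third compensates. *)
Lemma perturb i m v (r : R) : m != i -> exists w,
  [/\ u i w = u i v - r, u m w = u m v & forall j, `|u j w - u j v| <= `|r|].
Proof.
move=> mi; have := u_sum3 i v.
have rr : r <= `|r| /\ - r <= `|r| by rewrite ler_norm -normrN ler_norm.
have [->|->] : m = i + 1 \/ m = i + 1 + 1.
- move: mi; move: m; apply: (ord3_around (i := i)); first by rewrite eqxx.
    by left.
  by right.
- have [w wi wi1] := u_pt i (u i v - r) (u (i + 1) v); have := u_sum3 i w => s1 s2.
  exists w; split=> //; apply: (ord3_around (i := i)); rewrite ler_norml; apply/andP; split; lra.
have [w wi wi1] := u_pt i (u i v - r) (u (i + 1) v + r); have := u_sum3 i w => s1 s2.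
exists w; split=> //; first by lra.
by apply: (ord3_around (i := i)); rewrite ler_norml; apply/andP; split; lra.
Qed.

End Triangles.

(** * The image of a polygon is an equilateral triangle *)

Section Classification.
Variable R : realType.
Local Notation C := (R[i]^o).
Variable P : Defs.pmap R.
Hypothesis polP : polygon P.
Local Notation K := (pdom P).
Local Notation f := (pfun P).
Local Notation lvl := (lvl R).

(** Injectivity and the continuity of the inverse prevent far parts of the domain from coming back
    near [f p]; there the whole image coincides with the model. *)
Lemma local_model_image p M : K p -> locally_onto P p M ->
  exists2 e : R, 0 < e & forall y, (forall j, `|u j y - u j (f p)| < e) ->
    (f @` K) y <-> M y.
Proof.
move=> Kp H; have [e1 e10 H1] := locally_onto_image H.
have [e2 e20 H2] := polygon_inverse_cvg polP Kp e10.
have [e3 e30 H3] := locally_onto_nbhs H (V := setT) filterT.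
have /nbhs_uP[e e0 He] : nbhs (f p) (fun y => cdist y (f p) < Num.min e2 e3).
  by apply: near_cdist; rewrite lt_min e20.
exists e => // y /He; rewrite lt_min => /andP[y2 y3]; split.
  by case=> x Kx fx; rewrite -fx; apply: H1 => //; apply: H2 => //; rewrite fx.
by move=> My; have [x [Kx _] fx] := H3 y My y3; exists x.
Qed.

Lemma interior_image p : K° p -> (f @` K)° (f p).
Proof.
move=> Ip; have Kp : K p by exact: interior_subset.
case: (polP) => _ _ _ /(_ p Ip)[_ _ H] _.
have [e e0 He] := local_model_image Kp H.
by apply/nbhs_uP; exists e => // x /He H'; apply/H'.
Qed.

(** A convex set that lies, near one of its points, in a half-plane bounded by a line through that
    point lies in it entirely. *)
Lemma image_sub_model p j k M : K p -> locally_onto P p M -> M `<=` hplane j k ->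
  u j (f p) = lvl k -> f @` K `<=` hplane j k.
Proof.
move=> Kp H sub fp y Ty; have [e e0 He] := local_model_image Kp H.
(* The parameter [t] below brings the point of the segment from [f p] to [y] within [e] of [f p] in
   all coordinates. *)
pose B := 1 + \sum_(j < 3) `|u j y - u j (f p)|.
have B0 : 0 < B by rewrite ltr_wpDr ?sumr_ge0.
pose t := Num.min 1 (e / 2 / B).
have t0 : 0 < t by rewrite lt_min ltr01 !divr_gt0.
have t1 : t <= 1 by rewrite ge_min lexx.
have : (f @` K) (seg (f p) y t).
  have Tp : (f @` K) (f p) by exists p.
  have t01 : 0 <= t <= 1 by rewrite (ltW t0).
  exact: (polygon_image_convex polP Tp Ty t01).
move=> /He H'; have /sub : M (seg (f p) y t).
  apply: H' => i; rewrite u_seg.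
  have -> : (1 - t) * u i (f p) + t * u i y - u i (f p) = t * (u i y - u i (f p)) by ring.
  rewrite normrM (gtr0_norm t0).
  have h : `|u i y - u i (f p)| <= B.
    rewrite /B (bigD1 i) //= addrCA lerDl addr_ge0 ?sumr_ge0 //.
  apply: (@le_lt_trans _ _ (e / 2 / B * B)).
    by apply: ler_pM => //; [exact: ltW | rewrite ge_min lexx orbT].
  by rewrite divfK ?gt_eqF //; lra.
rewrite /hplane /= u_seg fp => h; rewrite -subr_le0 -(pmulr_rle0 _ t0); lra.
Qed.

(** The vertex opposite to the side in direction [i] is where [u i] is minimal on the image. *)
Lemma polygon_vertex i : exists v k l, [/\ (f @` K) v,
  u (i + 1) v = lvl k, u (i + 1 + 1) v = lvl l,
  f @` K `<=` hplane (i + 1) k & f @` K `<=` hplane (i + 1 + 1) l].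
Proof.
have K0 : K !=set0.
  by case: polP => _ _ [p Ip] _ _; exists p; exact: interior_subset.
have [] := @compact_EVT_min _ R (fun p => u i (f p)) K K0 (polygon_compact polP).
  apply/subspace_continuousP => p Kp.
  apply: (@cvg_comp _ _ _ f (@u R i) _ (nbhs (f p))); first exact: polygon_cvg.
  exact: u_continuous.
move=> p; rewrite inE => Kp pmin.
have {}pmin y : (f @` K) y -> u i (f p) <= u i y.
  by move=> [x Kx <-]; apply: pmin; rewrite inE.
have [M mM H] := local_modelP polP Kp.
have [e e0 He] := local_model_image Kp H.
have e20 : 0 < e / 2 by rewrite divr_gt0.
(* A model that allows [u i] to decrease while [u m] is fixed contradicts minimality. This excludes
   all models but the corner between directions [i + 1] and [i + 1 + 1]. *)
have contra m : m != i ->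
    (forall w, u i w <= u i (f p) -> u m w = u m (f p) -> M w) -> False.
  move=> mi HM; have [w [wi wm wj]] := perturb (f p) (e / 2) mi.
  have /pmin : (f @` K) w.
    apply/He; last by apply: HM => //; lra.
    by move=> j; apply: le_lt_trans (wj j) _; rewrite gtr0_norm //; lra.
  by rewrite wi; lra.
have i1 := ord3_succ_neq i; have i2 := ord3_succ2_neq i.
case: mM H He contra => [Ip|j k Bp pj|j k l Bp pk pl] H He contra.
- by case: (contra (i + 1)).
- have [ji|ji] := eqVneq j i.
    case: (contra (i + 1)) => // w wi _; rewrite /hplane /= -pj ji //.
  by case: (contra j) => // w _ wj; rewrite /hplane /= wj pj.
have [ji|ji] := eqVneq j i.
  rewrite ji in pk pl H; exists (f p), k, l; split=> //.
    by apply: (image_sub_model Kp H) => // w [].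
  by apply: (image_sub_model Kp H) => // w [].
have [ji1|ji1] : j = i + 1 \/ j = i + 1 + 1.
- move: ji; move: j {pk pl H He contra}; apply: (ord3_around (i := i)); first by rewrite eqxx.
    by left.
  by right.
- rewrite ji1 ord3_succ3 in pk pl contra.
  case: (contra (i + 1 + 1)) => // w wi wj.
  by split; rewrite /hplane /= -?pk -?pl // wj.
rewrite ji1 ord3_succ3 in pk pl contra.
case: (contra (i + 1)) => // w wi wj.
by split; rewrite /hplane /= -?pk -?pl // wj.
Qed.

Lemma polygon_image : exists2 k, -1 <= tsum k & f @` K = tri k.
Proof.
have /choice[v /choice[k1 /choice[k2 H]]] : forall i, exists v k l, [/\ (f @` K) v,
  u (i + 1) v = lvl k, u (i + 1 + 1) v = lvl l,
  f @` K `<=` hplane (i + 1) k & f @` K `<=` hplane (i + 1 + 1) l] := polygon_vertex.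
pose k j := k1 (j + 1 + 1).
have kE i : k1 i = k (i + 1) by rewrite /k ord3_succ3.
(* Vertices [i] and [i + 1] are both on side [i + 1 + 1], and the image lies in both half-planes, so
   each of the two levels bounds the other. *)
have k2E i : k2 i = k (i + 1 + 1).
  rewrite /k ord3_succ3; have [Tv _ vl _ T2] := H i; have [Tw wk _ T1 _] := H (i + 1).
  apply: (@lvl_inj R); apply/le_anti/andP; split.
    by rewrite -vl; exact: T1.
  by rewrite -wk; exact: T2.
have sub : f @` K `<=` tri k.
  move=> y Ty j; have [_ _ _ + _] := H (j + 1 + 1).
  by rewrite ord3_succ3 kE ord3_succ3 => /(_ y Ty).
have vP i : [/\ (f @` K) (v i), u (i + 1) (v i) = lvl (k (i + 1)) &
    u (i + 1 + 1) (v i) = lvl (k (i + 1 + 1))].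
  by have [] := H i; rewrite kE k2E.
have Lpos : 0 < 3 / 4 + (tsum k)%:~R / 2 :> R.
  have [p /interior_image/nbhs_uP[e e0 He]] : K° !=set0 by case: polP.
  have lt j : u j (f p) < lvl (k j).
    have e20 : 0 <= e / 2 by rewrite divr_ge0 // ltW.
    have [w' w1 w2] := u_pt j (u j (f p) + e / 2) (u (j + 1) (f p) - e / 2).
    have := sub w' _ j; rewrite w1 => H'; suff : (f @` K) w' by move=> /H'; lra.
    apply: He; have s1 := u_sum3 j w'; have s2 := u_sum3 j (f p).
    by apply: (ord3_around (i := j)); rewrite ltr_norml; apply/andP; split; lra.
  have := lt 0; have := lt 1; have := lt (1 + 1); have := u_sum (f p).
  have := lvl_sum R 0 k; rewrite add0r; lra.
exists k.
  have /(_ R) := @ltr_int _; move: Lpos; case: (leP (-1) (tsum k)) => // lt1 Lpos _.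
  have : (tsum k)%:~R <= (- 2)%:~R :> R by rewrite ler_int; lia.
  by rewrite rmorphN /=; lra.
apply/seteqP; split=> // z zT.
set L := 3 / 4 + (tsum k)%:~R / 2 in Lpos.
have L0 : L != 0 by rewrite gt_eqF.
(* Barycentric coordinates of [z]: the slack at side [j] over the height [L]. *)
pose lam j := (lvl (k j) - u j z) / L.
have lam0 j : 0 <= lam j by rewrite divr_ge0 ?(ltW Lpos) // subr_ge0; exact: zT.
have lamS : lam 0 + lam 1 + lam (1 + 1) = 1.
  rewrite /lam -!mulrDl; have -> : lvl (k 0) - u 0 z + (lvl (k 1) - u 1 z) +
    (lvl (k (1 + 1)) - u (1 + 1) z) = L; last by rewrite divff.
  by have := lvl_sum R 0 k; rewrite add0r -/L; have := u_sum z; lra.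
have uz j : u j z = lvl (k j) - lam j * L by rewrite /lam divfK // subKr.
have uv j i : u j (v i) = if j == i then lvl (k j) - L else lvl (k j).
  have [_ v1 v2] := vP i; have := u_sum3 i (v i).
  have := lvl_sum R i k; rewrite -/L.
  move: j; apply: (ord3_around (i := i)); rewrite ?eqxx.
  - by lra.
  - by rewrite v1 ifN // ord3_succ_neq.
  - by rewrite v2 ifN // ord3_succ2_neq.
(* The barycentre is written with two nested segments. If [lam 0 + lam 1 = 0], then [z] is the third
   vertex and the value [a = 0] is harmless. *)
pose a := lam 1 / (lam 0 + lam 1).
have den0 : 0 <= lam 0 + lam 1 by rewrite addr_ge0.
have a01 : 0 <= a <= 1.
  rewrite /a divr_ge0 //=; have [->|n0] := eqVneq (lam 0 + lam 1) 0.
    by rewrite invr0 mulr0.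
  by rewrite ler_pdivrMr ?mul1r ?lerDr // lt_neqAle eq_sym n0.
have b01 : 0 <= lam (1 + 1) <= 1.
  by rewrite lam0 /= -lamS lerDr.
have -> : z = seg (seg (v 0) (v 1) a) (v (1 + 1)) (lam (1 + 1)).
  have aE : (lam 0 + lam 1) * a = lam 1.
    rewrite /a; have [e|n0] := eqVneq (lam 0 + lam 1) 0; last by rewrite mulrCA divff ?mulr1.
    by have := lam0 0; have := lam0 1; rewrite e mul0r; lra.
  have b1 : 1 - lam (1 + 1) = lam 0 + lam 1 by lra.
  by apply: u_ext; rewrite !u_seg uz !uv ?eqxx ?ord3_neq b1; nra.
have Tv i : (f @` K) (v i) by case: (vP i).
apply: (polygon_image_convex polP) => //.
exact: (polygon_image_convex polP).
Qed.

End Classification.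

(** * Conversely, each triangle of positive size is a polygon *)

Section TriangleGeometry.
Variable R : realType.
Local Notation C := (R[i]^o).
Local Notation lvl := (lvl R).
Implicit Types (p v w z : C) (k : 'I_3 -> int).

Lemma tri_size k : -1 <= tsum k -> 0 < 3 / 4 + (tsum k)%:~R / 2 :> R.
Proof. by rewrite -(ler_int R) rmorphN /=; lra. Qed.

Lemma tri_vertex k j : -1 <= tsum k -> exists v,
  [/\ tri k v, u j v = lvl (k j) & u (j + 1) v = lvl (k (j + 1))].
Proof.
move=> /tri_size k0; have [v vj vj1] := u_pt j (lvl (k j)) (lvl (k (j + 1))).
exists v; split=> //; have := u_sum3 j v; have := lvl_sum R j k => s1 s2.
by apply: (ord3_around (i := j)); lra.
Qed.

Lemma tri_sub_hplane k j l : -1 <= tsum k -> @tri R k `<=` hplane j l ->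
  lvl (k j) <= lvl l.
Proof.
by move=> k0 sub; have [v [Tv vj _]] := tri_vertex j k0; rewrite -vj; exact: sub.
Qed.

Lemma tri_interior k p : (tri k)° p <-> forall j, u j p < lvl (k j).
Proof.
split=> [/nbhs_uP[e e0 He] j|H].
  have e20 : 0 < e / 2 by rewrite divr_gt0.
  have [w [wj _ wd]] := perturb p (- (e / 2)) (ord3_succ_neq j).
  have := He w _ j; rewrite wj => H'; suff : u j p - - (e / 2) <= lvl (k j) by lra.
  by apply: H' => i; apply: le_lt_trans (wd i) _; rewrite normrN gtr0_norm //; lra.
apply/nbhs_uP; pose e := Num.min (lvl (k 0) - u 0 p)
  (Num.min (lvl (k 1) - u 1 p) (lvl (k (1 + 1)) - u (1 + 1) p)).
have eP j : e <= lvl (k j) - u j p.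
  by move: j; apply: ord3P; rewrite !ge_min lexx ?orbT.
exists e; first by rewrite !lt_min !subr_gt0 !H.
move=> x xp j; have := xp j; rewrite ltr_norml => /andP[_]; have := eP j; lra.
Qed.

Lemma tri_seg k : seg_closed (@tri R k).
Proof. by move=> x y t Tx Ty t01 j; apply: hplane_seg; [exact: Tx | exact: Ty |]. Qed.

Lemma closed_tri k : closed (@tri R k).
Proof.
have -> : tri k = \bigcap_(j in [set: 'I_3]) (@u R j @^-1` [set x | x <= lvl (k j)]).
  by apply/seteqP; split=> [z Tz j _|z Tz j]; exact: Tz.
apply: closed_bigI => j _; have /continuous_closedP H := @u_continuous R j.
exact: H (@closed_le R _).
Qed.

Lemma compact_tri k : compact (@tri R k).
Proof.
pose phi (w : R * R) : C := pt0 w.1 w.2.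
have phiC : continuous phi.
  move=> w; apply/(cvgrPdist_lt (F := nbhs w)) => e e0.
  have eR : e = ((complex.Re e)%:C)%C by rewrite RRe_real // gtr0_real.
  have r0 : 0 < complex.Re e by rewrite -ltcR -eR.
  have r8 : 0 < complex.Re e / 8 by rewrite divr_gt0.
  have n1 : \forall w' \near w, `|w.1 - w'.1| < complex.Re e / 8.
    have : (fun w' : R * R => w'.1) @ nbhs w --> w.1 by exact: cvg_fst.
    by move=> /(cvgrPdist_lt (F := nbhs w)) /(_ _ r8).
  have n2 : \forall w' \near w, `|w.2 - w'.2| < complex.Re e / 8.
    have : (fun w' : R * R => w'.2) @ nbhs w --> w.2 by exact: cvg_snd.
    by move=> /(cvgrPdist_lt (F := nbhs w)) /(_ _ r8).
  apply: filterS2 n1 n2 => w' h1 h2; rewrite cdistE eR ltcR.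
  apply: le_lt_trans (cdist_u _ _) _.
  have [-> ->] := u_pt0 w.1 w.2; have [-> ->] := u_pt0 w'.1 w'.2; lra.
(* Lower bound of [u j] on the triangle, from the upper bounds of the other two coordinates; it
   gives an enclosing parallelogram. *)
pose m j := - (lvl (k (j + 1)) + lvl (k (j + 1 + 1))).
have cB : compact (phi @` (`[m 0, lvl (k 0)] `*` `[m 1, lvl (k 1)])).
  apply: continuous_compact; first exact: continuous_subspaceT.
  by apply: compact_setX; exact: segment_compact.
apply: subclosed_compact cB _; first exact: closed_tri.
move=> z Tz; exists (u 0 z, u 1 z); last first.
  by have [e0 e1] := u_pt0 (u 0 z) (u 1 z); exact: u_ext.
have mP j : m j <= u j z.
  by have := Tz (j + 1); have := Tz (j + 1 + 1); have := u_sum3 j z; rewrite /m; lra.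
by split; rewrite /= in_itv /= mP Tz.
Qed.

Lemma tri_deck g k :
  deck_act g @` (@tri R k) = tri (fun j => k (j - g.1) + offset g j).
Proof.
have lvlD (a b : int) : lvl (a + b) = lvl a + b%:~R / 2 by rewrite /lvl intrD; lra.
apply/seteqP; split=> [_ [z Tz <-] j|z Tz].
  by rewrite u_deck lvlD lerD2r.
have [w wz] := deck_surj g z; exists w => // j.
have := Tz (j + g.1); rewrite -wz u_deck addrK lvlD.
by rewrite lerD2r.
Qed.

Lemma locally_onto_id (T : set C) p (M : set C) (e : R) : 0 < e ->
    (forall y, (forall j, `|u j y - u j p| < e) -> T y <-> M y) ->
  locally_onto (PMap T id) p M.
Proof.
move=> e0 He; split; first by exists setT => //; exact: filterT.
apply/seteqP; split=> A /=.
  change (nbhs p (fun x => T x -> A x) -> nbhs p (fun x => M x -> A x)).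
  have : nbhs p (fun y => T y <-> M y) by apply/nbhs_uP; exists e.
  by apply: filterS2 => x TM TA Mx; apply/TA/TM.
change (nbhs p (fun x => M x -> A x) -> nbhs p (fun x => T x -> A x)).
have : nbhs p (fun y => T y <-> M y) by apply/nbhs_uP; exists e.
by apply: filterS2 => x TM MA Tx; apply/MA/TM.
Qed.

Lemma polygon_tri k : -1 <= tsum k -> polygon (PMap (@tri R k) id).
Proof.
move=> k1; have k0 := tri_size k1; set L := 3 / 4 + (tsum k)%:~R / 2 in k0.
have near_lt (j : 'I_3) p : u j p < lvl (k j) ->
    forall y, (forall i, `|u i y - u i p| < lvl (k j) - u j p) -> u j y <= lvl (k j).
  by move=> _ y /(_ j); rewrite ltr_norml => /andP[_]; lra.
split=> /=.
- exact: compact_tri.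
- by apply/convex_setP => x y t; exact: tri_seg.
- have [c c0 c1] := u_pt 0 (lvl (k 0) - L / 3) (lvl (k 1) - L / 3).
  exists c; apply/tri_interior; have := u_sum c; have := lvl_sum R 0 k.
  rewrite add0r -/L => s1 s2; apply: ord3P; rewrite ?add0r in c1 *; lra.
- move=> p /[dup] Ip /tri_interior pk; split.
  + exact: derivable_id.
  + by rewrite derive_id oner_eq0.
  + have /nbhs_uP[e e0 He] := Ip.
    by apply: (locally_onto_id e0) => y /He.
move=> p [Tp nI].
have [j pj] : exists j, u j p = lvl (k j).
  apply: contrapT => /forallNP H; apply: nI; apply/tri_interior => j.
  by rewrite lt_neqAle; apply/andP; split; [apply/eqP; exact: H | exact: Tp].
have [[i [pi pi1]]|ncorner] := pselect (exists i, u i p = lvl (k i) /\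
    u (i + 1) p = lvl (k (i + 1))).
  right; have [g gi gk] := offset_surj i (k i).
  have [h hi hk] := offset_surj (i + 1) (k (i + 1)).
  exists g, h; split=> /=.
  + by rewrite gi hi eq_sym ord3_succ_neq.
  + by apply/liftP; rewrite gi gk.
  + by apply/liftP; rewrite hi hk.
  rewrite !left_of_hplane gi hi gk hk.
  (* The three slacks [lvl (k j) - u j p] add up to [L > 0], so the third one is positive at a
     corner. *)
  have pi2 : u (i + 1 + 1) p < lvl (k (i + 1 + 1)).
    by have := u_sum3 i p; have := lvl_sum R i k; rewrite -/L; lra.
  apply: (@locally_onto_id _ _ _ (lvl (k (i + 1 + 1)) - u (i + 1 + 1) p)).
    by rewrite subr_gt0.
  move=> y yp; split=> [Ty|[yi yi1]]; first by split; exact: Ty.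
  by apply: (ord3_around (i := i)) => //; exact: near_lt pi2 y yp.
left; have [g gj gk] := offset_surj j (k j); exists g; split=> /=.
  by apply/liftP; rewrite gj gk.
rewrite left_of_hplane gj gk.
have pj1 : u (j + 1) p < lvl (k (j + 1)).
  rewrite lt_neqAle; apply/andP; split; last exact: Tp.
  by apply/eqP => e; apply: ncorner; exists j.
have pj2 : u (j + 1 + 1) p < lvl (k (j + 1 + 1)).
  rewrite lt_neqAle; apply/andP; split; last exact: Tp.
  by apply/eqP => e; apply: ncorner; exists (j + 1 + 1); rewrite ord3_succ3.
apply: (@locally_onto_id _ _ _ (Num.min (lvl (k (j + 1)) - u (j + 1) p)
  (lvl (k (j + 1 + 1)) - u (j + 1 + 1) p))).
  by rewrite lt_min !subr_gt0 pj1.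
move=> y yp; split=> [Ty|yj]; first exact: Ty.
apply: (ord3_around (i := j)) => //.
  by apply: (near_lt _ _ pj1 y) => i; have := yp i; rewrite lt_min => /andP[].
by apply: (near_lt _ _ pj2 y) => i; have := yp i; rewrite lt_min => /andP[].
Qed.

End TriangleGeometry.

(** * Edges and corners of a polygon, read off its triangle *)

Section PolygonBoundary.
Variable R : realType.
Local Notation C := (R[i]^o).
Variable (P : Defs.pmap R) (k : 'I_3 -> int).
Hypothesis polP : polygon P.
Hypothesis k0 : -1 <= tsum k.
Hypothesis PT : pfun P @` pdom P = tri k.
Local Notation K := (pdom P).
Local Notation f := (pfun P).
Local Notation lvl := (lvl R).

Lemma polygon_in_tri p : K p -> tri k (f p).
Proof. by move=> Kp; rewrite -PT; exists p. Qed.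

(** A lift that locally bounds the image is a supporting line of the triangle, hence carries one of
    its sides. *)
Lemma on_line_eq p j l M : K p -> locally_onto P p M -> M `<=` hplane j l ->
  u j (f p) = lvl l -> u j (f p) = lvl (k j).
Proof.
move=> Kp H sub fp; have := image_sub_model polP Kp H sub fp; rewrite PT.
move=> /(tri_sub_hplane k0) kl; apply/le_anti; rewrite polygon_in_tri //=.
by rewrite fp.
Qed.

Lemma pboundaryP p : pboundary P p <-> K p /\ exists j, u j (f p) = lvl (k j).
Proof.
split=> [Bp|[Kp [j pj]]].
  have Kp : K p by case: Bp.
  split=> //; have [M mM H] := local_modelP polP Kp.
  case: mM H => [Ip|j l _ pj|j l l' _ pj _] H; first by case: Bp.
    by exists j; exact: on_line_eq H _ pj.
  by exists (j + 1); apply: (on_line_eq Kp H _ pj) => w [].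
split=> // /(interior_image polP); rewrite PT => /tri_interior/(_ j).
by rewrite pj ltxx.
Qed.

(** Over a vertex, an edge point is impossible: its half-plane model would contain points beyond the
    other side. *)
Lemma corner_pointP p : K p ->
  corner_point P p <-> exists j, u j (f p) = lvl (k j) /\ u (j + 1) (f p) = lvl (k (j + 1)).
Proof.
move=> Kp; split=> [[g [h [gh /liftP pg /liftP ph]]]|[j [pj pj1]]].
  rewrite !left_of_hplane => H.
  have eg : u g.1 (f p) = lvl (k g.1) by apply: (on_line_eq Kp H _ pg) => w [].
  have eh : u h.1 (f p) = lvl (k h.1) by apply: (on_line_eq Kp H _ ph) => w [].
  have [e|e] : h.1 = g.1 + 1 \/ g.1 = h.1 + 1.
    by move: gh; move: (g.1) (h.1); do 2!apply: ord3P;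
      rewrite ?eqxx ?ord3E ?add0r //; auto.
  - by exists g.1; rewrite -e.
  - by exists h.1; rewrite -e.
have Bp : pboundary P p by apply/pboundaryP; split=> //; exists j.
case: (polP) => _ _ _ _ /(_ p Bp)[[g [/liftP pg]]|//].
rewrite left_of_hplane => H; have [e e0 He] := local_model_image polP Kp H.
have e20 : 0 < e / 2 by rewrite divr_gt0.
have [i [ig pi]] : exists i, g.1 != i /\ u i (f p) = lvl (k i).
  have [gj|gj] := eqVneq g.1 j; last by exists j.
  by exists (j + 1); rewrite gj eq_sym ord3_succ_neq.
have [w [wi wg wd]] := perturb (f p) (- (e / 2)) ig.
have : (f @` K) w.
  apply/He; last by rewrite /hplane /= wg pg.
  by move=> m; apply: le_lt_trans (wd m) _; rewrite normrN gtr0_norm //; lra.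
by rewrite PT => /(_ i); rewrite wi pi; lra.
Qed.

End PolygonBoundary.

(** * Polygons with the same image differ by a reparametrization *)

Section Reparametrization.
Variable R : realType.
Local Notation C := (R[i]^o).
Implicit Types (g : deck) (x y : C).

Lemma deck_actB g x y : deck_act g x - deck_act g y = tau0 R ^+ g.1 * (x - y).
Proof. by rewrite /deck_act; ring. Qed.

Lemma norm_tau0 : `|tau0 R| = 1.
Proof.
have : `|tau0 R| ^+ 3 = 1 by rewrite -normrX tau_cube normr1.
by move=> /eqP; rewrite pexprn_eq1 //= => /eqP.
Qed.

Lemma cdist_deck g x y : cdist (deck_act g x) (deck_act g y) = cdist x y.
Proof.
apply: (@complexI R); rewrite -!cdistE deck_actB normrM normrX norm_tau0.
by rewrite expr1n mul1r.
Qed.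

Variables (P Q : Defs.pmap R).
Hypothesis (polP : polygon P) (polQ : polygon Q).

(** The reparametrization is the inverse of [pfun Q] composed with [deck_act g \o pfun P].
    Bijectivity and continuity follow from global injectivity; differentiability is the rule for the
    derivative of an inverse. *)
Lemma reparametrization_of_image g :
    pfun Q @` pdom Q = deck_act g @` (pfun P @` pdom P) ->
  reparametrization (deck_pmap g P) Q.
Proof.
move=> eqI; have deck_inj x y : deck_act g x = deck_act g y -> x = y.
  by move=> e; apply: cdist_eq0; rewrite -(cdist_deck g) e cdist0.
have /choice[phi phiP] : forall p, exists x, pdom P p ->
    pdom Q x /\ pfun Q x = deck_act g (pfun P p).
  move=> p; have [Kp|nKp] := pselect (pdom P p); last by exists 0.
  have : (deck_act g @` (pfun P @` pdom P)) (deck_act g (pfun P p)).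
    by exists (pfun P p) => //; exists p.
  by rewrite -eqI => -[x Kx xp]; exists x.
have phi_dist p (e : R) : pdom P p -> 0 < e -> exists2 d : R, 0 < d &
    forall x, pdom P x -> cdist x p < d -> cdist (phi x) (phi p) < e.
  move=> Kp e0; have [Kq fq] := phiP p Kp.
  have [d1 d10 H1] := polygon_inverse_cvg polQ Kq e0.
  have [d d0 H] := within_cdist (polygon_cvg polP Kp) d10.
  exists d => // x Kx xp; have [Kqx fqx] := phiP x Kx.
  by apply: H1 => //; rewrite fq fqx cdist_deck; exact: H.
have phi_inj p x : pdom P p -> pdom P x -> phi p = phi x -> p = x.
  move=> Kp Kx e; apply: (polygon_inj polP) => //; apply: deck_inj.
  by have [_ <-] := phiP p Kp; have [_ <-] := phiP x Kx; rewrite e.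
exists phi; split=> /=.
- split.
  + by move=> p Kp; have [] := phiP p Kp.
  + by move=> p x; rewrite !inE; exact: phi_inj.
  + move=> x Kx; have : (pfun Q @` pdom Q) (pfun Q x) by exists x.
    rewrite eqI => -[_ [p Kp <-] gp]; exists p => //.
    have [Kq fq] := phiP p Kp.
    by apply: (polygon_inj polQ) => //; rewrite fq.
- apply/subspace_continuousP => p Kp.
  apply/(cvgrPdist_lt (F := within (pdom P) (nbhs p))) => e e0.
  have eR : e = ((complex.Re e)%:C)%C by rewrite RRe_real // gtr0_real.
  have r0 : 0 < complex.Re e by rewrite -ltcR -eR.
  have [d d0 Hd] := phi_dist p _ Kp r0.
  change (nbhs p (fun x => pdom P x -> `|phi p - phi x| < e)).
  by apply: filterS (near_cdist p d0) => x xp Kx; rewrite cdistE eR ltcR cdistC; exact: Hd.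
- move=> p Ip; have Kp : pdom P p by exact: interior_subset.
  have [Kr fr] := phiP p Kp; set r := phi p in Kr fr *.
  (* Otherwise [pfun Q r] is on a side of the triangle, while the image contains a whole
     neighbourhood of that point. *)
  have Ir : (pdom Q)° r.
    apply: contrapT => nIr.
    have [k k0 PT] := polygon_image polQ.
    have /(pboundaryP polQ k0 PT)[_ [j rj]] : pboundary Q r by [].
    have := interior_image polP Ip; move=> /nbhs_uP[e e0 He].
    have e20 : 0 < e / 2 by rewrite divr_gt0.
    have [w [wj _ wd]] := perturb (pfun P p) (- (e / 2)) (ord3_succ_neq (j - g.1)).
    have : (pfun P @` pdom P) w.
      by apply: He => i; apply: le_lt_trans (wd i) _; rewrite normrN gtr0_norm //; lra.
    have : tri k (pfun Q r) by rewrite -PT; exists r.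
    move=> /(_ j) _ Tw; have : (deck_act g @` (pfun P @` pdom P)) (deck_act g w).
      by exists w.
    rewrite -eqI PT => /(_ j); rewrite -rj fr !u_deck wj; lra.
  have [derP _ _] : [/\ derivable (pfun P) p 1, 'D_1 (pfun P) p != 0 &
    locally_onto P p setT] by case: polP => _ _ _ /(_ p Ip).
  have [derQ dQ0 _] : [/\ derivable (pfun Q) r 1, 'D_1 (pfun Q) r != 0 &
    locally_onto Q r setT] by case: polQ => _ _ _ /(_ r Ir).
  pose F (h : C) : C := phi (h *: (1 : C) + p) - r.
  have hE (h : C) : h *: (1 : C) + p - p = h by rewrite addrK /GRing.scale /= mulr1.
  have /nbhsCP[d1 d10 Hd1] := Ip.
  (* Injectivity of [phi] keeps its increment [F h] away from 0, so the limit defining the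
     derivative of [pfun Q] can be taken along [F]. *)
  have F0 : F @ (0 : C)^' --> (0 : C)^'.
    move=> A /=; rewrite /nbhs /= => /nbhsCP[e e0 He].
    have [d d0 Hd] := phi_dist p e Kp e0.
    change (nbhs (0 : C) (fun h => h != 0 -> A (F h))).
    apply/nbhsCP; exists (Num.min d d1); first by rewrite lt_min d0.
    move=> h; rewrite lt_min => /andP[hd hd1] h0.
    have hp : cdist (h *: (1 : C) + p) p = cdist h 0 by rewrite /cdist hE subr0.
    have Kh : pdom P (h *: (1 : C) + p).
      by apply: Hd1; rewrite hp.
    apply: He.
      by rewrite /cdist subr0; apply: Hd => //; rewrite hp.
    rewrite /F subr_eq0; apply/eqP => /phi_inj => /(_ Kh Kp) e1.
    by move: h0; rewrite -(hE h) e1 subrr eqxx.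
  have near_dom : \forall h \near (0 : C)^', pdom P (h *: (1 : C) + p) /\ h != 0.
    change (nbhs (0 : C) (fun h => h != 0 -> pdom P (h *: (1 : C) + p) /\ h != 0)).
    apply/nbhsCP; exists d1 => // h hd1 h0; split=> //.
    apply: Hd1.
    by rewrite /cdist hE -[X in normc X](subr0 h).
  pose slope (f : C -> C) (a : C) (h : C) : C := h^-1 *: ((f \o shift a) (h *: 1) - f a).
  have cvgQ : (fun h => slope (pfun Q) r (F h)) @ (0 : C)^' --> 'D_1 (pfun Q) r.
    have derQ' : slope (pfun Q) r @ (0 : C)^' --> 'D_1 (pfun Q) r by exact: derQ.
    exact: (@cvg_comp _ _ _ F (slope (pfun Q) r) _ _ _ F0 derQ').
  have cvgP : (fun h => slope (pfun P) p h) @ (0 : C)^' --> 'D_1 (pfun P) p by exact: derP.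
  (* The difference quotient of [phi] is that of [deck_act g \o pfun P] divided by that of [pfun Q]
     along [F], whose limit is nonzero. *)
  apply/cvg_ex; exists (('D_1 (pfun Q) r)^-1 * (tau0 R ^+ g.1 * 'D_1 (pfun P) p)).
  apply: cvg_trans (cvgM (cvgV dQ0 cvgQ) (cvgM (cvg_cst (tau0 R ^+ g.1)) cvgP)).
  apply: near_eq_cvg.
  apply: filterS near_dom => h [Kh h0].
  have [_ fh] := phiP _ Kh.
  have Fh : F h *: (1 : C) + r = phi (h *: (1 : C) + p).
    by rewrite /F /GRing.scale /= mulr1 subrK.
  rewrite /slope /= Fh fh fr deck_actB /GRing.scale /=.
  have T0 : tau0 R ^+ g.1 != 0.
    by rewrite expf_neq0 // -normr_eq0 norm_tau0 oner_eq0.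
  have D0 : pfun P (h * 1 + p) - pfun P p != 0.
    rewrite subr_eq0; apply/eqP => /(polygon_inj polP Kh Kp) e.
    by move: h0; rewrite -(hE h) [_ + p]e subrr eqxx.
  change (phi (h * 1 + p) - phi p) with (F h).
  rewrite invfM invrK; move: (F h) (_ ^+ _) (_ - _) T0 D0 => a t d T0 D0.
  by field; rewrite T0 h0 D0.
- by move=> p Kp; have [] := phiP p Kp.
Qed.

End Reparametrization.

(** * Counting boundary points *)


Section Counting.

Lemma ncard_image (T : finType) (U : choiceType) (A : {pred T}) (F : T -> U) (B : set U) :
  {in A &, injective F} -> (forall x, x \in A -> B (F x)) ->
  (forall y, B y -> exists2 x, x \in A & F x = y) -> ncard B = #|A|.
Proof.
move=> inj sub sur.
have -> : B = [set` [fset y in map F (enum A)]%fset].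
  apply/seteqP; split=> y /=; rewrite !inE.
    by move=> /sur[x xA <-]; apply: map_f; rewrite mem_enum.
  by move=> /mapP[x]; rewrite mem_enum => /sub Bx ->.
rewrite /ncard set_fsetK card_fseq undup_id ?size_map ?cardE //.
by rewrite map_inj_in_uniq ?enum_uniq // => x y; rewrite !mem_enum; exact: inj.
Qed.

(** Points of the domain are counted through their images: [w] enumerates the values and [f] is
    injective. *)
Lemma ncard_preimage (T : finType) (U : pointedType) (V : choiceType) (A : {pred T})
    (w : T -> V) (K : set U) (f : U -> V) (B : set V) :
  (forall x y, K x -> K y -> f x = f y -> x = y) ->
  {in A &, injective w} -> (forall x, x \in A -> B (w x) /\ (f @` K) (w x)) ->
  (forall p, K p -> B (f p) -> exists2 x, x \in A & w x = f p) ->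
  ncard [set p | K p /\ B (f p)] = #|A|.
Proof.
move=> injf injw sub sur.
have /choice[F FP] : forall x, exists p, x \in A -> K p /\ f p = w x.
  move=> x; have [xA|] := boolP (x \in A); last by exists point.
  by have [_ [p Kp fp]] := sub x xA; exists p.
apply: (ncard_image (F := F)).
- move=> x y xA yA e; apply: injw => //.
  by have [_ <-] := FP x xA; have [_ <-] := FP y yA; rewrite e.
- by move=> x xA /=; have [Kp ->] := FP x xA; split=> //; case: (sub x xA).
- move=> p /= [Kp /(sur p Kp)[x xA wx]]; exists x => //.
  by have [KF fF] := FP x xA; apply: injf => //; rewrite fF.
Qed.

End Counting.

(** * Deck orbits of points, and their points on a triangle *)

Section DeckGroup.
Variable R : realType.
Local Notation C := (R[i]^o).
Local Notation lvl := (lvl R).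
Implicit Types (g h : deck) (v w z : C) (i j : 'I_3) (k : 'I_3 -> int).

Lemma ord3_predK (i : 'I_3) : i - 1 + 1 = i.
Proof. by rewrite subrK. Qed.

Lemma offset_sum_around g i : offset g i + offset g (i + 1) + offset g (i + 1 + 1) = 0.
Proof. by rewrite -(tsum_around i (offset g)); exact: offset_sum. Qed.

Lemma tsum_shift g k : tsum (fun j => k (j - g.1) + offset g j) = tsum k.
Proof.
have e := offset_sum g; rewrite [RHS](tsum_around (- g.1) k) /tsum.
rewrite sub0r (addrC 1 (- _)) (addrC (1 + 1) (- _)) (addrA (- g.1)).
by rewrite -[RHS]addr0 -e; ring.
Qed.

Lemma offset_exists_around i j (t : 'I_3 -> int) : tsum t = 0 ->
  (3 %| t j - t (j + 1)%R)%Z -> exists2 g, g.1 = i & forall j, offset g j = t j.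
Proof.
move=> t0 tj; apply: offset_exists => //.
move: tj t0; rewrite /tsum; move: j; apply: ord3P; rewrite ?add0r ?ord3E //;
  move: (t 0) (t 1) (t (1 + 1)) => a b c /dvdzP[m e] e2; apply/dvdzP.
  by exists (m - b); lia.
by exists (m + a); lia.
Qed.

Lemma deck_ext g h : g.1 = h.1 -> (forall j, offset g j = offset h j) -> g = h.
Proof.
case: g h => i [a b] [i' [a' b']] /= <- H; have := H 0; have := H (1 + 1).
rewrite /offset /= => e1 e2; have -> : a = a' by lia.
by have -> : b = b' by lia.
Qed.

(** An element is determined by its rotation index and its offsets; the product is built from those
    that [u_deck] prescribes. *)
Lemma deck_comp g h : exists g', forall z : C, deck_act g' z = deck_act g (deck_act h z).
Proof.
have [||g' g1 go] := @offset_exists (g.1 + h.1)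
    (fun j => offset h (j - g.1) + offset g j).
- by have := tsum_shift g (offset h); rewrite /tsum offset_sum.
- rewrite sub0r addrC; have := offset_mod3 h (- g.1); have := offset_mod3 g 0.
  rewrite add0r (addrC 1 (- _)) => /dvdzP[m em] /dvdzP[n en].
  by apply/dvdzP; exists (n + m); rewrite mulrDl -em -en; ring.
exists g' => z; apply: u_ext; rewrite !u_deck go g1 intrD opprD addrA; lra.
Qed.

Lemma deck_inv g : exists g', forall z : C, deck_act g' (deck_act g z) = z.
Proof.
have [||g' g1 go] := @offset_exists (- g.1) (fun j => - offset g (j + g.1)).
- by rewrite add0r (addrC 1) (addrC (1 + 1)) (addrA g.1) -!opprD offset_sum_around oppr0.
- have := offset_mod3 g g.1; rewrite add0r (addrC 1) => /dvdzP[m em].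
  by apply/dvdzP; exists (- m); rewrite mulNr -em; ring.
exists g' => z; apply: u_ext; rewrite !u_deck go g1 opprK addrK rmorphN /=; lra.
Qed.

Lemma deck_id : exists g, forall z : C, deck_act g z = z.
Proof.
by exists (0, (0, 0)) => z; rewrite /deck_act /= expr0 mul1r mulr0z addr0 mul0r addr0.
Qed.

(* [theta = 0] describes the double points, [0 < theta < 2] with [theta != 1] the
   generic points of the lines. *)
Definition on_line (j : 'I_3) (l l' : int) (theta : R) w :=
  u j w = lvl l /\ u (j + 1) w = lvl l' - theta / 4.

Definition orbit_of (theta : R) (rho : int) w := exists j l l',
  on_line j l l' theta w /\ (3 %| l - l' - rho)%Z.

Lemma lvlD (a b : int) : lvl (a + b) = lvl a + b%:~R / 2.
Proof. by rewrite /lvl intrD; lra. Qed.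

(** A deck transformation rotates [j] and moves both levels by offsets congruent modulo 3, so
    [l - l'] modulo 3 is invariant. Conversely, equal residues let [offset_exists_around] produce
    the transformation. *)
Lemma orbit_ofP i (a b : int) (theta : R) v w : on_line i a b theta v ->
  same_orbit v w <-> orbit_of theta (a - b) w.
Proof.
move=> [va vb]; split=> [[g ->]|[j [l [l' [[wl wl'] /dvdzP[m em]]]]]].
  exists (i + g.1), (a + offset g (i + g.1)), (b + offset g (i + g.1 + 1)).
  split; first split.
  - by rewrite u_deck addrK lvlD va.
  - by rewrite u_deck addrAC addrK lvlD vb; lra.
  have := offset_mod3 g (i + g.1) => /dvdzP[m em].
  by apply/dvdzP; exists m; rewrite -em; ring.
(* Two offsets are imposed by the levels, the third by the vanishing of the sum. *)
pose t n := if n == j then l - a else if n == j + 1 then l' - b else a + b - l - l'.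
have t1 : t j = l - a by rewrite /t eqxx.
have t2 : t (j + 1) = l' - b by rewrite /t (negbTE (ord3_succ_neq j)) eqxx.
have t3 : t (j + 1 + 1) = a + b - l - l'.
  by rewrite /t (negbTE (ord3_succ2_neq j)) (negbTE (ord3_succ_neq (j + 1))).
have [||g gj go] := @offset_exists_around (j - i) j t.
- by rewrite (tsum_around j) t1 t2 t3; ring.
- by rewrite t1 t2; apply/dvdzP; exists m; rewrite -em; ring.
exists g; apply: (@u_ext2 _ j); rewrite u_deck gj go ?t1 ?t2.
  by rewrite subKr va wl -lvlD addrC subrK.
rewrite wl' (_ : j + 1 - (j - i) = i + 1); last by rewrite opprB addrC addrA subrK.
by have := lvlD b (l' - b); rewrite addrC subrK vb; lra.
Qed.

Lemma lvl_sub (m l : int) (theta : R) : 0 <= theta < 2 ->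
  lvl m = lvl l - theta / 4 -> theta = 0 /\ m = l.
Proof.
rewrite /lvl => /andP[t0 t2] e.
have d : (l - m)%:~R = theta / 2 :> R by rewrite rmorphB /=; lra.
have : (0 <= l - m < 1).
  by rewrite -(ler_int R) -(ltr_int R) d /=; apply/andP; split; lra.
move=> lm; have e0 : m = l by lia.
by split=> //; rewrite e0 subrr in d; lra.
Qed.

(** No three lifts are concurrent: four times the sum is an odd integer. *)
Lemma lvl_no_triple (a b c : int) : lvl a + lvl b + lvl c != 0.
Proof.
apply/eqP; rewrite /lvl => e.
have : (3 + 2 * (a + b + c))%:~R = 0 :> R by rewrite !(intrD, intrM) /=; lra.
by move=> /eqP; rewrite intr_eq0 => /eqP; lia.
Qed.

(** Two descriptions with different directions would force [theta = 0] and three concurrent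
    lifts. *)
Lemma on_line_uniq i j (m m' l l' : int) (theta : R) w : 0 <= theta < 2 ->
  on_line i m m' theta w -> on_line j l l' theta w -> [/\ i = j, m = l & m' = l'].
Proof.
move=> t02 [wm wm'] [wl wl'].
have [ij|[ij|ij]] : i = j \/ i = j + 1 \/ i = j + 1 + 1.
- by move: i {wm wm'}; apply: (ord3_around (i := j)); auto.
- subst i; split=> //; first by apply: (@lvl_inj R); rewrite -wm -wl.
  by apply: (@lvl_inj R); have := wl'; rewrite wm'; lra.
- subst i; have := u_sum3 j w; have [t0 _] := lvl_sub t02 (etrans (esym wm) wl').
  rewrite wl wm wm' t0 mul0r subr0 => /eqP.
  by rewrite (negbTE (lvl_no_triple _ _ _)).
subst i; rewrite ord3_succ3 in wm'; have := u_sum3 j w.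
have [t0 _] := lvl_sub t02 (etrans (esym wl) wm').
rewrite wl wm wl' t0 mul0r subr0 => /eqP.
by rewrite (negbTE (lvl_no_triple _ _ _)).
Qed.

(** Measured by [u (j + 1)], the side has length [3/4 + tsum k / 2], and the points sit at
    [theta/4 + d/2] from its upper end. So [d <= tsum k + (3 - theta)/2], whose integer part depends
    on whether [theta] is below or above 1. *)
Lemma in_tri_on_line k j (l' : int) (theta : R) (N : nat) w :
    0 < theta < 2 -> theta != 1 -> -1 <= tsum k ->
    N%:Z = tsum k + (if theta < 1 then 2 else 1) ->
    on_line j (k j) l' theta w ->
  tri k w <-> exists2 d : 'I_N, True & l' = k (j + 1) - d%:Z.
Proof.
move=> /andP[t0 t2] t1 k0 NE [wj wj1]; have s1 := u_sum3 j w; have s2 := lvl_sum R j k.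
have sE : (tsum k)%:~R = N%:R - (if theta < 1 then 2 else 1) :> R.
  have -> : tsum k = N%:Z - (if theta < 1 then 2 else 1) by rewrite NE addrK.
  by rewrite rmorphB /=; case: ifP.
rewrite sE in s2; rewrite wj wj1 in s1.
split=> [Tw|[d _ dE]].
  have := Tw (j + 1); have := Tw (j + 1 + 1); rewrite wj1 => h2 h1.
  have e1 : l' <= k (j + 1).
    rewrite -ltzD1 -(ltr_int R) intrD; move: h1; rewrite /lvl; lra.
  have e2 : k (j + 1) - l' < N%:Z.
    rewrite -(ltr_int R) rmorphB /=; move: s2 h2 s1; rewrite /lvl.
    by move: t1; case: (ltgtP theta 1) => // tt _; lra.
  have dN : (`|k (j + 1)%R - l'| < N)%N by lia.
  by exists (Ordinal dN) => //=; lia.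
have dR : (d : nat)%:R <= N%:R - 1 :> R.
  by rewrite lerBrDr natr1 ler_nat ltn_ord.
have d0 : 0 <= (d : nat)%:R :> R by [].
have l'E : l'%:~R = (k (j + 1))%:~R - (d : nat)%:R :> R by rewrite dE rmorphB.
apply: (ord3_around (i := j)).
- by rewrite wj.
- by rewrite wj1 /lvl l'E; lra.
move: s2 s1; rewrite /lvl l'E.
by move: t1; case: (ltgtP theta 1) => // tt _; lra.
Qed.

(* The points [u (j + 1) = lvl (k (j + 1) - d)] of the [j]-th side of [tri k] have orbit
   type [k j - k (j + 1) + d]. *)
Definition residue_count (k : 'I_3 -> int) (rho : int) (N : nat) : nat :=
  #|[pred jd : 'I_3 * 'I_N | (3 %| k jd.1 - k (jd.1 + 1)%R + jd.2%:Z - rho)%Z]|.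

Lemma line_point j (l l' : int) (theta : R) : exists w, on_line j l l' theta w.
Proof. by have [w wj wj1] := u_pt j (lvl l) (lvl l' - theta / 4); exists w. Qed.

(** Stated for an injective map onto the triangle, because it is applied both to a polygon and to
    its reflection. *)
Lemma count_line_points (K : set C) (f : C -> C) k (theta : R) (rho : int) (N : nat) :
    (forall x z, K x -> K z -> f x = f z -> x = z) -> f @` K = tri k ->
    -1 <= tsum k -> 0 < theta < 2 -> theta != 1 ->
    N%:Z = tsum k + (if theta < 1 then 2 else 1) ->
  ncard [set p | K p /\ ((exists j, u j (f p) = lvl (k j)) /\ orbit_of theta rho (f p))] =
    residue_count k rho N.
Proof.
move=> injf PT k0 t02 t1 NE.
have t02' : 0 <= theta < 2 by case/andP: t02 => /ltW -> ->.
have /choice[w wP] : forall jd : 'I_3 * 'I_N, exists w,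
    on_line jd.1 (k jd.1) (k (jd.1 + 1) - jd.2%:Z) theta w.
  by move=> jd; exact: line_point.
apply: (ncard_preimage (w := w)
  (B := [set v | (exists j, u j v = lvl (k j)) /\ orbit_of theta rho v])).
- exact: injf.
- move=> [i c] [j d] _ _ e; have := wP (i, c); rewrite e => h1.
  have [/= -> _ cd] := on_line_uniq t02' h1 (wP (j, d)).
  by congr (_, _); apply/val_inj => /=; move: cd => /=; lia.
- move=> [j d]; rewrite inE /= => dv; have [wj wj1] := wP (j, d).
  split; first split.
  + by exists j.
  + exists j, (k j), (k (j + 1) - d%:Z); split=> //.
    by rewrite opprB [d%:Z - _]addrC addrA.
  change ((f @` K) (w (j, d))); rewrite PT; apply/(in_tri_on_line t02 t1 k0 NE (wP (j, d))).
  by exists d.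
move=> p Kp [[i pi] [j [l [l' [[pl pl'] dv]]]]].
have Tp : tri k (f p) by rewrite -PT; exists p.
have ij : j = i /\ l = k i.
  have : i = j \/ i = j + 1 \/ i = j + 1 + 1.
    by move: (i); apply: (ord3_around (i := j)); auto.
  case=> [ij|[ij|ij]].
  - by subst i; split=> //; apply: (@lvl_inj R); rewrite -pl.
  - subst i; have [t0 _] := lvl_sub t02' (etrans (esym pi) pl').
    by move: t02; rewrite t0 ltxx.
  subst i; have := u_sum3 j (f p); rewrite pl pl' pi => s.
  (* The point would lie on two lifts, which makes [theta] an odd integer; between 0 and 2 only the
     excluded value 1 remains. *)
  have e : (3 + 2 * (l + l' + k (j + 1 + 1)))%:~R = theta :> R.
    by move: s; rewrite /lvl !(intrD, intrM) /=; lra.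
  exfalso; move: t1 t02; rewrite -e (ltr_int _ 0) (ltr_int _ _ 2) => n1 n2.
  move: (l + _ + _) n1 n2 => a n1 n2; have a1 : 3 + 2 * a = 1 by lia.
  by rewrite a1 eqxx in n1.
case: ij => ji li; subst j l.
have /(in_tri_on_line t02 t1 k0 NE (conj pi pl'))[d _ dE] := Tp.
exists (i, d); first by rewrite inE /= -[X in (3 %| X)%Z](_ : k i - l' - rho = _) // dE; ring.
have [wi wi1] := wP (i, d).
by apply: (@u_ext2 _ i); rewrite ?wi ?pi // wi1 pl' dE.
Qed.

Lemma count_orbit_of (P : Defs.pmap R) k (theta : R) (rho : int) (N : nat) :
    polygon P -> -1 <= tsum k -> pfun P @` pdom P = tri k ->
    0 < theta < 2 -> theta != 1 ->
    N%:Z = tsum k + (if theta < 1 then 2 else 1) ->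
  ncard [set p | pboundary P p /\ orbit_of theta rho (pfun P p)] =
    residue_count k rho N.
Proof.
move=> polP k0 PT t02 t1 NE.
rewrite -(count_line_points rho (@polygon_inj R P polP) PT k0 t02 t1 NE).
congr ncard; apply/seteqP; split=> p /=; first by move=> [/(pboundaryP polP k0 PT)[]].
by move=> [Kp [e o]]; split=> //; apply/(pboundaryP polP k0 PT).
Qed.

End DeckGroup.

(** * Classes of polygons and their corner, [s] and [r] numbers *)

Section Invariants.
Variable R : realType.
Local Notation C := (R[i]^o).
Local Notation lvl := (lvl R).
Implicit Types (P Q : Defs.pmap R) (g h : deck) (v w z : C) (i j : 'I_3).
Implicit Types (k : 'I_3 -> int).

Definition image_of P : set C := pfun P @` pdom P.

Lemma image_of_reparametrization P Q g :
  reparametrization (deck_pmap g P) Q -> image_of Q = deck_act g @` image_of P.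
Proof.
move=> [phi [[sub _ sur] _ _ e]]; apply/seteqP; split=> [_ [x Kx <-]|_ [_ [p Kp <-] <-]].
  have [p Kp px] := sur x Kx; exists (pfun P p); first by exists p.
  by rewrite -px e.
by exists (phi p); [exact: sub | rewrite e].
Qed.

Lemma reparametrizationP P Q g : polygon P -> polygon Q ->
  reparametrization (deck_pmap g P) Q <-> image_of Q = deck_act g @` image_of P.
Proof.
by move=> polP polQ; split; [exact: image_of_reparametrization
                            |exact: reparametrization_of_image].
Qed.

Lemma polygon_classP P Q : polygon P ->
  polygon_class P Q <-> polygon Q /\ exists g, image_of Q = deck_act g @` image_of P.
Proof.
by move=> polP; split=> -[polQ [g H]]; split=> //; exists g; apply/reparametrizationP.
Qed.

Lemma polygon_class_eq P Q g : polygon P -> polygon Q ->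
  image_of Q = deck_act g @` image_of P -> polygon_class P = polygon_class Q.
Proof.
move=> polP polQ e; have [g' gK] := @deck_inv R g.
have e' : image_of P = deck_act g' @` image_of Q.
  rewrite e image_comp; apply/seteqP; split=> [z Pz|_ [z Pz <-]]; last by rewrite /= gK.
  by exists z => //=; rewrite gK.
apply/seteqP; split=> S /polygon_classP[//|polS [h eS]]; apply/polygon_classP => //; split=> //.
  have [h' hE] := @deck_comp R h g'; exists h'; rewrite eS e' image_comp.
  by apply: eq_imagel => z _ /=; rewrite hE.
have [h' hE] := @deck_comp R h g; exists h'; rewrite eS e image_comp.
by apply: eq_imagel => z _ /=; rewrite hE.
Qed.

Lemma polygon_class_refl P : polygon P -> polygon_class P P.
Proof.
move=> polP; apply/polygon_classP => //; split=> //.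
have [g gE] := @deck_id R; exists g.
by apply/seteqP; split=> [z Pz|_ [z Pz <-]]; [exists z | rewrite gE].
Qed.

Lemma tri_eq k k' : -1 <= tsum k -> @tri R k = tri k' -> forall j, k j = k' j.
Proof.
move=> k0 e j.
have e1 : lvl (k j) <= lvl (k' j).
  by apply: (tri_sub_hplane k0); rewrite e => z Tz; exact: Tz.
have k'0 : forall i, k i <= k' i.
  move=> i; have : lvl (k i) <= lvl (k' i).
    by apply: (tri_sub_hplane k0); rewrite e => z Tz; exact: Tz.
  by rewrite /lvl lerD2l ler_pM2r ?invr_gt0 // ler_int.
have k'1 : -1 <= tsum k'.
  have := k'0 0; have := k'0 1; have := k'0 (1 + 1); move: k0; rewrite /tsum.
  move: (k 0) (k 1) (k (1 + 1)) (k' 0) (k' 1) (k' (1 + 1)) => *; lia.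
apply: (@lvl_inj R); apply/le_anti; rewrite e1 /=.
by apply: (tri_sub_hplane k'1); rewrite -e => z Tz; exact: Tz.
Qed.

Lemma corner_number_tri P k i (a b : int) v :
    polygon P -> -1 <= tsum k -> image_of P = tri k -> on_line i a b 0 v ->
  corner_number P v = #|[pred j : 'I_3 | (3 %| k j - k (j + 1)%R - (a - b))%Z]|.
Proof.
move=> polP k0 PT /orbit_ofP ov.
have t02 : 0 <= (0 : R) < 2 by rewrite lexx ltr0n.
have /choice[w wP] : forall j, exists w, on_line j (k j) (k (j + 1)) 0 w.
  by move=> j; exact: line_point.
have wu j : u j (w j) = lvl (k j) /\ u (j + 1) (w j) = lvl (k (j + 1)).
  by have [-> ->] := wP j; rewrite mul0r subr0.
pose B : set C := [set z | (exists j, u j z = lvl (k j) /\ u (j + 1) z = lvl (k (j + 1))) /\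
  orbit_of 0 (a - b) z].
rewrite /corner_number (_ : [set p | _] = [set p | pdom P p /\ B (pfun P p)]); last first.
  apply/seteqP; split=> p /=.
    move=> [/(pboundaryP polP k0 PT)[Kp _] /(corner_pointP polP k0 PT Kp) c /ov o].
    by [].
  move=> [Kp [c o]]; split; last exact/ov.
    by apply/(pboundaryP polP k0 PT); split=> //; have [j [? _]] := c; exists j.
  exact/(corner_pointP polP k0 PT Kp).
apply: (ncard_preimage (w := w)).
- exact: polygon_inj.
- move=> x y _ _ e; have := wP x; rewrite e => h.
  by have [] := on_line_uniq t02 h (wP y).
- move=> j; rewrite inE => dj; split; first split.
  + by exists j.
  + by exists j, (k j), (k (j + 1)).
  change ((pfun P @` pdom P) (w j)); rewrite -/(image_of P) PT.
  have [v' [Tv' vj vj1]] := tri_vertex R j k0; have [wj wj1] := wu j.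
  by rewrite (_ : w j = v') //; apply: (@u_ext2 _ j); rewrite ?wj ?vj ?wj1 ?vj1.
move=> p Kp [[j [pj pj1]] [j' [l [l' [h dv]]]]].
have h' : on_line j (k j) (k (j + 1)) 0 (pfun P p).
  by split; rewrite // mul0r subr0.
have [ej el el'] := on_line_uniq t02 h h'; subst j' l l'.
exists j; first by [].
by have [wj wj1] := wu j; apply: (@u_ext2 _ j); rewrite ?wj ?wj1.
Qed.

Lemma ReC z : complex.Re z^* = complex.Re z. Proof. by case: z. Qed.
Lemma ImC z : complex.Im z^* = - complex.Im z. Proof. by case: z. Qed.
Lemma conjK z : (z^*)^* = z.
Proof. by apply: complex_ext; rewrite ?ReC ?ImC // opprK. Qed.

Lemma cdistJ z w : cdist z^* w^* = cdist z w.
Proof.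
apply/eqP; rewrite -(@eqrXn2 _ 2) // ?cdist_ge0 //.
by rewrite -!sqn_cdist /sqn !ReB !ImB !ReC !ImC; apply/eqP; ring.
Qed.

Lemma u_mirror j z : u j (- z^*) = - u (- j) z.
Proof.
have ReN w : complex.Re (- w) = - complex.Re w by case: w.
have ImN w : complex.Im (- w) = - complex.Im w by case: w.
move: j; apply: ord3P; rewrite ?oppr0 ?ord3E !uE ReN ?ImN ReC ?ImC //; lra.
Qed.

(** The reflection reverses the cyclic order of the directions and negates coordinates, with
    [- lvl l = lvl (-1 - l)]; eliminating one coordinate by [u_sum3] turns [theta] into [1 + theta].
    Thus [s(P^op)] counts points with parameter between 1 and 2 on the sides of [P] itself. *)
Lemma orbit_of_mirror (theta : R) (rho : int) w :
  orbit_of theta rho (- w^*) <-> orbit_of (1 + theta) (rho + 1) w.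
Proof.
split=> [[j [l [l' [[]]]]]|[m [n [n' [[wn wn'] /dvdzP[q e]]]]]].
  rewrite !u_mirror => wl wl' /dvdzP[q e].
  exists (- j), (-1 - l), (l + l' + 1); split; last first.
    by apply/dvdzP; exists (q - l - 1); rewrite !mulrBl -e; ring.
  have := u_sum3 (- j - 1) w; rewrite ord3_predK.
  rewrite opprD in wl'; rewrite /on_line.
  have wl0 : u (- j) w = - lvl l by rewrite -wl opprK.
  have wl1 : u (- j - 1) w = - lvl l' + theta / 4 by rewrite -[LHS]opprK wl'; ring.
  rewrite wl0 wl1 => s; split; first by rewrite /lvl !intrD rmorphN /=; lra.
  by move: s; rewrite /lvl !intrD; lra.
exists (- m), (-1 - n), (n' + n); split; last first.
  by apply/dvdzP; exists (q - n); lia.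
have := u_sum3 (m - 1) w; rewrite ord3_predK wn wn' => s.
split; rewrite u_mirror ?opprD opprK ?wn; first by rewrite /lvl !intrD rmorphN /=; lra.
by move: s; rewrite /lvl !intrD; lra.
Qed.

Lemma s_number_tri P k e i (a b : int) (theta : R) (N : nat) :
    polygon P -> -1 <= tsum k -> image_of P = tri k ->
    0 < theta < 1 -> on_line i a b theta e -> N%:Z = tsum k + 2 ->
  s_number e P = residue_count k (a - b) N.
Proof.
move=> polP k0 PT /andP[t0 t1] /orbit_ofP oe NE.
have t02 : 0 < theta < 2 by rewrite t0 /=; lra.
rewrite -(@count_orbit_of _ P k theta (a - b) N) ?lt_eqF // ?t1 //.
by congr ncard; apply/seteqP; split=> p /= -[Bp /oe].
Qed.

Lemma pboundary_reflect P p : pboundary (Defs.reflect P) p <-> pboundary P p^*.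
Proof.
have sub (A : set C) z : (Num.conj @` A)° z -> A° z^*.
  move=> /nbhsCP[e e0 H]; apply/nbhsCP; exists e => // x xz.
  have [|y Ay yx] := H x^*; first by rewrite -[z]conjK cdistJ.
  by rewrite -[x]conjK -yx conjK.
have JJ (A : set C) : Num.conj @` (Num.conj @` A) = A.
  rewrite image_comp; apply/seteqP; split=> [_ [z Az <-]|z Az]; first by rewrite /= conjK.
  by exists z => //=; rewrite conjK.
rewrite /pboundary /Defs.reflect /=; split=> -[Kp nI]; split.
- by have [x Kx <-] := Kp; rewrite conjK.
- move=> I; apply: nI; have := sub (Num.conj @` pdom P) p^*.
  by rewrite JJ conjK; exact.
- by exists p^* => //; exact: conjK.
- by move=> /sub.
Qed.

Lemma s_number_reflect P k e i (a b : int) (theta : R) (N : nat) :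
    polygon P -> -1 <= tsum k -> image_of P = tri k ->
    0 < theta < 1 -> on_line i a b theta e -> N%:Z = tsum k + 1 ->
  s_number e (Defs.reflect P) = residue_count k (a - b + 1) N.
Proof.
move=> polP k0 PT /andP[t0 t1] /orbit_ofP oe NE.
have t02 : 0 < 1 + theta < 2 by apply/andP; split; lra.
have tn1 : 1 + theta != 1 by rewrite gt_eqF //; lra.
have tlt : (1 + theta < 1) = false by apply/negbTE; rewrite -leNgt; lra.
rewrite -(@count_line_points _ (Num.conj @` pdom P) (fun z => pfun P z^*) k
  (1 + theta) (a - b + 1) N) ?tlt //; last first.
- rewrite -PT /image_of image_comp; apply: eq_imagel => z _ /=.
  by rewrite conjK.
- move=> _ _ [x Kx <-] [y Ky <-]; rewrite !conjK => /(polygon_inj polP Kx Ky) ->//.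
congr ncard; apply/seteqP; split=> p /=.
  move=> [/pboundary_reflect/(pboundaryP polP k0 PT)[Kp e1] /oe /orbit_of_mirror o].
  by split=> //; exists p^* => //; exact: conjK.
move=> [[x Kx <-] [e1 o]]; split; last by apply/oe/orbit_of_mirror.
by apply/pboundary_reflect/(pboundaryP polP k0 PT); move: e1; rewrite conjK.
Qed.

(** A deck element that fixes [tri k] is determined by its rotation index [i], with offsets
    [k j - k (j - i)]. These have sum 0, and they are congruent modulo 3 exactly when [i = 0] or 3
    divides [tsum k]. *)
Lemma r_number_tri P k : polygon P -> -1 <= tsum k -> image_of P = tri k ->
  r_number P = if (3 %| tsum k)%Z then 3%N else 1%N.
Proof.
move=> polP k0 PT.
have rP g : reparametrization (deck_pmap g P) P <->
    forall j, k j = k (j - g.1) + offset g j.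
  rewrite reparametrizationP // PT tri_deck; split=> [/(tri_eq k0)//|e].
  by congr tri; apply/funext.
pose t (i j : 'I_3) : int := k j - k (j - i).
have idx : (0 + 1 = 1 :> 'I_3) * (0 - 1 = 1 + 1 :> 'I_3) * (1 - 1 = 0 :> 'I_3) *
  (0 - (1 + 1) = 1 :> 'I_3) * (1 - (1 + 1) = 1 + 1 :> 'I_3) by do !split; apply/val_inj.
have t_sum i : tsum (t i) = 0.
  rewrite /t /tsum; apply/eqP; move: i; apply: ord3P;
    rewrite ?subr0 ?sub0r ?ord3E ?subrr ?addrK //; apply/eqP.
  - by ring.
  - by ring.
have t_div i : (3 %| tsum k)%Z || (i == 0) -> (3 %| t i 0%R - t i (0 + 1)%R)%Z.
  move=> H; apply/dvdzP; rewrite /t; move: i H; apply: ord3P; rewrite ?ord3_neq ?eqxx /= ?orbF.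
  - by move=> _; exists 0; rewrite !subr0; ring.
  - move=> /dvdzP[q e]; exists (k 0 - q); rewrite !idx mulrBl -e /tsum.
    by ring.
  move=> /dvdzP[q e]; exists (q - k 1); rewrite !idx.
  by rewrite mulrBl -e /tsum; ring.
have /choice[G GP] : forall i, exists g : deck, (3 %| tsum k)%Z || (i == 0) ->
    g.1 = i /\ forall j, offset g j = t i j.
  move=> i; have [H|H] := boolP ((3 %| tsum k)%Z || (i == 0)); last first.
    by exists (0, (0, 0)).
  have [g g1 go] := @offset_exists_around i 0 (t i) (t_sum i) (t_div i H).
  by exists g.
rewrite /r_number (ncard_image (A := [pred i : 'I_3 | (3 %| tsum k)%Z || (i == 0)]) (F := G)).
- case: ifP => K3; last first.
    by rewrite (eq_card (B := pred1 0)) ?card1 // => i; rewrite !inE K3.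
  by rewrite (eq_card (B := predT)) ?card_ord // => i; rewrite !inE K3.
- by move=> i j; rewrite !inE => /GP[gi _] /GP[gj _] e; rewrite -gi e gj.
- move=> i /GP[g1 go] /=; apply/rP => j; rewrite g1 go /t; ring.
move=> g /= /rP e.
have K3 : (3 %| tsum k)%Z || (g.1 == 0).
  have [g10|g0] := eqVneq g.1 (0 : 'I_3); first by rewrite orbT.
  have := offset_mod3 g 0; have o j : offset g j = k j - k (j - g.1).
    by rewrite [X in X - _]e; ring.
  rewrite !o !idx => /dvdzP[q]; rewrite orbF.
  have : g.1 = 1 \/ g.1 = 1 + 1.
    by move: g0; move: (g.1); apply: ord3P; rewrite ?eqxx //; auto.
  case=> ->; rewrite !idx => eq; apply/dvdzP.
    by exists (k 0 - q); rewrite mulrBl -eq /tsum; ring.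
  exists (q + k 1); rewrite mulrDl -eq /tsum.
  by ring.
exists g.1; first exact: K3.
have [G1 Go] := GP g.1 K3; apply: deck_ext => // j.
by rewrite Go /t [X in X - _]e; ring.
Qed.

End Invariants.

(** * The minimal triangle and areas *)


Section MinimalTriangle.
Variable R : realType.
Local Notation C := (R[i]^o).
Local Notation lvl := (lvl R).
Implicit Types (v w z e : C) (i j : 'I_3) (k : 'I_3 -> int).

(** If direction [m] is missing, adding 2 to [u m] and -1 to the other coordinates stays in the set
    and exceeds the maximum of [u m]. *)
Lemma compact_hplanes (j1 j2 j3 : 'I_3) (k1 k2 k3 : int) (D : set C) :
    D = hplane j1 k1 `&` hplane j2 k2 `&` hplane j3 k3 -> compact D -> D !=set0 ->
  forall m, m \in [:: j1; j2; j3].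
Proof.
move=> DE cD D0 m; apply/negPn/negP; rewrite !inE !negb_or => /and3P[m1 m2 m3].
have [] := @compact_EVT_max _ R (fun z => u m z) D D0 cD.
  by apply: continuous_subspaceT; exact: u_continuous.
move=> c; rewrite inE => Dc cmax.
have [w wm wm1] := u_pt m (u m c + 2) (u (m + 1) c - 1).
have others j : m != j -> u j w = u j c - 1.
  have := u_sum3 m w; have := u_sum3 m c; move: j.
  by apply: (ord3_around (i := m)); rewrite ?eqxx //; lra.
have /cmax : w \in D.
  rewrite inE; move: Dc; rewrite DE /hplane /= => -[[h1 h2] h3].
  by split; [split|]; rewrite others //; lra.
by rewrite wm; lra.
Qed.

Lemma upper_triangle_tri (D : set C) X Y Z : upper_triangle D X Y Z -> exists2 k,
  tsum k = -1 & D = tri k /\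
    forall V, V \in [:: X; Y; Z] -> exists i, on_line i (k i) (k (i + 1)) 0 V.
Proof.
move=> [[g1 [g2 [g3 DE]]] [cD [p Ip]] nolift vert _].
rewrite !left_of_hplane in DE.
have D0 : D !=set0 by exists p; exact: interior_subset.
have mem := compact_hplanes DE cD D0.
have [k DT] : exists k, D = tri k.
  pose k m := if m == g1.1 then offset g1 g1.1 else
    if m == g2.1 then offset g2 g2.1 else offset g3 g3.1.
  exists k; rewrite DE; move: mem; rewrite /k.
  move: (g1.1) (g2.1) (g3.1) (offset g1 g1.1) (offset g2 g2.1) (offset g3 g3.1).
  move=> j1 j2 j3 k1 k2 k3 mem; apply/seteqP; split=> z; rewrite /hplane /tri /=.
    move=> [[h1 h2] h3] m; have := mem m; rewrite !inE.
    by case: eqVneq => [->//|_]; case: eqVneq => [->//|_] /eqP ->.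
  have : uniq [:: j1; j2; j3].
    apply: (leq_size_uniq (enum_uniq 'I_3)) => [m _|]; first exact: mem.
    by rewrite size_enum_ord.
  rewrite /= !inE negb_or andbT => /andP[/andP[n12 n13] n23] H; split; [split|].
  - by have := H j1; rewrite eqxx.
  - by have := H j2; rewrite eq_sym (negbTE n12) eqxx.
  - by have := H j3; rewrite eq_sym (negbTE n13) eq_sym (negbTE n23).
have kge : -1 <= tsum k.
  move: Ip; rewrite DT => /tri_interior lt.
  have Lpos : 0 < 3 / 4 + (tsum k)%:~R / 2 :> R.
    have := lt 0; have := lt 1; have := lt (1 + 1); have := u_sum p.
    have := lvl_sum R 0 k; rewrite add0r; lra.
  rewrite leNgt; apply/negP => klt.
  have : (tsum k)%:~R <= (- 2)%:~R :> R by rewrite ler_int; lia.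
  by rewrite rmorphN /=; lra.
have kle : tsum k <= -1.
  rewrite leNgt; apply/negP => klt; have k0 : 0 <= (tsum k)%:~R :> R by rewrite ler0z; lia.
  pose L : R := 3 / 4 + (tsum k)%:~R / 2.
  (* A point on the next lift inside, at slack 1/2 from side 0; the remaining slack [L - 1/2] is
     shared equally by the other two sides. *)
  have [w w0 w1] := u_pt 0 (lvl (k 0) - 2^-1) (lvl (k 1) - (L / 2 - 4^-1)).
  rewrite add0r in w1; have [g gj gk] := offset_surj 0 (k 0 - 1).
  have : (D° `&` Defs.lift g) w.
    split; last by apply/liftP; rewrite gj gk w0 /lvl rmorphB /=; lra.
    rewrite DT; apply/tri_interior; have := u_sum w; have := lvl_sum R 0 k.
    by rewrite add0r -/L => s1 s2; apply: ord3P; rewrite /L in s1 w1 *; lra.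
  by rewrite nolift.
have kE : tsum k = -1 by apply/le_anti; rewrite kle kge.
exists k => //; split=> // V /vert[DV /double_pointP[i [a [b [Va Vb]]]]].
have TV : tri k V by rewrite -DT.
(* The height of the triangle is 1/4 and consecutive levels are 1/2 apart, so the only lift in
   direction [j] that meets it is its side. *)
have level j (c : int) : u j V = lvl c -> c = k j.
  move=> Vc; have h1 : c%:~R <= (k j)%:~R :> R.
    by have := TV j; rewrite Vc /lvl; lra.
  have h2 : (k j)%:~R < (c + 1)%:~R :> R.
    have := TV (j + 1); have := TV (j + 1 + 1); have := u_sum3 j V.
    have := lvl_sum R j k; rewrite kE Vc /lvl intrD rmorphN /=; lra.
  by apply/le_anti; rewrite -(ler_int R) h1 /= -ltzD1 -(ltr_int R).
exists i; split; first by rewrite Va (level _ _ Va).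
by rewrite Vb (level _ _ Vb) mul0r subr0.
Qed.

(** The side of the minimal triangle has length 1/4 in [u (i + 1 + 1)], so the affine parameter on
    it is [1 - theta]. *)
Lemma side_point k i e A B (t : R) : tsum k = -1 -> 0 < t < 1 ->
    on_line i (k i) (k (i + 1)) 0 A ->
    on_line (i + 1) (k (i + 1)) (k (i + 1 + 1)) 0 B -> e = seg A B t ->
  on_line (i + 1) (k (i + 1)) (k (i + 1 + 1)) (1 - t) e.
Proof.
move=> kE /andP[t0 t1] [A0 A1] [B1 B2] ->.
rewrite mul0r subr0 in A1 B2; have sA := u_sum3 i A; have sL := lvl_sum R i k.
rewrite kE rmorphN /= in sL.
have A2 : u (i + 1 + 1) A = lvl (k (i + 1 + 1)) - 4^-1 by lra.
by split; rewrite u_seg ?A1 ?A2 ?B1 ?B2; lra.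
Qed.

(* The orbit of [e] has type [a - b]; the double points at the ends of its side have
   types [a - b] and [a - b - 1], and the opposite one [a - b + 1]. *)
Lemma upper_triangle_types (D : set C) X Y Z e :
    upper_triangle D X Y Z -> open_side X Z e ->
  exists i (a b : int) (theta : R), [/\ 0 < theta < 1, on_line i a b theta e,
    exists j c d, on_line j c d 0 Y /\ (3 %| c - d - (a - b) - 1)%Z &
    exists (s s' : int) j c d j' c' d',
      [/\ on_line j c d 0 X, on_line j' c' d' 0 Z,
          (3 %| c - d - (a - b) - s)%Z, (3 %| c' - d' - (a - b) - s')%Z &
          (s = 0 /\ s' = -1) \/ (s = -1 /\ s' = 0)]].
Proof.
move=> H [t [t01 eE]]; have [k kE [_ vert]] := upper_triangle_tri H.
have uXYZ : uniq [:: X; Y; Z] by case: H.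
have [x vx] := vert X ltac:(by rewrite !inE eqxx).
have [y vy] := vert Y ltac:(by rewrite !inE eqxx orbT).
have [z vz] := vert Z ltac:(by rewrite !inE eqxx !orbT).
have vinj i (V W : C) :
    on_line i (k i) (k (i + 1)) 0 V -> on_line i (k i) (k (i + 1)) 0 W -> V = W.
  by move=> [v0 v1] [w0 w1]; apply: (@u_ext2 _ i); rewrite ?v0 ?w0 ?v1 ?w1.
have xy : x != y.
  apply/eqP => e'; rewrite e' in vx; move: uXYZ.
  by rewrite (vinj _ _ _ vx vy) /= !inE eqxx ?orbT ?andbF.
have xz : x != z.
  apply/eqP => e'; rewrite e' in vx; move: uXYZ.
  by rewrite (vinj _ _ _ vx vz) /= !inE eqxx ?orbT ?andbF.
have yz : y != z.
  apply/eqP => e'; rewrite e' in vy; move: uXYZ.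
  by rewrite (vinj _ _ _ vy vz) /= !inE eqxx ?orbT ?andbF.
have t01' : 0 < 1 - t < 1 by move: t01 => /andP[t0 t1]; apply/andP; split; lra.
have dv i : (3 %| k (i + 1 + 1) - k i - (k (i + 1) - k (i + 1 + 1)) - 1)%Z.
  apply/dvdzP; exists (k (i + 1 + 1)); move: kE; rewrite (tsum_around i).
  by move: (k i) (k (i + 1)) (k (i + 1 + 1)) => a b c kE; lia.
have dv' i : (3 %| k i - k (i + 1) - (k (i + 1) - k (i + 1 + 1)) - (-1))%Z.
  apply/dvdzP; exists (- k (i + 1)); move: kE; rewrite (tsum_around i).
  by move: (k i) (k (i + 1)) (k (i + 1 + 1)) => a b c kE; lia.
have dv0 (a : int) : (3 %| a - a - 0)%Z by rewrite subrr subr0.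
(* The labels [X], [Y], [Z] may follow either cyclic order of the vertices. In the second case the
   side is read from [Z] to [X], which exchanges [t] and [1 - t]. *)
have [zx|xz'] : z = x + 1 \/ x = z + 1.
  by move: xz {xy yz vx vz}; move: (x) (z); do 2!apply: ord3P; rewrite ?eqxx ?ord3E ?add0r //; auto.
- have yx : y = x + 1 + 1.
    move: xy yz; rewrite zx; move: (y); apply: (ord3_around (i := x)); rewrite ?eqxx //.
  subst z y; rewrite ord3_succ3 in vy.
  exists (x + 1), (k (x + 1)), (k (x + 1 + 1)), (1 - t); split=> //.
  + exact: side_point vx vz eE.
  + by exists (x + 1 + 1), (k (x + 1 + 1)), (k x); split.
  exists (-1), 0, x, (k x), (k (x + 1)), (x + 1), (k (x + 1)), (k (x + 1 + 1)).
  by split=> //; right.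
have yx : y = z + 1 + 1.
  by move: xy yz; rewrite xz'; move: (y); apply: (ord3_around (i := z)); rewrite ?eqxx.
subst x y; rewrite ord3_succ3 in vy.
exists (z + 1), (k (z + 1)), (k (z + 1 + 1)), (1 - (1 - t)); split=> //.
- by rewrite subKr.
- apply: side_point vz vx _ => //.
  by rewrite eE; apply: complex_ext; rewrite ?Re_seg ?Im_seg; ring.
- by exists (z + 1 + 1), (k (z + 1 + 1)), (k z); split.
exists 0, (-1), (z + 1), (k (z + 1)), (k (z + 1 + 1)), z, (k z), (k (z + 1)).
by split=> //; left.
Qed.

End MinimalTriangle.

(** * Areas of triangles and of polygons *)

Section Areas.
Variable R : realType.
Local Notation C := (R[i]^o).
Local Notation lvl := (lvl R).
Local Notation mu := (@lebesgue_measure R).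

Lemma affine_integral (a b m c : R) : a < b ->
  (\int[mu]_(x in `[a, b]) ((x + m) * c)%R%:E =
     ((b + m) ^+ 2 * c / 2 - (a + m) ^+ 2 * c / 2)%:E)%E.
Proof.
move=> ab; pose F x := (x + m) ^+ 2 * c / 2.
have dF (x : R) : is_derive x 1 F ((x + m) * c).
  by rewrite /F; apply: is_derive_eq; rewrite /GRing.scale /=; field.
have cF : continuous F.
  by move=> x; apply/differentiable_continuous/derivable1_diffP; case: (dF x).
rewrite EFinB; apply: (@continuous_FTC2 R (fun x => (x + m) * c) F a b ab).
- apply: continuous_subspaceT => x.
  apply: (@cvgM _ _ (nbhs x)); last exact: cvg_cst.
  by apply: (@cvgD _ R^o _ (nbhs x)); [exact: cvg_id | exact: cvg_cst].
- split.
  + by move=> x _; case: (dF x).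
  + by apply: cvg_at_right_filter; exact: cF.
  + by apply: cvg_at_left_filter; exact: cF.
- by move=> x _; rewrite derive1E; exact: derive_val.
Qed.

(** Integration of vertical sections: the one at [x] has length [(x + m) * 2 / sqrt 3], where [- m]
    is the abscissa of the vertex opposite to side 0. *)
Lemma planar_area_tri k : -1 <= tsum k ->
  planar_area (@tri R k) = ((3 / 4 + (tsum k)%:~R / 2) ^+ 2 / Num.sqrt 3)%:E.
Proof.
move=> /(tri_size R); set L := (X in 0 < X) => L0.
rewrite /planar_area /product_measure1 /=.
have s0 := @sqrt3_gt0 R; set s := Num.sqrt 3 in s0 *.
pose m := lvl (k 1) + lvl (k (1 + 1)).
have LE : L = lvl (k 0) + m by have := lvl_sum R 0 k; rewrite add0r -/L /m => <-; ring.
transitivity (\int[mu]_(x in `[(- m)%R, (lvl (k 0))%R]) ((x + m) * (2 / s))%R%:E)%E.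
  rewrite [RHS]integral_mkcond; apply: eq_integral => x _ /=.
  rewrite patchE; set S := xsection _ _.
  have SE y : S y <-> x <= lvl (k 0) /\
      - (lvl (k (1 + 1)) + x / 2) * (2 / s) <= y <= (lvl (k 1) + x / 2) * (2 / s).
    rewrite /S xsectionP /=.
    have yE : y = (s / 2 * y) * (2 / s) by field; rewrite gt_eqF.
    have p2 : 0 < 2 / s by rewrite divr_gt0.
    rewrite [in X in _ <-> X]yE !ler_pM2r //; split=> [H|[h0 /andP[h2 h1]]].
      have := H 0; have := H 1; have := H (1 + 1); rewrite !uE /= => h2 h1 h0.
      by split=> //; apply/andP; split; rewrite /s; lra.
    by apply: ord3P; rewrite !uE /= -/s; lra.
  case: ifPn => xm.
    move: xm; rewrite inE /= in_itv /= => /andP[x1 x2].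
    have -> : S = `[- (lvl (k (1 + 1)) + x / 2) * (2 / s), (lvl (k 1) + x / 2) * (2 / s)]%classic.
      by apply/seteqP; split=> y /=; rewrite in_itv /=; [move=> /SE[] | move=> h; apply/SE].
    rewrite lebesgue_measure_itv /= lte_fin.
    have p2 : 0 < 2 / s by rewrite divr_gt0.
    rewrite ltr_pM2r //; case: ifPn => h.
      have alg (a b c y : R) : (a + y / 2) * c - - (b + y / 2) * c = (y + (a + b)) * c.
        by field.
      by rewrite -EFinB; congr EFin; exact: alg.
    rewrite -leNgt in h; have -> : x = - m by rewrite /m in x1 *; lra.
    by rewrite addNr mul0r.
  have -> : S = set0.
    apply/seteqP; split=> y //= /SE[h0 /andP[h1 h2]]; move/negP: xm; apply.
    rewrite inE /= in_itv /= h0 andbT.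
    have p2 : 0 < 2 / s by rewrite divr_gt0.
    by move: (le_trans h1 h2); rewrite ler_pM2r // /m; lra.
  by rewrite measure0.
rewrite affine_integral; last by rewrite LE in L0; lra.
by congr EFin; rewrite -?/L LE addNr; field; rewrite gt_eqF.
Qed.

(** By injectivity, the multiplicity is the indicator function of the triangle. *)
Lemma polygon_area_tri P k : polygon P -> -1 <= tsum k -> image_of P = @tri R k ->
  polygon_area P = planar_area (@tri R k).
Proof.
move=> polP k0 PT; rewrite /polygon_area.
pose T2 : set (R * R) := [set w | tri k (w.1 +i* w.2)%C].
have mT : measurable T2.
  have -> : T2 = \bigcap_(j in [set: 'I_3]) [set w | u j (w.1 +i* w.2)%C <= lvl (k j)].
    by apply/seteqP; split=> w; [move=> H j _; exact: H | move=> H j; exact: H].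
  apply: fin_bigcap_measurable => // j _.
  have mf : measurable_fun setT (fun w : R * R => u j (w.1 +i* w.2)%C).
    have m1 : measurable_fun setT (fun w : R * R => w.1) by exact: measurable_fst.
    have m2 : measurable_fun setT (fun w : R * R => w.2) by exact: measurable_snd.
    move: j; apply: ord3P.
    - by under eq_fun do rewrite u0E /=.
    - under eq_fun do rewrite u1E /=.
      by apply: measurable_funD; apply: measurable_funM => //; exact: measurableT_comp.
    under eq_fun do rewrite u2E /=.
    by apply: measurable_funB; apply: measurable_funM => //; exact: measurableT_comp.
  rewrite -[X in measurable X]setTI.
  by have := mf measurableT _ (measurable_itv `]-oo, lvl (k j)]); congr measurable;
    apply/seteqP; split=> w [_] /=; rewrite in_itv.
transitivity (\int[lebesgue_measure \x lebesgue_measure]_w (\1_T2 w)%:E)%E.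
  apply: eq_integral => w _; rewrite indicE /counting.
  case: (boolP (w \in T2)) => [|wT].
    rewrite inE /T2 /= -PT => -[p Kp fp].
    have -> : [set q | pdom P q /\ pfun P q = (w.1 +i* w.2)%C] = [set p].
      apply/seteqP; split=> q /=; last by move=> ->.
      by move=> [Kq fq]; apply: (polygon_inj polP) => //; rewrite fq.
    by rewrite asboolT // fset_set1 cardfs1.
  have -> : [set q | pdom P q /\ pfun P q = (w.1 +i* w.2)%C] = set0.
    apply/seteqP; split=> q //= -[Kq fq]; move/negP: wT; apply.
    by rewrite inE /T2 /= -PT -fq; exists q.
  by rewrite asboolT // fset_set0 cardfs0.
by rewrite integral_indic // setIT.
Qed.

End Areas.

(** * Jacobi's identity *)


Section QBinomial.
Variable A : comNzRingType.
Variable q : A.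

Definition qfact (n : nat) : A := \prod_(0 <= k < n) (1 - q ^+ k.+1).

Definition qfall (N i : nat) : A := \prod_(0 <= k < i) (1 - q ^+ (N - k)).

(** Gaussian binomial coefficient, by Pascal's rule, as the base ring has no division; [qbin_qfact]
    is the quotient formula. *)
Fixpoint qbin (N i : nat) : A :=
  match N, i with
  | _, 0%N => 1
  | 0%N, _.+1 => 0
  | N'.+1, i'.+1 => qbin N' i' + q ^+ i'.+1 * qbin N' i'.+1
  end.

Lemma qbin0 N : qbin N 0 = 1. Proof. by case: N. Qed.

Lemma qbin_small N i : (N < i)%N -> qbin N i = 0.
Proof.
elim: N i => [|N IH] [|i] //= iN; rewrite !IH ?mulr0 ?addr0 //.
exact: ltnW.
Qed.

Lemma qfactS n : qfact n.+1 = qfact n * (1 - q ^+ n.+1).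
Proof. by rewrite /qfact big_nat_recr. Qed.

Lemma qfallS N i : qfall N i.+1 = qfall N i * (1 - q ^+ (N - i)).
Proof. by rewrite /qfall big_nat_recr. Qed.

Lemma qfallSS N i : qfall N.+1 i.+1 = (1 - q ^+ N.+1) * qfall N i.
Proof. by rewrite /qfall big_nat_recl. Qed.

Lemma qbin_qfact N i : (i <= N)%N -> qbin N i * qfact i = qfall N i.
Proof.
elim: N i => [|N IH] [|i] //= iN; rewrite ?mul1r; try by rewrite /qfact /qfall !big_geq.
rewrite mulrDl qfactS qfallSS.
have e1 : qbin N i * (qfact i * (1 - q ^+ i.+1)) = qfall N i * (1 - q ^+ i.+1).
  by rewrite mulrA IH.
rewrite e1; have [iN'|iN'] := ltnP i N.
  rewrite -mulrA -qfactS IH // qfallS.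
  have -> : q ^+ N.+1 = q ^+ i.+1 * q ^+ (N - i) by rewrite -exprD; congr (_ ^+ _); lia.
  ring.
have -> : i = N by apply/eqP; rewrite eqn_leq iN' andbT.
by rewrite qbin_small // mulr0 mul0r addr0 mulrC.
Qed.

(** Splitting off the factor [k = 0] leaves the same product at [q * x]; the two resulting sums
    match Pascal's rule. *)
Lemma q_binomial (x y : A) (N : nat) :
  \prod_(0 <= k < N) (y + q ^+ k * x) =
    \sum_(0 <= i < N.+1) q ^+ 'C(i, 2) * qbin N i * x ^+ i * y ^+ (N - i).
Proof.
elim: N x => [|N IH] x; first by rewrite big_geq // big_nat1 /= !mul1r.
rewrite big_nat_recl // expr0 mul1r.
have -> : \prod_(0 <= k < N) (y + q ^+ k.+1 * x) =
    \prod_(0 <= k < N) (y + q ^+ k * (q * x)).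
  by apply: eq_bigr => k _; rewrite exprSr mulrA.
rewrite IH mulrDl big_distrr /= big_distrr /=.
rewrite [in RHS]big_nat_recl // [X in X + _ = _]big_nat_recl //.
rewrite !qbin0 !subn0 !expr0 !mulr1 !mul1r -addrA; congr (_ + _).
  by rewrite -exprS.
have -> : \sum_(0 <= i < N.+1) q ^+ 'C(i.+1, 2) * qbin N.+1 i.+1 * x ^+ i.+1 *
      y ^+ (N.+1 - i.+1) =
    \sum_(0 <= i < N.+1) (q ^+ 'C(i.+1, 2) * qbin N i * x ^+ i.+1 * y ^+ (N - i)) +
    \sum_(0 <= i < N.+1) (q ^+ 'C(i.+1, 2) * (q ^+ i.+1 * qbin N i.+1) * x ^+ i.+1 *
      y ^+ (N - i)).
  by rewrite -big_split /=; apply: eq_bigr => i _; rewrite subSS; ring.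
rewrite addrC; congr (_ + _).
  apply: eq_bigr => i _; rewrite binS bin1 exprD exprMn exprS; ring.
rewrite [in RHS]big_nat_recr //= qbin_small // !(mulr0, mul0r) addr0.
apply: eq_big_nat => i /= iN; rewrite exprMn.
have -> : (N - i = (N - i.+1).+1)%N by lia.
by rewrite [y ^+ _.+1]exprS; ring.
Qed.

End QBinomial.

Arguments qbin : simpl never.

Section RmorphQ.
Variables (A B : comNzRingType) (f : {rmorphism A -> B}) (q : A).

Lemma rmorph_qbin N i : f (qbin q N i) = qbin (f q) N i.
Proof.
elim: N i => [|N IH] [|i]; rewrite /qbin ?rmorph1 ?rmorph0 // -/qbin.
by rewrite rmorphD rmorphM rmorphXn !IH.
Qed.

End RmorphQ.

(** * A finite form of Jacobi's identity *)

Section JacobiFinite.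
Local Notation P := {poly int}.
Local Notation q := ('X : P).
Local Notation fact := (qfact q).
Local Notation fall := (qfall q).
Local Notation bin := (qbin q).

Lemma qfact_neq0 n : fact n != 0.
Proof.
rewrite prodf_seq_neq0; apply/allP => k _ /=; apply/eqP => /(congr1 (fun p : P => p`_0)).
by rewrite coefB coef1 coefXn coef0.
Qed.

Lemma qfall_qfact N i : (i <= N)%N -> fall N i * fact (N - i) = fact N.
Proof.
elim: i => [|i IH] iN; first by rewrite /qfall big_geq // mul1r subn0.
rewrite -IH; last exact: ltnW.
have -> : (N - i = (N - i.+1).+1)%N by lia.
rewrite qfactS qfallS; have -> : (N - i = (N - i.+1).+1)%N by lia.
ring.
Qed.

Lemma qbin_sym N i : (i <= N)%N -> bin N (N - i) = bin N i.
Proof.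
move=> iN; apply: (mulIf (qfact_neq0 i)); apply: (mulIf (qfact_neq0 (N - i))).
rewrite mulrAC qbin_qfact ?leq_subr // qbin_qfact // qfall_qfact //.
by rewrite -{2}(subKn iN) qfall_qfact // leq_subr.
Qed.

Lemma deriv_vanish (A : comNzRingType) (W : {poly A}) :
  ((1 - 'X) * W)^`().[1] = - W.[1].
Proof.
rewrite derivM derivB derivX -polyC1 derivC sub0r hornerD hornerM.
by rewrite !hornerE; ring.
Qed.

(* The q-binomial theorem at y = q^n, x = -z, N = 2n + 1, differentiated at z = 1,
   where the factor k = n vanishes. *)
Lemma q_binomial_derivative (n : nat) :
  \sum_(0 <= i < n.*2.+2) (-1) ^+ i * q ^+ ('C(i, 2) + n * (n.*2.+1 - i))
      * bin n.*2.+1 i * i%:R =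
    - (q ^+ n * \prod_(0 <= k < n) (q ^+ n - q ^+ k) *
      \prod_(n.+1 <= k < n.*2.+1) (q ^+ n - q ^+ k)).
Proof.
have := q_binomial q%:P (- 'X) (q%:P ^+ n) n.*2.+1.
move=> /(congr1 (fun p : {poly P} => (p^`()).[1])).
rewrite (@big_cat_nat _ _ _ n) /=; [|by []|by rewrite -addnn; lia].
rewrite [X in _ * X](@big_ltn _ _ _ n); last by rewrite -addnn; lia.
set U := \prod_(0 <= k < n) _; set V := \prod_(n.+1 <= k < _) _.
have -> : U * ((q%:P ^+ n + q%:P ^+ n * - 'X) * V) = (1 - 'X) * ((q ^+ n)%:P * U * V).
  by rewrite -polyC_exp; ring.
rewrite deriv_vanish !hornerM hornerC.
have -> : U.[1] = \prod_(0 <= k < n) (q ^+ n - q ^+ k).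
  rewrite /U horner_prod; apply: eq_bigr => k _.
  by rewrite -!polyC_exp !hornerE mulrN1.
have -> : V.[1] = \prod_(n.+1 <= k < n.*2.+1) (q ^+ n - q ^+ k).
  rewrite /V horner_prod; apply: eq_bigr => k _.
  by rewrite -!polyC_exp !hornerE mulrN1.
move=> ->; rewrite raddf_sum horner_sum; apply: eq_bigr => i _.
have binC : qbin q%:P n.*2.+1 i = (bin n.*2.+1 i)%:P :> {poly P}.
  by rewrite -(rmorph_qbin (polyC : {rmorphism P -> {poly P}})).
pose c := (-1) ^+ i * q ^+ ('C(i, 2) + n * (n.*2.+1 - i)) * bin n.*2.+1 i.
transitivity (((c *: 'X^i)^`()).[1]).
  by rewrite derivZ derivXn hornerZ hornerMn hornerXn expr1n.
congr (_ .[1]); congr (_^`()); rewrite /c binC (exprNn 'X) -mul_polyC !polyCM exprD exprM.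
by rewrite polyCM !polyC_exp polyCN; ring.
Qed.

(** Each factor is [- q^k (1 - q^(n-k))]. *)
Lemma prod_below n : \prod_(0 <= k < n) (q ^+ n - q ^+ k) =
  (-1) ^+ n * q ^+ 'C(n, 2) * fact n.
Proof.
have H : forall m, (m <= n)%N -> \prod_(0 <= k < m) (q ^+ n - q ^+ k) =
    (-1) ^+ m * q ^+ 'C(m, 2) * \prod_(0 <= k < m) (1 - q ^+ (n - k)).
  elim=> [_|m IH mn]; first by rewrite !big_geq // !mulr1.
  rewrite !big_nat_recr //= IH ?(ltnW mn) // binS bin1 exprD.
  have -> : q ^+ n = q ^+ m * q ^+ (n - m) by rewrite -exprD subnKC // ltnW.
  by rewrite [(-1) ^+ m.+1]exprS; ring.
rewrite H //; congr (_ * _).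
by have := qfall_qfact (leqnn n); rewrite subnn /qfact [\prod_(0 <= k < 0) _]big_geq // mulr1.
Qed.

Lemma prod_above n : \prod_(n.+1 <= k < n.*2.+1) (q ^+ n - q ^+ k) = q ^+ (n * n) * fact n.
Proof.
rewrite -{1}[n.+1]add0n big_addn (_ : n.*2.+1 - n.+1 = n)%N; last by rewrite -addnn; lia.
have -> : q ^+ (n * n) = \prod_(0 <= k < n) q ^+ n by rewrite prodr_const_nat subn0 exprM.
rewrite -big_split /=; apply: eq_bigr => k _.
by rewrite mulrBr mulr1 -exprD; congr (_ - _ ^+ _); lia.
Qed.

(** In [q_binomial_derivative] the indices [n - j] and [n + 1 + j] carry the same Gaussian binomial,
    the same power of [q] and opposite signs; their factors combine to
    [(n + 1 + j) - (n - j) = 2j + 1]. *)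
Lemma jacobi_finite n :
  \sum_(0 <= j < n.+1) (-1) ^+ j * (j.*2.+1)%:R * q ^+ 'C(j.+1, 2) *
    bin n.*2.+1 (n - j) = fact n ^+ 2.
Proof.
(* The part of the exponent of [q] common to both sides, to be cancelled in a domain. *)
pose E := (n + 'C(n, 2) + n * n)%N.
have E0 : (-1) ^+ n.+1 * q ^+ E != 0 :> P.
  by rewrite mulf_neq0 ?signr_eq0 // expf_neq0 // polyX_eq0.
apply: (mulfI E0).
transitivity (- (q ^+ n * \prod_(0 <= k < n) (q ^+ n - q ^+ k) *
      \prod_(n.+1 <= k < n.*2.+1) (q ^+ n - q ^+ k))); last first.
  by rewrite prod_below prod_above /E !exprD [(-1) ^+ n.+1]exprS; ring.
rewrite -q_binomial_derivative [RHS](@big_cat_nat _ _ _ n.+1) /=; [|by []|lia].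
rewrite [X in _ = X + _]big_nat_rev /= -[X in \sum_(X <= _ < n.*2.+2) _]add0n.
rewrite [X in _ = _ + X]big_addn (_ : n.*2.+2 - n.+1 = n.+1)%N; last lia.
rewrite -big_split /= big_distrr /=; apply: eq_big_nat => j /= jn.
rewrite add0n subSS.
have jn' : (j <= n)%N by lia.
have sym : bin n.*2.+1 (j + n.+1) = bin n.*2.+1 (n - j).
  rewrite -(@qbin_sym n.*2.+1 (n - j)); last by rewrite -addnn; lia.
  by congr bin; rewrite -addnn; lia.
rewrite sym.
have b2 k : (2 * 'C(k, 2) + k = k * k)%N.
  case: k => [//|k]; have := mul_bin_diag k.+1 1; rewrite bin1 => <-.
  by rewrite mulnS addnC.
have [m nE] : exists m, n = (m + j)%N by exists (n - j)%N; lia.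
have e1 : ('C(n - j, 2) + n * (n.*2.+1 - (n - j)) = E + 'C(j.+1, 2))%N.
  have := b2 m; have := b2 (m + j)%N; have := b2 j.+1; rewrite /E nE addnK.
  have -> : ((m + j).*2.+1 - m = m + j + j.+1)%N by rewrite -addnn; lia.
  by move: 'C(m, 2) 'C(m + j, 2) 'C(j.+1, 2) => c1 c2 c3; clear; nia.
have e2 : ('C(j + n.+1, 2) + n * (n.*2.+1 - (j + n.+1)) = E + 'C(j.+1, 2))%N.
  have := b2 (j + n.+1)%N; have := b2 n; have := b2 j.+1; rewrite /E nE.
  have -> : ((m + j).*2.+1 - (j + (m + j).+1) = m)%N by rewrite -addnn; lia.
  by move: 'C(j + (m + j).+1, 2) 'C(m + j, 2) 'C(j.+1, 2) => c1 c2 c3; clear; nia.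
rewrite e1 e2 exprD [(-1) ^+ (j + n.+1)]exprD.
have -> : (-1) ^+ (n - j) = - (-1) ^+ (n.+1) * (-1) ^+ j :> P.
  rewrite exprS mulN1r opprK -exprD -signr_odd -[RHS]signr_odd oddD oddB //.
have -> : (j + n.+1)%:R = n%:R + j%:R + 1 :> P by rewrite natrD -natr1; ring.
rewrite natrB //.
have -> : j.*2.+1%:R = j%:R + j%:R + 1 :> P by rewrite -natr1 -addnn natrD.
by ring.
Qed.

End JacobiFinite.

(** * Jacobi's identity, coefficient by coefficient *)

Section JacobiCoefficients.
Local Notation P := {poly int}.
Local Notation q := ('X : P).
Local Notation fact := (qfact q).
Local Notation fall := (qfall q).
Local Notation bin := (qbin q).

Definition congr_mod (m : nat) (a b : P) := exists h : P, a = b + q ^+ m * h.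

Lemma congr_modM m a b c d : congr_mod m a b -> congr_mod m c d ->
  congr_mod m (a * c) (b * d).
Proof. by move=> [h ->] [k ->]; exists (h * d + b * k + q ^+ m * h * k); ring. Qed.

Lemma congr_mod_prod (m n : nat) (F : nat -> P) (s : nat) :
  (forall k, (s <= k < n)%N -> congr_mod m (F k) 1) ->
  congr_mod m (\prod_(s <= k < n) F k) 1.
Proof.
move=> H; rewrite big_seq_cond; apply: (big_ind (fun a => congr_mod m a 1)).
- by exists 0; ring.
- by move=> a b Ha Hb; rewrite -[X in congr_mod _ _ X](mul1r 1); exact: congr_modM.
- by move=> k; rewrite mem_index_iota andbT; exact: H.
Qed.

Lemma congr_mod_factor (m k : nat) : (m <= k)%N -> congr_mod m (1 - q ^+ k) 1.
Proof.
move=> mk; exists (- q ^+ (k - m)); rewrite mulrN -exprD subnKC //.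
Qed.

Lemma congr_mod_coef m a b i : congr_mod m a b -> (i < m)%N -> a`_i = b`_i.
Proof. by move=> [h ->] im; rewrite coefD coefXnM im addr0. Qed.

Lemma fact_coef m n : (m <= n)%N -> (fact n)`_m = (fact m)`_m.
Proof.
move=> mn; apply: (@congr_mod_coef m.+1) => //.
rewrite /qfact (@big_cat_nat _ _ _ m 0 n) //=.
rewrite -[X in congr_mod _ _ X]mulr1; apply: congr_modM; first by exists 0; ring.
by apply: congr_mod_prod => k /andP[mk _]; exact: congr_mod_factor.
Qed.

(** Multiplied by one more [fact n], each Gaussian binomial of [jacobi_finite] becomes 1 modulo
    [q ^+ (n - j).+1]. *)
Lemma jacobi_congr n : congr_mod n.+1 (fact n ^+ 3)
  (\sum_(0 <= j < n.+1) (-1) ^+ j * (j.*2.+1)%:R * q ^+ 'C(j.+1, 2)).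
Proof.
rewrite exprS -jacobi_finite big_distrr /= big_seq_cond [X in congr_mod _ _ X]big_seq_cond.
apply: (big_ind2 (congr_mod n.+1)).
- by exists 0; ring.
- by move=> a b c d [h ->] [k ->]; exists (h + k); ring.
move=> j; rewrite mem_index_iota andbT => /= jn.
have jn' : (j <= n)%N by lia.
have [h hE] : congr_mod (n - j).+1 (fact n * bin n.*2.+1 (n - j)) 1.
  have -> : fact n = fact (n - j) * \prod_(n - j <= k < n) (1 - q ^+ k.+1).
    by rewrite {1}/qfact (@big_cat_nat _ _ _ (n - j)) ?leq_subr.
  rewrite mulrAC [fact _ * _]mulrC qbin_qfact; last by rewrite -addnn; lia.
  rewrite -[X in congr_mod _ _ X](mul1r 1); apply: congr_modM.
    apply: congr_mod_prod => k /andP[_ kn]; apply: congr_mod_factor.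
    by rewrite -addnn; lia.
  by apply: congr_mod_prod => k /andP[kn _]; exact: congr_mod_factor.
(* The power of [q] in front of the binomial raises the order of the error to at least [n + 1],
   because [j <= 'C(j.+1, 2)]. *)
have [d dE] : exists d, ('C(j.+1, 2) + (n - j).+1 = n.+1 + d)%N.
  have : (j <= 'C(j.+1, 2))%N by rewrite binS bin1 leq_addl.
  by exists ('C(j.+1, 2) - j)%N; lia.
exists ((-1) ^+ j * (j.*2.+1)%:R * q ^+ d * h).
rewrite mulrCA hE mulrDr mulr1; congr (_ + _).
have -> : q ^+ n.+1 * ((-1) ^+ j * (j.*2.+1)%:R * q ^+ d * h) =
  (-1) ^+ j * (j.*2.+1)%:R * (q ^+ n.+1 * q ^+ d) * h by ring.
by rewrite -exprD -dE exprD; ring.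
Qed.

Definition jacobi_coef (m : nat) : int :=
  \sum_(0 <= j < m.+1) (-1) ^+ j * (j.*2.+1)%:R * (m == 'C(j.+1, 2))%:R.

Lemma jacobi_coefE m : (fact m ^+ 3)`_m = jacobi_coef m.
Proof.
rewrite (congr_mod_coef (jacobi_congr m)) // coef_sum; apply: eq_bigr => j _.
have -> : (-1) ^+ j * j.*2.+1%:R * q ^+ 'C(j.+1, 2) =
    ((-1) ^+ j * j.*2.+1%:R)%:P * q ^+ 'C(j.+1, 2) :> P.
  by rewrite polyCM polyC_exp polyCN polyC1 polyC_natr.
by rewrite coefCM coefXn.
Qed.

Lemma bin2_inj i j : 'C(i.+1, 2) = 'C(j.+1, 2) -> i = j.
Proof.
have mono a b : (a < b)%N -> ('C(a.+1, 2) < 'C(b.+1, 2))%N.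
  elim: b => // b IH; rewrite ltnS leq_eqVlt => /orP[/eqP->|/IH h].
    by rewrite [X in (_ < X)%N]binS bin1 -addn1 leq_add2l.
  by apply: ltn_trans h _; rewrite [X in (_ < X)%N]binS bin1 -addn1 leq_add2l.
by case: (ltngtP i j) => // /mono h e; rewrite e ltnn in h.
Qed.

Lemma jacobi_coef_tri j : jacobi_coef 'C(j.+1, 2) = (-1) ^+ j * (j.*2.+1)%:R.
Proof.
have jm : (j < 'C(j.+1, 2).+1)%N by rewrite ltnS binS bin1 leq_addl.
rewrite /jacobi_coef big_mkord (bigD1 (Ordinal jm)) //= eqxx mulr1.
rewrite big1 ?addr0 // => i ij; case: eqP => [/bin2_inj e|_]; last by rewrite mulr0.
by case/eqP: ij; apply/val_inj.
Qed.

Lemma jacobi_coef_nontri m : (forall j, m != 'C(j.+1, 2)) -> jacobi_coef m = 0.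
Proof.
by move=> H; rewrite /jacobi_coef big1 // => j _; rewrite (negbTE (H j)) mulr0.
Qed.

End JacobiCoefficients.

(** * Power series in [T^alpha] inside the Novikov ring *)

Section NovikovPowerSeries.
Variable R : realType.
Local Notation Lambda := (novikov R).
Implicit Types (a b : nat -> R[i]) (alpha x y c : R).

Lemma nov_TD (x y : R) : nov_T x * nov_T y = nov_T (x + y) :> Lambda.
Proof.
apply: novikovP; apply/funext => z /=.
rewrite (@nov_convE R [set x]) //=; last first.
  by move=> w; rewrite /nov_T_fun; case: (w =P x) => [->|_]//; rewrite eqxx.
rewrite fsbig_set1 /= /nov_T_fun eqxx mul1r.
by rewrite subr_eq [y + x]addrC.
Qed.

Lemma nov_TX (x : R) n : nov_T x ^+ n = nov_T (n%:R * x) :> Lambda.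
Proof.
elim: n => [|n IH]; first by rewrite mul0r.
by rewrite exprS IH nov_TD -natr1 mulrDl mul1r addrC.
Qed.

Lemma nov_mulT (f : Lambda) (x z : R) : (nov_T x * f) z = f (z - x).
Proof.
rewrite /GRing.mul /= (@nov_convE R [set x]) //=; last first.
  by move=> w; rewrite /nov_T_fun; case: (w =P x) => [->|_]//; rewrite eqxx.
by rewrite fsbig_set1 /= /nov_T_fun eqxx mul1r.
Qed.

(** The truncation recovers the only candidate [n] for [x = n * alpha]. *)
Definition series_fun alpha a x : R[i] :=
  let n := Num.trunc (x / alpha) in if x == n%:R * alpha then a n else 0.

Lemma series_fun_finite alpha a c : 0 < alpha ->
  finite_set [set x | x <= c /\ series_fun alpha a x != 0].
Proof.
move=> a0; apply: (@sub_finite_set _ _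
    ((fun n : nat => n%:R * alpha) @` `I_(Num.trunc (c / alpha)).+1)).
  move=> x [xc]; rewrite /series_fun; case: (x =P _) => [xE _|_]; last by rewrite eqxx.
  exists (Num.trunc (x / alpha)) => //=; rewrite ltnS.
  by apply: le_truncn; rewrite ler_pM2r ?invr_gt0.
by apply: finite_image; exact: finite_II.
Qed.

Definition nov_series alpha (a0 : 0 < alpha) a : Lambda :=
  Novikov (fun c => series_fun_finite a c a0).

Variable alpha : R.
Hypothesis alpha_gt0 : 0 < alpha.
Local Notation S := (nov_series alpha_gt0).

Lemma nov_seriesE a n : S a (n%:R * alpha) = a n.
Proof.
by rewrite /= /series_fun mulfK ?(lt0r_neq0 alpha_gt0) // natrK eqxx.
Qed.

Lemma nov_series_out a x : (forall n : nat, x != n%:R * alpha) -> S a x = 0.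
Proof. by move=> H; rewrite /= /series_fun ifN. Qed.

Lemma nov_series_ext (f : Lambda) a : (forall n, f (n%:R * alpha) = a n) ->
  (forall x, (forall n : nat, x != n%:R * alpha) -> f x = 0) -> f = S a.
Proof.
move=> H1 H2; apply: novikovP; apply/funext => x.
have [[n ->]|nE] := pselect (exists n : nat, x = n%:R * alpha).
  by rewrite H1 nov_seriesE.
have H n : x != n%:R * alpha by apply/eqP => e; apply: nE; exists n.
by rewrite H2 // nov_series_out.
Qed.

Lemma nov_seriesM a b :
  S a * S b = S (fun n => \sum_(i < n.+1) a i * b (n - i)%N).
Proof.
have supp (d : nat -> R[i]) x : S d x != 0 -> exists n : nat, x = n%:R * alpha.
  move=> /eqP dx; apply: contrapT => H; apply: dx; apply: nov_series_out => n.
  by apply/eqP => e; apply: H; exists n.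
have inj : injective (fun n : nat => n%:R * alpha).
  move=> m n; rewrite /= => /(mulIf (lt0r_neq0 alpha_gt0)) /eqP.
  by rewrite eqr_nat => /eqP.
apply: nov_series_ext => [n|x xn].
  rewrite /GRing.mul /= (@nov_convE R [set n%:R * alpha | n in `I_n.+1]) /=.
  - rewrite fsbig_image; last by move=> i j _ _; exact: inj.
    rewrite -fsbig_ord; apply: eq_bigr => i _.
    have iN : (i <= n)%N by rewrite -ltnS.
    rewrite -mulrBl -natrB //.
    by rewrite -[series_fun _ a _]/(S a _) -[series_fun _ b _]/(S b _) !nov_seriesE.
  - by apply: finite_image; exact: finite_II.
  move=> y /(supp a)[i ->] /(supp b)[j e]; exists i => //=.
  have : i%:R + j%:R = n%:R :> R.
    by apply: (mulIf (lt0r_neq0 alpha_gt0)); rewrite mulrDl -e addrC subrK.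
  by rewrite -natrD => /eqP; rewrite eqr_nat => /eqP <-; rewrite ltnS leq_addr.
rewrite /GRing.mul /=; rewrite /nov_conv; apply: fsbig1 => y _; apply/eqP.
rewrite mulf_eq0; apply/negPn/negP; rewrite negb_or => /andP[/(supp a)[i iE] /(supp b)[j jE]].
have := xn (i + j)%N; rewrite natrD mulrDl -iE -jE addrC subrK eqxx //.
Qed.

Definition poly_series (p : {poly R[i]}) : Lambda := S (fun i => p`_i).

Lemma poly_seriesM p r : poly_series (p * r) = poly_series p * poly_series r.
Proof.
rewrite /poly_series nov_seriesM; congr nov_series; apply/funext => n.
exact: coefM.
Qed.

Lemma poly_series_factor k : poly_series (1 - 'X^k) = 1 - nov_T alpha ^+ k.
Proof.
rewrite nov_TX /poly_series; apply/esym/nov_series_ext => [n|x xn].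
  rewrite coefB coef1 coefXn /GRing.opp /GRing.add /GRing.one /= /nov_T_fun.
  rewrite mulf_eq0 (gt_eqF alpha_gt0) orbF pnatr_eq0.
  have -> : (n%:R * alpha == k%:R * alpha) = (n == k).
    by rewrite (inj_eq (mulIf (lt0r_neq0 alpha_gt0))) eqr_nat.
  by case: (n == 0)%N; case: (n == k).
rewrite /GRing.opp /GRing.add /GRing.one /= /nov_T_fun.
have := xn 0%N; rewrite mul0r => /negbTE ->; rewrite (negbTE (xn k)).
by rewrite oppr0 addr0.
Qed.

Lemma poly_series1 : poly_series 1 = 1.
Proof.
rewrite /poly_series; apply/esym/nov_series_ext => [n|x xn]; rewrite /GRing.one /= /nov_T_fun.
  by rewrite coef1 mulf_eq0 (gt_eqF alpha_gt0) orbF pnatr_eq0; case: (n == 0)%N.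
by have := xn 0%N; rewrite mul0r => /negbTE ->.
Qed.

Lemma nov_cvg_unique (v : nat -> Lambda) l l' : nov_cvg v l -> nov_cvg v l' -> l = l'.
Proof.
move=> H H'; apply: novikovP; apply/funext => x.
have [n [h h']] : exists n, v n x = l x /\ v n x = l' x.
  have [N _ HN] := H x; have [N' _ HN'] := H' x.
  by exists (maxn N N'); split; [apply: HN|apply: HN'] => //=; rewrite ?leq_maxl ?leq_maxr.
by rewrite -h -h'.
Qed.

Lemma nov_lim_eq (v : nat -> Lambda) l : nov_cvg v l -> nov_lim v = l.
Proof.
move=> H; rewrite /nov_lim; case: xgetP => [l' _ H'|/(_ l)//].
exact: nov_cvg_unique H' H.
Qed.

Definition euler_coef n : R[i] := ((qfact ('X : {poly int}) n)`_n)%:~R.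

Lemma euler_prodE : euler_prod (nov_T alpha) = S euler_coef.
Proof.
(* Beyond this index, the factors still to come only affect exponents above [c]. *)
apply: nov_lim_eq => c; exists (Num.trunc (c / alpha)) => // n cn x xc; rewrite /= in cn.
have -> : \prod_(1 <= k < n.+1) (1 - nov_T alpha ^+ k) =
    poly_series (map_poly intr (qfact 'X n)).
  elim: n {cn} => [|n IH].
    by rewrite big_geq // /qfact big_geq // rmorph1 poly_series1.
  rewrite big_nat_recr //= IH qfactS rmorphM poly_seriesM; congr (_ * _).
  by rewrite rmorphB rmorph1 rmorphXn /= map_polyX poly_series_factor.
have [[m mE]|nE] := pselect (exists m : nat, x = m%:R * alpha); last first.
  have H m : x != m%:R * alpha by apply/eqP => e; apply: nE; exists m.
  by rewrite /poly_series (nov_series_out _ H) (nov_series_out _ H).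
have mn : (m <= n)%N.
  apply: leq_trans cn; rewrite -[m](@natrK R) -[m%:R](mulfK (lt0r_neq0 alpha_gt0)).
  by apply: le_truncn; rewrite -mE ler_pM2r ?invr_gt0.
by rewrite mE /poly_series !nov_seriesE coef_map /= /euler_coef (fact_coef mn).
Qed.

Lemma euler_cube : euler_prod (nov_T alpha) ^+ 3 = S (fun n => (jacobi_coef n)%:~R).
Proof.
rewrite euler_prodE exprS expr2 !nov_seriesM; congr nov_series; apply/funext => n.
rewrite -jacobi_coefE exprS coefM rmorph_sum /=; apply: eq_bigr => i _.
have iN : (i <= n)%N by rewrite -ltnS.
rewrite rmorphM /= fact_coef // expr2 coefM rmorph_sum /=; congr (_ * _).
apply: eq_bigr => j _; have jN : (j <= n - i)%N by rewrite -ltnS.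
by rewrite rmorphM /= !fact_coef //; lia.
Qed.

(** The whole prefix is returned, since each new coefficient of the inverse series depends on all
    earlier ones. *)
Fixpoint inverse_coefs a n : seq R[i] :=
  if n is n'.+1 then
    let s := inverse_coefs a n' in
    rcons s (- \sum_(i < n) a (n - i)%N * nth 0 s i)
  else [:: 1].

Lemma size_inverse_coefs a n : size (inverse_coefs a n) = n.+1.
Proof. by elim: n => //= n IH; rewrite size_rcons IH. Qed.

Lemma nth_inverse_coefs a n m : (m <= n)%N ->
  nth 0 (inverse_coefs a n) m = nth 0 (inverse_coefs a m) m.
Proof.
elim: n => [|n IH]; first by rewrite leqn0 => /eqP ->.
rewrite leq_eqVlt => /orP[/eqP ->//|mn].
by rewrite /= nth_rcons size_inverse_coefs mn IH.
Qed.

Lemma nov_series_unit a : a 0%N = 1 -> S a \is a GRing.unit.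
Proof.
move=> a0; pose b n := nth 0 (inverse_coefs a n) n.
suff e : S b * S a = 1 by apply/(@nov_unitPl R (S a) (S b)).
rewrite nov_seriesM -poly_series1 /poly_series; congr nov_series; apply/funext => n.
rewrite coef1; case: n => [|n]; first by rewrite big_ord1 /b /= a0 mulr1.
rewrite big_ord_recr /= subnn a0 mulr1 {2}/b /= nth_rcons size_inverse_coefs ltnn eqxx.
apply/eqP; rewrite subr_eq0; apply/eqP; apply: eq_bigr => i _.
by rewrite mulrC /b nth_inverse_coefs // -ltnS.
Qed.

Lemma euler_prod_unit : euler_prod (nov_T alpha) \is a GRing.unit.
Proof.
rewrite euler_prodE; apply: nov_series_unit.
by rewrite /euler_coef /qfact big_geq // coef1.
Qed.

End NovikovPowerSeries.

(** * The superpotential *)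


Section SuperpotentialCoefficients.
Variable R : realType.
Local Notation Lambda := (novikov R).
Local Notation Lxyz := (mpoly 3 Lambda).
Local Notation X_ m := (mpolyX Lambda m).
Local Notation var i := (mpolyX Lambda (mnm1 (i : 'I_3))).
Variable A : R.
Hypothesis A_gt0 : 0 < A.
Local Notation qa := (nov_T A : Lambda).
Local Notation q := (qa ^+ 8).

Lemma q_exp : q = nov_T (8 * A).
Proof. by rewrite nov_TX. Qed.

Lemma q9_exp : q ^+ 9 = nov_T (72 * A).
Proof. by rewrite -exprM nov_TX. Qed.

Lemma A8_gt0 : 0 < 8 * A. Proof. by rewrite mulr_gt0. Qed.
Lemma A72_gt0 : 0 < 72 * A. Proof. by rewrite mulr_gt0. Qed.

Lemma nov_T_unit (x : R) : (nov_T x : Lambda) \is a GRing.unit.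
Proof. by apply/(@nov_unitPl R _ (nov_T (- x))); rewrite nov_TD addNr. Qed.

(** By Jacobi's identity, the sum of [(-1)^j (2j+1) T^((2j+1)^2 A)]: the factor [qa] completes
    [8 j(j+1)/2] to an odd square. In [eta9] all exponents are multiplied by 9. *)
Definition eta1 : Lambda := qa * euler_prod q ^+ 3.

Definition eta9 : Lambda := qa ^+ 9 * euler_prod (q ^+ 9) ^+ 3.

Definition phi : Lambda := - eta9.

Definition psi : Lambda := - (eta1 + 3%:R * eta9).

Lemma tri_num j : (8 * 'C(j.+1, 2) + 1 = j.*2.+1 ^ 2)%N.
Proof.
have := mul_bin_diag j.+1 1; rewrite bin1 /= => e.
by rewrite -addnn -mulnn; move: e; move: 'C(j.+1, 2) => c; nia.
Qed.

Lemma tri_numR j : 1 + 8 * ('C(j.+1, 2))%:R = (j.*2.+1)%:R ^+ 2 :> R.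
Proof. by rewrite -natrX -tri_num natrD natrM addrC. Qed.

Lemma odd_sqr_inj (m n : nat) : m%:R ^+ 2 * A = n%:R ^+ 2 * A -> m = n.
Proof.
move=> /(mulIf (lt0r_neq0 A_gt0)) /eqP; rewrite -!natrX eqr_nat.
by rewrite eqn_sqr => /eqP.
Qed.

Lemma euler1_coef j :
  eta1 ((j.*2.+1)%:R ^+ 2 * A) = ((-1) ^+ j * (j.*2.+1)%:R)%:~R.
Proof.
rewrite /eta1 nov_mulT q_exp (euler_cube A8_gt0) -tri_numR.
rewrite (_ : _ - A = ('C(j.+1, 2))%:R * (8 * A)); last by ring.
by rewrite nov_seriesE jacobi_coef_tri.
Qed.

Lemma euler1_out (x : R) : (forall j : nat, x != (j.*2.+1)%:R ^+ 2 * A) ->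
  eta1 x = 0.
Proof.
move=> H; rewrite /eta1 nov_mulT q_exp (euler_cube A8_gt0).
have [[n xn]|nn] := pselect (exists n : nat, x - A = n%:R * (8 * A)); last first.
  by rewrite nov_series_out // => n; apply/eqP => e; apply: nn; exists n.
rewrite xn nov_seriesE jacobi_coef_nontri // => j; apply/eqP => nj.
have /eqP[] := H j; rewrite -tri_numR -nj.
by rewrite -[LHS](subrK A) xn; ring.
Qed.

Lemma euler9_coef j :
  eta9 ((3 * j.*2.+1)%:R ^+ 2 * A) =
    ((-1) ^+ j * (j.*2.+1)%:R)%:~R.
Proof.
rewrite /eta9 nov_TX nov_mulT q9_exp (euler_cube A72_gt0) natrM exprMn -tri_numR.
rewrite (_ : _ - 9 * A = ('C(j.+1, 2))%:R * (72 * A)); last by ring.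
by rewrite nov_seriesE jacobi_coef_tri.
Qed.

Lemma euler9_out (x : R) : (forall j : nat, x != (3 * j.*2.+1)%:R ^+ 2 * A) ->
  eta9 x = 0.
Proof.
move=> H; rewrite /eta9 nov_TX nov_mulT q9_exp (euler_cube A72_gt0).
have [[n xn]|nn] := pselect (exists n : nat, x - 9 * A = n%:R * (72 * A)); last first.
  by rewrite nov_series_out // => n; apply/eqP => e; apply: nn; exists n.
rewrite xn nov_seriesE jacobi_coef_nontri // => j; apply/eqP => nj.
have /eqP[] := H j; rewrite natrM exprMn -tri_numR -nj.
by rewrite -[LHS](subrK (9 * A)) xn; ring.
Qed.

Lemma phi_coef j : phi ((3 * j.*2.+1)%:R ^+ 2 * A) = ((-1) ^+ j.+1 * (j.*2.+1)%:R)%:~R.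
Proof. by rewrite -[LHS]/(- eta9 _) (euler9_coef j) -rmorphN exprS mulN1r mulNr. Qed.

Lemma phi_out (x : R) : (forall j : nat, x != (3 * j.*2.+1)%:R ^+ 2 * A) -> phi x = 0.
Proof. by move=> H; rewrite -[LHS]/(- eta9 x) (euler9_out H) oppr0. Qed.

Lemma natr_mulE n (f : Lambda) (x : R) : (n%:R * f) x = n%:R * f x.
Proof.
elim: n => [|n IH]; first by rewrite !mul0r.
by rewrite -!natr1 !mulrDl !mul1r -IH.
Qed.

Lemma psiE (x : R) a b : eta1 x = a -> eta9 x = b -> psi x = - (a + 3%:R * b).
Proof. by move=> <- <-; rewrite -natr_mulE. Qed.

Lemma psi_coef n : ~~ (3 %| n.*2.+1)%N ->
  psi ((n.*2.+1)%:R ^+ 2 * A) = ((-1) ^+ n.+1 * (n.*2.+1)%:R)%:~R.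
Proof.
move=> n3; have e9 : eta9 ((n.*2.+1)%:R ^+ 2 * A) = 0.
  apply: euler9_out => j; apply/eqP => /odd_sqr_inj e.
  by move: n3; rewrite e dvdn_mulr.
apply: etrans (psiE (euler1_coef n) e9) _.
by rewrite mulr0 addr0 -rmorphN exprS mulN1r mulNr.
Qed.

(** At an odd multiple [2n+1 = 3(2j+1)] one has [n = 3j+1], so [eta1] contributes
    [- (-1)^j 3 (2j+1)], which [3 eta9] cancels. *)
Lemma psi_out (x : R) :
  (forall n : nat, ~~ (3 %| n.*2.+1)%N -> x != (n.*2.+1)%:R ^+ 2 * A) -> psi x = 0.
Proof.
move=> H; have [[n xn]|nn] := pselect (exists n : nat, x = (n.*2.+1)%:R ^+ 2 * A); last first.
  have e1 : eta1 x = 0.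
    by apply: euler1_out => n; apply/eqP => e; apply: nn; exists n.
  have e9 : eta9 x = 0.
    apply: euler9_out => j; apply/eqP => e; apply: nn.
    by exists (3 * j).+1; rewrite e; congr (_%:R ^+ 2 * A); lia.
  by apply: etrans (psiE e1 e9) _; rewrite mulr0 addr0 oppr0.
have n3 : (3 %| n.*2.+1)%N.
  by apply/negPn/negP => n3; have := H n n3; rewrite xn eqxx.
have [j jE] : exists j, n = (3 * j).+1.
  by move: n3 => /dvdnP[k kE]; exists (n %/ 3)%N; lia.
have e : (n.*2.+1 = 3 * j.*2.+1)%N by lia.
have e1 : eta1 x = ((-1) ^+ n * (3 * j.*2.+1)%:R)%:~R by rewrite xn (euler1_coef n) e.
have e9 : eta9 x = ((-1) ^+ j * (j.*2.+1)%:R)%:~R by rewrite xn e (euler9_coef j).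
have s3 : (-1) ^+ 3 = -1 :> int by [].
apply: etrans (psiE e1 e9) _.
by rewrite jE exprS exprM s3 natrM !(rmorphM, rmorphN) /=; ring.
Qed.

Definition W333 : Lxyz :=
  phi *: X_ (monomial3 3 0 0) - phi *: X_ (monomial3 0 3 0) +
  phi *: X_ (monomial3 0 0 3) + psi *: X_ (monomial3 1 1 1).

Lemma monomial3_eq m n l m' n' l' :
  (monomial3 m n l == monomial3 m' n' l') = [&& m == m', n == n' & l == l'].
Proof.
apply/eqP/and3P => [e|[/eqP -> /eqP -> /eqP ->]//].
have := congr1 (fun k : multinom 3 => val (val k)) e => /= -[-> -> ->].
by rewrite !eqxx.
Qed.

Lemma W333_coef m n l (x : R) : mcoeff (monomial3 m n l) W333 x =
  phi x * ((m, n, l) == (3, 0, 0)%N)%:R - phi x * ((m, n, l) == (0, 3, 0)%N)%:R +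
  phi x * ((m, n, l) == (0, 0, 3)%N)%:R + psi x * ((m, n, l) == (1, 1, 1)%N)%:R.
Proof.
have bE (f : Lambda) (b : bool) : (f * b%:R) x = f x * b%:R.
  by rewrite mulrC natr_mulE mulrC.
rewrite /W333 !(mcoeffD, mcoeffN, mcoeffZ, mcoeffX) !monomial3_eq.
rewrite -!bE ![_ == (_, _)]xpair_eqE.
by rewrite ![3%N == _]eq_sym ![0%N == _]eq_sym ![1%N == _]eq_sym -!andbA.
Qed.

Definition scaling (s : 'I_3 -> Lambda) : 3.-tuple Lxyz := [tuple s i *: var i | i < 3].

Lemma comp_scaling (s : 'I_3 -> Lambda) i : comp_mpoly (scaling s) (var i) = s i *: var i.
Proof. by rewrite comp_mpolyXU -tnth_nth tnth_mktuple. Qed.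

Lemma scaling_coordinate_change (s : 'I_3 -> Lambda) :
  (forall i, s i \is a GRing.unit) -> coordinate_change (scaling s).
Proof.
move=> su; exists (scaling (fun i => (s i)^-1)) => i.
rewrite !tnth_mktuple !linearZ /= !comp_scaling !scalerA.
by rewrite mulrV ?su // mulVr ?su // scale1r.
Qed.

Lemma comp_scaling_monomial (s : 'I_3 -> Lambda) m n l :
  comp_mpoly (scaling s) (X_ (monomial3 m n l)) =
    (s 0 ^+ m * s 1 ^+ n * s (1 + 1) ^+ l) *:
      (var 0 ^+ m * var 1 ^+ n * var (1 + 1) ^+ l).
Proof.
rewrite comp_mpolyX !big_ord_recl big_ord0 !tnth_mktuple mulr1.
have -> : lift ord0 (ord0 : 'I_2) = 1 :> 'I_3 by apply/val_inj.
have -> : lift ord0 (lift (ord0 : 'I_2) (ord0 : 'I_1)) = 1 + 1 :> 'I_3 by apply/val_inj.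
rewrite -[ord0]/(0 : 'I_3) /=.
rewrite !exprZn -!scalerAl -!scalerAr !scalerA mulrA; congr (_ *: _).
by rewrite mulrA.
Qed.

Lemma nov_three_unit : (3%:R : Lambda) \is a GRing.unit.
Proof.
apply/(@nov_unitPl R _ (nov_series A_gt0 (fun n => if n == 0%N then 3%:R^-1 else 0))).
rewrite mulrC -[RHS](poly_series1 A_gt0); apply: nov_series_ext => [n|x xn]; rewrite natr_mulE.
  rewrite nov_seriesE coef1; case: n => [|n]; last by rewrite mulr0.
  by rewrite divff // pnatr_eq0.
by rewrite nov_series_out // mulr0.
Qed.

Lemma W333_mirror : equal_up_to_coordinates W333 (W_LG (inverse_mirror_map q)).
Proof.
have E9u : euler_prod (q ^+ 9) \is a GRing.unit.
  by rewrite q9_exp; exact: euler_prod_unit A72_gt0.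
have qau : qa \is a GRing.unit := nov_T_unit A.
set E9 := euler_prod (q ^+ 9) in E9u *; set E1 := euler_prod q.
(* An explicit cube root of [1 / phi], available because [phi] is minus a cube. *)
pose lam : Lambda := - (qa ^+ 3 * E9)^-1.
have lamu : lam \is a GRing.unit by rewrite unitrN unitrV unitrM unitrX.
(* The sign on [y] corrects the coefficient [- phi] of [y^3] and reverses the sign of the [xyz]
   term. *)
pose s (i : 'I_3) : Lambda := if i == 1 then - lam else lam.
have su i : s i \is a GRing.unit by rewrite /s; case: ifP => _ //; rewrite unitrN.
exists (scaling s); split; first exact: scaling_coordinate_change.
have lam3 : lam ^+ 3 * phi = 1.
  rewrite /lam /phi /eta9 -/E9 exprNn -signr_odd /= expr1 exprVn !mulN1r mulrNN.
  have -> : qa ^+ 9 * E9 ^+ 3 = (qa ^+ 3 * E9) ^+ 3 by rewrite exprMn -exprM.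
  by rewrite mulVr // unitrX // unitrM unitrX.
have psi3 : - (lam ^+ 3 * psi) = inverse_mirror_map q.
  rewrite /inverse_mirror_map /cubic_a -/E1 -/E9 /lam /psi /eta1 /eta9 -/E1 -/E9.
  rewrite invrM ?unitrX // -!exprVn.
  have hq : qa * qa^-1 = 1 by rewrite divrr.
  have h9 : E9 * E9^-1 = 1 by rewrite divrr.
  have h3 : (3%:R : Lambda) * 3%:R^-1 = 1 by rewrite divrr // nov_three_unit.
  (* The inverses become variables, so that [ring] only has to regroup the products fixed by [hq],
     [h9] and [h3]. *)
  move: (qa^-1) (E9^-1) (3%:R^-1) hq h9 h3 => iq i9 i3 hq h9 h3.
  transitivity (- (iq ^+ 8 * (qa * iq) * i9 ^+ 3 * E1 ^+ 3 +
    3%:R * (qa * iq) ^+ 9 * (E9 * i9) ^+ 3)); first by ring.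
  transitivity (- (3%:R + (3%:R * i3) * iq ^+ 8 * (E1 * i9) ^+ 3)); last by ring.
  by rewrite hq h9 h3; ring.
rewrite /W333 !linearD /= linearN /= !linearZ /= !comp_scaling_monomial !scalerA.
rewrite /s /= !expr0 !expr1 !mul1r !mulr1.
have e1 : phi * lam ^+ 3 = 1 by rewrite mulrC.
have e2 : phi * (- lam) ^+ 3 = -1 by rewrite -e1; ring.
have e3 : psi * (lam * (- lam) * lam) = inverse_mirror_map q by rewrite -psi3; ring.
rewrite scalerN scalerA e1 e2 e3 !scale1r scaleN1r opprK.
have v0 : inord 0 = 0 :> 'I_3 by apply/val_inj; rewrite /= inordK.
have v1 : inord 1 = 1 :> 'I_3 by apply/val_inj; rewrite /= inordK.
have v2 : inord 2 = 1 + 1 :> 'I_3 by apply/val_inj; rewrite /= inordK.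
by rewrite /W_LG v0 v1 v2.
Qed.

End SuperpotentialCoefficients.

(** * Residues modulo 3 along the sides and at the corners *)

Section ResidueCounts.
Implicit Types (k : 'I_3 -> int).

Definition residues_below (N : nat) (x : int) : nat :=
  (\sum_(0 <= d < N) (3 %| (d%:Z - x)%R)%Z)%N.

Definition corner_type k (j : 'I_3) : int := k j - k (j + 1).

Lemma residue_countE k rho N :
  residue_count k rho N = (\sum_(j < 3) residues_below N (rho - corner_type k j)%R)%N.
Proof.
rewrite /residue_count -sum1_card big_mkcond /=.
rewrite -(pair_bigA _ (fun (j : 'I_3) (d : 'I_N) =>
  if (3 %| (k j - k (j + 1)%R + d%:Z - rho)%R)%Z then 1%N else 0%N)) /=.
apply: eq_bigr => j _; rewrite /residues_below big_mkord; apply: eq_bigr => d _.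
have -> : k j - k (j + 1) + d%:Z - rho = d%:Z - (rho - corner_type k j).
  by rewrite /corner_type; ring.
by case: ifP.
Qed.

Lemma residues_below_add3 N x : residues_below (N + 3) x = (residues_below N x).+1.
Proof.
rewrite /residues_below addnS addn2 !big_nat_recr //= -!addnA -[RHS]addn1; congr addn.
have : (((3 %| (N%:Z - x)%R)%Z + ((3 %| (N.+1%:Z - x)%R)%Z + (3 %| (N.+2%:Z - x)%R)%Z)) = 1)%N.
  by lia.
by [].
Qed.

Lemma residues_below_mul3 p r x : residues_below (3 * p + r) x = (p + residues_below r x)%N.
Proof.
elim: p => [|p IH]; first by rewrite muln0.
have -> : (3 * p.+1 + r = 3 * p + r + 3)%N by lia.
by rewrite residues_below_add3 IH.
Qed.

Lemma residues_below_congr N x y : (3 %| (x - y)%R)%Z ->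
  residues_below N x = residues_below N y.
Proof.
move=> xy; apply: eq_bigr => d _; congr nat_of_bool.
by move: (d%:Z) => z; lia.
Qed.

(** Modulo 3 the type drops by [tsum k] from one corner to the next: all three types agree if 3
    divides it, and they are distinct otherwise. *)
Lemma corner_type_succ k j : corner_type k (j + 1) = corner_type k j - tsum k + 3 * k (j + 1).
Proof. by rewrite (tsum_around j) /corner_type; ring. Qed.

Lemma corner_type_all k : (3 %| tsum k)%Z ->
  forall j, (3 %| (corner_type k j - corner_type k 0)%R)%Z.
Proof.
move=> k3; have e1 := corner_type_succ k 0; have e2 := corner_type_succ k (0 + 1).
rewrite add0r in e1 e2; apply: ord3P; rewrite ?subrr //.
  by rewrite e1; move: (corner_type k 0) (tsum k) (k 1) k3 => x y z; lia.
by rewrite e2 e1; move: (corner_type k 0) (tsum k) (k 1) (k (1 + 1)) k3 => x y z w; lia.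
Qed.

Lemma corner_type_one k t : ~~ (3 %| tsum k)%Z ->
  (\sum_(j < 3) (3 %| (corner_type k j - t)%R)%Z = 1)%N.
Proof.
move=> k3; have e1 := corner_type_succ k 0; have e2 := corner_type_succ k (0 + 1).
rewrite add0r in e1 e2; rewrite !big_ord_recl big_ord0 addn0.
have -> : lift ord0 (ord0 : 'I_2) = 1 :> 'I_3 by apply/val_inj.
have -> : lift ord0 (lift (ord0 : 'I_2) (ord0 : 'I_1)) = 1 + 1 :> 'I_3 by apply/val_inj.
rewrite -[ord0]/(0 : 'I_3) e2 e1.
by move: (corner_type k 0) (tsum k) (k 1) (k (1 + 1)) k3 => x y z w; lia.
Qed.

(** The three types being distinct modulo 3, each position [d] has the required residue on exactly
    one side. *)
Lemma residue_count_generic k rho N : ~~ (3 %| tsum k)%Z -> residue_count k rho N = N.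
Proof.
move=> k3; rewrite residue_countE /residues_below exchange_big /=.
rewrite (eq_bigr (fun=> 1%N)); first by rewrite sum_nat_const_nat subn0 muln1.
move=> d _; apply: etrans (corner_type_one (rho - d%:Z) k3); apply: eq_bigr => j _.
by congr (nat_of_bool (dvdz _ _)); ring.
Qed.

Lemma residue_count_special k rho N : (3 %| tsum k)%Z ->
  residue_count k rho N = (3 * residues_below N (rho - corner_type k 0)%R)%N.
Proof.
move=> k3; rewrite residue_countE (eq_bigr (fun=> residues_below N (rho - corner_type k 0))).
  by rewrite sum_nat_const card_ord.
move=> j _; apply: residues_below_congr; have := corner_type_all k3 j.
by move: (corner_type k j) (corner_type k 0) => x y; lia.
Qed.

Lemma corner_type_card_generic k t : ~~ (3 %| tsum k)%Z ->
  #|[pred j : 'I_3 | (3 %| (k j - k (j + 1)%R - t)%R)%Z]| = 1%N.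
Proof.
move=> k3; rewrite -sum1_card big_mkcond -[RHS](corner_type_one t k3) /=.
by apply: eq_bigr => j _; rewrite /corner_type unfold_in /=; case: ifP.
Qed.

Lemma corner_type_card_special k t : (3 %| tsum k)%Z ->
  #|[pred j : 'I_3 | (3 %| (k j - k (j + 1)%R - t)%R)%Z]| =
    if (3 %| (corner_type k 0 - t)%R)%Z then 3%N else 0%N.
Proof.
move=> k3; have H j : (3 %| (k j - k (j + 1)%R - t)%R)%Z = (3 %| (corner_type k 0 - t)%R)%Z.
  have := corner_type_all k3 j; rewrite -[k j - k (j + 1)]/(corner_type k j).
  by move: (corner_type k j) (corner_type k 0) => x y; lia.
case: ifP => h.
  by rewrite (eq_card (B := predT)) ?card_ord // => j; rewrite !inE H h.
by rewrite (eq_card (B := pred0)) ?card0 // => j; rewrite !inE H h.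
Qed.

(** The sum and one corner type modulo 3 determine the deck orbit; the rotation index [- i] carries
    corner [i] to corner 0. *)
Lemma tri_orbit k k' i : tsum k = tsum k' -> (3 %| (corner_type k' 0 - corner_type k i)%R)%Z ->
  exists g : deck, forall j, k' j = k (j - g.1) + offset g j.
Proof.
move=> kk' ti.
have [||g g1 go] := @offset_exists (- i) (fun j => k' j - k (j + i)).
- move: kk'; rewrite (tsum_around i k) /tsum add0r (addrC 1 i) (addrC (1 + 1) i) (addrA i).
  by move=> e; rewrite -[RHS](subrr (k' 0 + k' 1 + k' (1 + 1))) -{2}e; ring.
- move: ti; rewrite /corner_type !add0r (addrC 1 i) => /dvdzP[m e]; apply/dvdzP; exists m.
  by rewrite -e; ring.
by exists g => j; rewrite go g1 opprK addrC subrK.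
Qed.

Lemma corner_type_deck k k' (g : deck) : (forall j, k' j = k (j - g.1) + offset g j) ->
  tsum k' = tsum k /\ (3 %| (corner_type k' 0 - corner_type k (- g.1))%R)%Z.
Proof.
move=> e; have -> : k' = fun j => k (j - g.1) + offset g j by apply/funext.
split; first exact: tsum_shift.
have := offset_mod3 g 0; rewrite /corner_type !add0r (addrC 1 (- g.1)) => /dvdzP[m em].
by apply/dvdzP; exists m; rewrite -em; ring.
Qed.

End ResidueCounts.

(** * Weights of the polygon classes and the Floer potential *)

Section Floer.
Variable R : realType.
Local Notation C := (R[i]^o).
Implicit Types (P Q : Defs.pmap R) (k : 'I_3 -> int).

Local Notation area0 := (4^-1 ^+ 2 / Num.sqrt 3 : R).

Lemma area0_gt0 : 0 < area0.
Proof. by rewrite divr_gt0 ?exprn_gt0 ?invr_gt0 // sqrt3_gt0. Qed.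

Lemma area_tri k (n : nat) : tsum k = n%:Z - 1 ->
  planar_area (@tri R k) = ((n.*2.+1)%:R ^+ 2 * area0)%:E.
Proof.
move=> kn; rewrite planar_area_tri; last by rewrite kn; lia.
have e : (n.*2.+1)%:R = n%:R + n%:R + 1 :> R by rewrite -[LHS]natr1 -addnn natrD.
congr EFin; rewrite kn rmorphB /= e.
by field; rewrite gt_eqF // sqrt3_gt0.
Qed.

Lemma polygon_data P : polygon P -> exists k (n : nat),
  [/\ tsum k = n%:Z - 1, image_of P = tri k &
      polygon_area P = ((n.*2.+1)%:R ^+ 2 * area0)%:E].
Proof.
move=> polP; have [k k0 PT] := polygon_image polP.
exists k, (absz (tsum k + 1)).
have kn : tsum k = (absz (tsum k + 1))%:Z - 1 by move: (tsum k) k0 => x; lia.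
by split=> //; rewrite (polygon_area_tri polP k0 PT); exact: area_tri.
Qed.

Lemma polygon_of_tri k (n : nat) : tsum k = n%:Z - 1 -> exists P,
  [/\ polygon P, image_of P = @tri R k &
      polygon_area P = ((n.*2.+1)%:R ^+ 2 * area0)%:E].
Proof.
move=> kn; have k0 : -1 <= tsum k by rewrite kn; lia.
have polP := polygon_tri R k0; have PT : image_of (PMap (@tri R k) id) = tri k.
  by rewrite /image_of /= image_id.
by exists (PMap (tri k) id); split=> //; rewrite (polygon_area_tri polP k0 PT) (area_tri kn).
Qed.

Variables (X Y Z e : C) (i jX jY jZ : 'I_3) (a b cX dX cY dY cZ dZ : int) (theta : R).
Hypothesis theta01 : 0 < theta < 1.
Hypothesis he : on_line i a b theta e.
Hypotheses (hX : on_line jX cX dX 0 X) (hY : on_line jY cY dY 0 Y)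
  (hZ : on_line jZ cZ dZ 0 Z).
Local Notation eps := (a - b).
Local Notation tX := (cX - dX).
Local Notation tY := (cY - dY).
Local Notation tZ := (cZ - dZ).
Hypothesis tYe : (3 %| (tY - eps - 1)%R)%Z.
Hypothesis tXZe : (3 %| (tX - eps)%R)%Z && (3 %| (tZ - eps + 1)%R)%Z ||
  (3 %| (tX - eps + 1)%R)%Z && (3 %| (tZ - eps)%R)%Z.

(** Here [s(P) = n + 1], [s(P^op) = n] and [r(P) = 1]. *)
Lemma weight_generic P k (n : nat) : polygon P -> tsum k = n%:Z - 1 ->
  image_of P = tri k -> ~~ (3 %| tsum k)%Z ->
  polygon_weight e P = ((-1) ^+ n.+1 * (n.*2.+1)%:R : int)%:~R.
Proof.
move=> polP kn PT k3; have k0 : -1 <= tsum k by rewrite kn; lia.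
rewrite /polygon_weight (s_number_tri (N := n.+1) polP k0 PT theta01 he); last by lia.
rewrite (s_number_reflect (N := n) polP k0 PT theta01 he); last by lia.
rewrite (r_number_tri polP k0 PT) (negbTE k3) !residue_count_generic //.
by rewrite divr1 rmorphM rmorphXn rmorphN1 /= addSn addnn rmorph_nat.
Qed.

(** The rotation of order 3 makes both boundary counts multiples of 3, which [r(P) = 3] compensates
    in the quotient; the sign keeps the parity of [s(P)]. *)
Lemma weight_special P k (p : nat) : polygon P -> tsum k = (3 * p)%:Z ->
  image_of P = tri k ->
  polygon_weight e P =
    ((if (3 %| (corner_type k 0 - tY)%R)%Z then (-1) ^+ p else (-1) ^+ p.+1) *
    (p.*2.+1)%:R : int)%:~R.
Proof.
move=> polP kp PT; have k0 : -1 <= tsum k by rewrite kp; lia.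
have k3 : (3 %| tsum k)%Z by rewrite kp; lia.
rewrite /polygon_weight (s_number_tri (N := (3 * p + 2)%N) polP k0 PT theta01 he); last by lia.
rewrite (s_number_reflect (N := (3 * p + 1)%N) polP k0 PT theta01 he); last by lia.
rewrite (r_number_tri polP k0 PT) k3 !residue_count_special // !residues_below_mul3.
(* Of the positions left after [p] full periods, exactly one has the residue of [e]. It belongs to
   the count for [P^op] when the corners have type [Y] and to that for [P] otherwise, whence the
   opposite sign of [y^3]. *)
have c2 : residues_below 2 (eps - corner_type k 0) =
    (if (3 %| (corner_type k 0 - tY)%R)%Z then 0 else 1)%N.
  rewrite /residues_below !big_nat_recr //= big_geq // add0n.
  by move: (corner_type k 0) tYe => x; case: ifP; lia.
have c1 : residues_below 1 (eps + 1 - corner_type k 0) =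
    (if (3 %| (corner_type k 0 - tY)%R)%Z then 1 else 0)%N.
  rewrite /residues_below big_nat1.
  by move: (corner_type k 0) tYe => x; case: ifP; lia.
rewrite c1 c2 -mulnDr natrM mulrCA [3%:R * _]mulrC mulrK; last first.
  by rewrite unitfE pnatr_eq0.
have s3 m : (-1) ^+ (3 * m) = (-1) ^+ m :> R[i].
  by rewrite exprM; congr (_ ^+ _); rewrite !exprS expr0; ring.
rewrite s3 rmorphM /= rmorph_nat; case: ifP => _; rewrite rmorphXn rmorphN1 /=; congr (_ * _%:R).
- by rewrite addn0.
- by rewrite -addnn; lia.
- by rewrite addn1.
- by rewrite -addnn; lia.
Qed.

(** The weight of a class is computed on a chosen representative [Q]; its triangle lies in the same
    deck orbit, so it has the same sum and, when 3 divides the sum, the same common corner type. *)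
Lemma class_weight_eq P k : polygon P -> image_of P = tri k -> -1 <= tsum k ->
  exists Q k', [/\ polygon Q, image_of Q = tri k', tsum k' = tsum k,
    (3 %| tsum k)%Z -> (3 %| (corner_type k' 0 - corner_type k 0)%R)%Z &
    class_weight e (polygon_class P) = polygon_weight e Q].
Proof.
move=> polP PT k0; rewrite /class_weight.
have : polygon_class P (xget (PMap set0 id) (polygon_class P)).
  by apply: xgetPex; exists P; exact: polygon_class_refl.
set Q := xget _ _ => /(polygon_classP Q polP)[polQ [g QT]].
have [sk tk] := @corner_type_deck k (fun j => k (j - g.1) + offset g j) g (fun=> erefl).
exists Q, (fun j => k (j - g.1) + offset g j); split=> //.
  by rewrite QT PT tri_deck.
move=> k3; have := corner_type_all k3 (- g.1); move: tk.
by move: (corner_type _ 0) (corner_type k _) (corner_type k 0) => x y z; lia.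
Qed.

Let S := polygon_classes X Y Z.

Lemma corner_types P k : polygon P -> image_of P = tri k -> -1 <= tsum k ->
  [/\ corner_number P X = #|[pred j : 'I_3 | (3 %| (k j - k (j + 1)%R - tX)%R)%Z]|,
      corner_number P Y = #|[pred j : 'I_3 | (3 %| (k j - k (j + 1)%R - tY)%R)%Z]| &
      corner_number P Z = #|[pred j : 'I_3 | (3 %| (k j - k (j + 1)%R - tZ)%R)%Z]|].
Proof.
by move=> polP PT k0; split; [rewrite (corner_number_tri polP k0 PT hX)
  | rewrite (corner_number_tri polP k0 PT hY) | rewrite (corner_number_tri polP k0 PT hZ)].
Qed.

(** The area determines [tsum], odd squares being distinct, and the corner numbers then determine
    the residue that classifies the orbit. *)
Lemma classes_set1 P : polygon P -> forall r, polygon_area P = r%:E ->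
  S (corner_number P X) (corner_number P Y) (corner_number P Z) r = [set polygon_class P].
Proof.
move=> polP r Pr; apply/seteqP; split=> [_ [P' [polP' [cX' cY' cZ'] P'r] <-]|_ ->]; last first.
  by exists P.
have [k [n [kn PT Pa]]] := polygon_data polP.
have [k' [n' [kn' PT' Pa']]] := polygon_data polP'.
have nn : n' = n.
  have /odd_sqr_inj : (n'.*2.+1)%:R ^+ 2 * area0 = (n.*2.+1)%:R ^+ 2 * area0 :> R.
    by apply: EFin_inj; rewrite -Pa -Pa' Pr P'r.
  by move=> /(_ area0_gt0); lia.
rewrite nn in kn'; have kk' : tsum k = tsum k' by rewrite kn kn'.
have k0 : -1 <= tsum k by rewrite kn; lia.
have k0' : -1 <= tsum k' by rewrite kn'; lia.
(* If 3 does not divide the sum, the corners of [k] realize all residues. Otherwise the double point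
   whose corner number is 3 identifies the common type. *)
have [j tj] : exists j, (3 %| (corner_type k' 0 - corner_type k j)%R)%Z.
  have [k3|k3] := boolP (3 %| tsum k)%Z; last first.
    apply: contrapT => H; have := corner_type_one (corner_type k' 0) k3; rewrite big1 // => j _.
    apply/eqP; rewrite eqb0; apply/negP => tj; apply: H; exists j.
    by move: tj; move: (corner_type k j) (corner_type k' 0) => x y; lia.
  have k3' : (3 %| tsum k')%Z by rewrite -kk'.
  exists 0.
  have [eX eY eZ] := corner_types polP PT k0; have [eX' eY' eZ'] := corner_types polP' PT' k0'.
  move: cX' cY' cZ'; rewrite eX eY eZ eX' eY' eZ' !corner_type_card_special //.
  move: (corner_type k 0) (corner_type k' 0) tYe tXZe => x y hY' hXZ'.
  have [x1|[x1|x1]] : (3 %| (x - tX)%R)%Z \/ (3 %| (x - tY)%R)%Z \/ (3 %| (x - tZ)%R)%Z by lia.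
  - by rewrite x1; case: ifP => // y1 _ _ _; lia.
  - by rewrite x1; case: (ifP (3 %| (y - tY)%R)%Z) => // y1 _ _ _; lia.
  - by rewrite x1; case: (ifP (3 %| (y - tZ)%R)%Z) => // y1 _ _ _; lia.
have [g gk] := tri_orbit kk' tj.
apply/esym/(polygon_class_eq (g := g)) => //.
by rewrite PT PT' tri_deck; congr tri; apply/funext.
Qed.

(** The triple [(t, 0, 3p - t)] has all its corners of type [t]; the three double points give the
    three cubes. *)
Lemma classes_special (p : nat) (t : int) :
  S (if (3 %| (t - tX)%R)%Z then 3%N else 0%N) (if (3 %| (t - tY)%R)%Z then 3%N else 0%N)
    (if (3 %| (t - tZ)%R)%Z then 3%N else 0%N) ((3 * p.*2.+1)%:R ^+ 2 * area0) !=set0.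
Proof.
pose k (j : 'I_3) : int := if j == 0 then t else if j == 1 then 0 else 3 * p%:Z - t.
have kE : tsum k = (3 * p)%:Z by rewrite /tsum /k /=; lia.
have kn : tsum k = (3 * p).+1%:Z - 1 by lia.
have k3 : (3 %| tsum k)%Z by rewrite kE; lia.
have k0 : corner_type k 0 = t by rewrite /corner_type /k /= subr0.
have [P [polP PT Pa]] := polygon_of_tri kn; have k1 : -1 <= tsum k by lia.
have [eX eY eZ] := corner_types polP PT k1; rewrite !corner_type_card_special // k0 in eX eY eZ.
exists (polygon_class P); exists P => //; split=> //; rewrite Pa.
by congr (_%:R ^+ 2 * _)%:E; lia.
Qed.

Lemma classes_generic (n : nat) : ~~ (3 %| n.*2.+1)%N ->
  S 1 1 1 ((n.*2.+1)%:R ^+ 2 * area0) !=set0.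
Proof.
move=> n3; pose k (j : 'I_3) : int := if j == 0 then n%:Z - 1 else 0.
have kn : tsum k = n%:Z - 1 by rewrite /tsum /k /= !addr0.
have k3 : ~~ (3 %| tsum k)%Z by rewrite kn; lia.
have [P [polP PT Pa]] := polygon_of_tri kn; have k1 : -1 <= tsum k by lia.
have [eX eY eZ] := corner_types polP PT k1; rewrite !corner_type_card_generic // in eX eY eZ.
by exists (polygon_class P); exists P.
Qed.

Lemma Floer_potential_W333 : Floer_potential X Y Z e (W333 area0).
Proof.
move=> m n l r; rewrite W333_coef.
(* If there is no class, the coefficient must vanish: by [classes_special] and [classes_generic],
   every area in the support of [phi] or [psi] is realized with the corner numbers of its
   monomials. *)
have [[c Sc]|S0] := pselect (S m n l r !=set0); last first.
  have -> : polygon_classes X Y Z m n l r = set0.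
    by apply/seteqP; split=> // c Sc; apply: S0; exists c.
  split; first exact: finite_set0.
  rewrite fsbig_set0.
  have phi0 t : (m, n, l) = (if (3 %| (t - tX)%R)%Z then 3%N else 0%N,
      if (3 %| (t - tY)%R)%Z then 3%N else 0%N,
      if (3 %| (t - tZ)%R)%Z then 3%N else 0%N) -> phi area0 r = 0.
    move=> [em en el]; apply: phi_out => [|p]; first exact: area0_gt0.
    by apply/eqP => re; apply: S0; rewrite em en el re; exact: classes_special.
  (* The three double points have pairwise distinct residues modulo 3. *)
  have tE : [/\ (3 %| (tX - tY)%R)%Z = false, (3 %| (tX - tZ)%R)%Z = false,
      (3 %| (tY - tX)%R)%Z = false, (3 %| (tY - tZ)%R)%Z = false &
      (3 %| (tZ - tX)%R)%Z = false /\ (3 %| (tZ - tY)%R)%Z = false].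
    by move: tYe tXZe; move: tX tY tZ eps => x y z u hy hxz; split; try split;
      apply/negP; lia.
  case: tE => xy xz yx yz [zx zy].
  have z1 : phi area0 r * ((m, n, l) == (3, 0, 0)%N)%:R = 0.
    case: eqP => [E|_]; rewrite ?mulr0 // (phi0 tX) ?mul0r //.
    by rewrite xy xz subrr dvdz0.
  have z2 : phi area0 r * ((m, n, l) == (0, 3, 0)%N)%:R = 0.
    case: eqP => [E|_]; rewrite ?mulr0 // (phi0 tY) ?mul0r //.
    by rewrite yx yz subrr dvdz0.
  have z3 : phi area0 r * ((m, n, l) == (0, 0, 3)%N)%:R = 0.
    case: eqP => [E|_]; rewrite ?mulr0 // (phi0 tZ) ?mul0r //.
    by rewrite zx zy subrr dvdz0.
  have z4 : psi area0 r * ((m, n, l) == (1, 1, 1)%N)%:R = 0.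
    case: eqP => [[em en el]|_]; rewrite ?mulr0 // (psi_out area0_gt0) ?mul0r //.
    by move=> j j3; apply/eqP => re; apply: S0; rewrite em en el re; exact: classes_generic.
  by rewrite z1 z2 z3 z4 subr0 !addr0.
case: Sc => P [polP [<- <- <-] Pr] _.
rewrite -[polygon_classes _ _ _ _ _ _ _]/(S _ _ _ _) (classes_set1 polP Pr).
split; first exact: finite_set1.
rewrite fsbig_set1; have [k [n0 [kn PT Pa]]] := polygon_data polP.
have k0 : -1 <= tsum k by rewrite kn; lia.
have rE : r = (n0.*2.+1)%:R ^+ 2 * area0 by apply: EFin_inj; rewrite -Pr Pa.
have [Q [k' [polQ QT kk' tk' ->]]] := class_weight_eq polP PT k0.
have [-> -> ->] := corner_types polP PT k0.
have [k3|k3] := boolP (3 %| tsum k)%Z; last first.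
  rewrite !corner_type_card_generic // eqxx /= !mulr0 subr0 !add0r mulr1 rE.
  have kn' : tsum k' = n0%:Z - 1 by rewrite kk'.
  rewrite (weight_generic polQ kn' QT) ?kk' //.
  by apply: psi_coef; [exact: area0_gt0 | lia].
have [p pE] : exists p : nat, n0 = (3 * p).+1.
  by exists (n0 %/ 3)%N; move: k3; rewrite kn; lia.
have kp : tsum k' = (3 * p)%:Z by rewrite kk' kn pE; lia.
rewrite !corner_type_card_special // (weight_special (p := p) polQ kp QT).
have r3 : r = (3 * p.*2.+1)%:R ^+ 2 * area0.
  by rewrite rE pE; congr (_%:R ^+ 2 * _); lia.
rewrite r3 phi_coef; last exact: area0_gt0.
move: (tk' k3) tYe tXZe; move: (corner_type k' 0) (corner_type k 0) tX tY tZ eps.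
move=> x' x x1 y1 z1 u h1 h2 h3.
have -> : (3 %| (x' - y1)%R)%Z = (3 %| (x - y1)%R)%Z by lia.
have [hx|[hx|hx]] : [/\ (3 %| (x - x1)%R)%Z, ~~ (3 %| (x - y1)%R)%Z & ~~ (3 %| (x - z1)%R)%Z] \/
  [/\ ~~ (3 %| (x - x1)%R)%Z, (3 %| (x - y1)%R)%Z & ~~ (3 %| (x - z1)%R)%Z] \/
  [/\ ~~ (3 %| (x - x1)%R)%Z, ~~ (3 %| (x - y1)%R)%Z & (3 %| (x - z1)%R)%Z].
- have : (3 %| (x - x1)%R)%Z \/ (3 %| (x - y1)%R)%Z \/ (3 %| (x - z1)%R)%Z by lia.
  by case=> [hx|[hx|hx]]; [left|right; left|right; right]; split; lia.
- case: hx => h4 /negbTE h5 /negbTE h6; rewrite h4 h5 h6 !xpair_eqE /= !mulr0 mulr1.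
  by rewrite subr0 !addr0.
- case: hx => /negbTE h4 h5 /negbTE h6; rewrite h4 h5 h6 !xpair_eqE /= !mulr0 mulr1.
  by rewrite sub0r !addr0 -rmorphN exprS mulN1r mulNr opprK.
- case: hx => /negbTE h4 /negbTE h5 h6; rewrite h4 h5 h6 !xpair_eqE /= !mulr0 mulr1.
  by rewrite subr0 add0r addr0.
Qed.

End Floer.

Theorem theorem1p6 (R : realType) (Delta : set R[i]^o) (X Y Z e : R[i]^o)
    (hDelta : upper_triangle Delta X Y Z) (he : open_side X Z e) :
  let q_alpha := nov_T (fine (planar_area Delta)) in
  let q := q_alpha ^+ 8 in
  exists W333, Floer_potential X Y Z e W333 /\
    equal_up_to_coordinates W333 (W_LG (inverse_mirror_map q)).
Proof.
have [k kE [DE _]] := upper_triangle_tri hDelta.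
have -> : fine (planar_area Delta) = 4^-1 ^+ 2 / Num.sqrt 3.
  (* The minimal triangle is the case [n = 0] of the side [2n + 1]. *)
  have kn : tsum k = 0%N%:Z - 1 by rewrite kE.
  by rewrite DE (area_tri R kn) /= expr1n mul1r.
exists (W333 (4^-1 ^+ 2 / Num.sqrt 3)); split; last exact: W333_mirror (area0_gt0 R).
have [i [a [b [theta [theta01 oe]]]]] := upper_triangle_types hDelta he.
move=> [jY [cY [dY [oY tY]]]] [s [s' [jX [cX [dX [jZ [cZ [dZ [oX oZ tX tZ ss]]]]]]]]].
apply: (Floer_potential_W333 theta01 oe oX oY oZ tY).
(* The two cases are the two cyclic orders in which the vertices can be labelled. *)
by case: ss tX tZ => -[-> ->]; rewrite ?subr0 ?opprK => -> ->; rewrite ?orbT.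
Qed.
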